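(* Let $R$ be a noetherian pseudocompact ring, $\sigma$ a topological automorphism of $R$, $\delta$ a continuous $\sigma$-nilpotent left $\sigma$-derivation of $R$, and assume that $S = R[[t;\sigma,\delta]]$ is noetherian and that both $R$ and $S$ are (left and right) Auslander regular. Then for every $j\ge0$ $$\mathfrak{M}^j(R)\cap\mathfrak{M}_R(S)=\mathfrak{M}^{j+1}(S)\cap\mathfrak{M}_R(S),$$ i.e. a left $S$-module $M$ which is finitely generated over $R$ lies in $\mathfrak{M}^j(R)$ (as an $R$-module) if and only if it lies in $\mathfrak{M}^{j+1}(S)$ (as an $S$-module).
   Context: All rings are unital; ''noetherian'' means left and right noetherian. A left pseudocompact ring $R$ is a topological ring which is Hausdorff and complete and has a fundamental system of open neighbourhoods of zero consisting of left ideals $L$ such that $R/L$ has finite length as an $R$-module. A left $\sigma$-derivation is an additive map $\delta:R\to R$ with $\delta(ab)=\delta(a)b+\sigma(a)\delta(b)$. For $k\ge 0$ let $\mathcal{A}_k$ be the set of all noncommutative monomials in $Y,Z,Z'$ with exactly $k$ factors $Y$, and $\mathcal{A}_{\ge l}=\bigcup_{k\ge l}\mathcal{A}_k$. $\delta$ is $\sigma$-nilpotent if for every $n\ge1$ there is $m\ge1$ such that $M(\delta,\sigma,\sigma^{-1})(R)\subseteq \mathrm{Jac}(R)^n$ for all $M\in\mathcal{A}_{\ge m}$ (substitute $\delta,\sigma,\sigma^{-1}$ for $Y,Z,Z'$ and compose; $\mathrm{Jac}$ is the Jacobson radical). The skew power series ring $S=R[[t;\sigma,\delta]]$ is the left $R$-module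 of all formal power series $\sum_{i\ge0}a_it^i$, $a_i\in R$, with the product topology and the continuous multiplication determined by $ta=\sigma(a)t+\delta(a)$; explicitly $\big(\sum_{j} a_jt^j\big)\big(\sum_{l} b_lt^l\big)=\sum_{m\ge0}\big(\sum_{n=0}^m\sum_{j\ge n}a_jM_{j-n,n}(\delta,\sigma)(b_{m-n})\big)t^m$, where $M_{k,l}(Y,Z)$ is the sum of all noncommutative monomials in $Y,Z$ with $k$ factors $Y$ and $l$ factors $Z$. For a noetherian ring $A$ and a finitely generated left or right $A$-module $N$, put $j_A(N):=\min\{i\ge0:\operatorname{Ext}^i_A(N,A)\ne0\}$. $A$ is Auslander regular if every finitely generated (left or right) $A$-module has a finite resolution by finitely generated projective $A$-modules and, for every finitely generated (left or right) $A$-module $N$, every $k\ge0$ and every $A$-submodule $N'\subseteq\operatorname{Ext}^k_A(N,A)$, one has $j_A(N')\ge k$. $\mathfrak{M}^j(A)$ is the full subcategory of finitely generated left $A$-modules $M$ such that $\operatorname{Ext}^i_A(M',A)=0$ for all $i<j$ and all submodules $M'\subseteq M$. $\mathfrak{M}_R(S)$ is the category of left $S$-modules which are finitely generated as $R$-modules. *)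

(* Defs.v *)
From HB Require Import structures.
From mathcomp Require Import all_boot all_order all_algebra.
From mathcomp Require Import boolp classical_sets functions cardinality fsbigop.
From mathcomp Require Import topology tvs.

Set Implicit Arguments.
Unset Strict Implicit.
Unset Printing Implicit Defensive.

Import GRing.Theory.
Local Open Scope classical_set_scope.
Local Open Scope ring_scope.

(* Rings are [pzRingType]s, so the zero ring is allowed. Left A-modules are
   [lmodType A]; right A-modules are left modules over the converse ring A^c.
   Submodules of M are the closed predicates [submodClosed M]; left ideals of A
   are the submodules of the regular module A^o. *)

Section Submodules.
Variables (A : pzRingType) (M : lmodType A).

Definition submodule (N : submodClosed M) : Type := {x : M | x \in N}.

Section SubmoduleInstances.
Variable N : submodClosed M.
HB.instance Definition _ :=
  [isSub of submodule N for @sval M (fun x => x \in N)].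
HB.instance Definition _ := [Choice of submodule N by <:].
HB.instance Definition _ := [SubChoice_isSubLmodule of submodule N by <:].
End SubmoduleInstances.

Section MakeSubmodule.
Variables (P : set M) (P0 : P 0) (PD : forall x y, P x -> P y -> P (x + y)).
Variable PZ : forall a x, P x -> P (a *: x).

Let pred_of_P : {pred M} := fun x => `[< P x >].

Fact submod_of_closed : GRing.subsemimod_closed pred_of_P.
Proof.
split; first split.
- exact/asboolP.
- by move=> x y /asboolP Px /asboolP Py; apply/asboolP/PD.
- by move=> a x /asboolP Px; apply/asboolP/PZ.
Qed.

Definition submod_of : submodClosed M :=
  HB.pack pred_of_P (GRing.isSubmodClosed.Build A M pred_of_P submod_of_closed).

Lemma submod_ofP x : x \in submod_of <-> P x.
Proof. by split=> [/asboolP|?]; last exact/asboolP. Qed.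
End MakeSubmodule.

Definition zero_submod : submodClosed M.
Proof.
by apply: (@submod_of [set 0]) => //= [x y -> ->|a x ->]; rewrite ?addr0 ?scaler0.
Defined.

Section Quotient.
Variable N : submodClosed M.

Fact submod_zmod_closed : zmod_closed N.
Proof. exact: GRing.subsemimod_closedB (GRing.subsemimodClosedP N). Qed.

Definition zmod_of_submod : zmodClosed M :=
  HB.pack (N : {pred M})
    (GRing.isZmodClosed.Build M (N : {pred M}) submod_zmod_closed).

Definition quotient_module : Type := {ideal_quot zmod_of_submod}.
HB.instance Definition _ := GRing.Zmodule.on quotient_module.

Definition quotient_proj (x : M) : quotient_module :=
  \pi_({ideal_quot zmod_of_submod})%qT x.

Definition quotient_scale (a : A) (x : quotient_module) : quotient_module :=
  quotient_proj (a *: repr (x : {ideal_quot zmod_of_submod})).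

Lemma quotient_projP x y : quotient_proj x = quotient_proj y <-> x - y \in N.
Proof.
have -> : (x - y \in N) = (x - y \in zmod_of_submod) by [].
by rewrite Quotient.idealrBE; split=> /eqP.
Qed.

Lemma quotient_projK x : quotient_proj (repr x) = x.
Proof. exact: reprK. Qed.

Lemma quotient_proj_repr x : x - repr (quotient_proj x) \in N.
Proof. by apply/quotient_projP; rewrite quotient_projK. Qed.

Fact quotient_projD : {morph quotient_proj : x y / x + y}.
Proof. exact: (@pi_addr _ _ _ _ _ {ideal_quot zmod_of_submod}). Qed.

Fact quotient_projZ a x : quotient_proj (a *: x) = quotient_scale a (quotient_proj x).
Proof.
by apply/quotient_projP; rewrite -scalerBr rpredZ // quotient_proj_repr.
Qed.

Fact quotient_scaleA a b x :
  quotient_scale a (quotient_scale b x) = quotient_scale (a * b) x.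
Proof. by rewrite -[x]quotient_projK -!quotient_projZ scalerA. Qed.
Fact quotient_scale1 : left_id 1 quotient_scale.
Proof. by move=> x; rewrite -[x]quotient_projK -!quotient_projZ scale1r. Qed.
Fact quotient_scaleDr : right_distributive quotient_scale +%R.
Proof.
move=> a x y; rewrite -[x]quotient_projK -[y]quotient_projK.
by rewrite -quotient_projD -!quotient_projZ -quotient_projD scalerDr.
Qed.
Fact quotient_scaleDl x : {morph quotient_scale^~ x : a b / a + b}.
Proof.
move=> a b; rewrite -[x]quotient_projK.
by rewrite -!quotient_projZ -quotient_projD scalerDl.
Qed.

HB.instance Definition _ := GRing.Zmodule_isLmodule.Build A quotient_module
  quotient_scaleA quotient_scale1 quotient_scaleDr quotient_scaleDl.

Fact quotient_proj_is_linear : linear quotient_proj.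
Proof. by move=> a x y; rewrite quotient_projD quotient_projZ. Qed.
HB.instance Definition _ := GRing.isLinear.Build A M quotient_module *:%R
  quotient_proj quotient_proj_is_linear.

End Quotient.
End Submodules.

Section LinearMaps.
Variables (A : pzRingType) (M N : lmodType A) (f : {linear M -> N}).

Definition ker : submodClosed M.
Proof.
apply: (@submod_of _ _ [set x | f x = 0]) => /= [|x y|a x].
- exact: linear0.
- by rewrite linearD => -> ->; rewrite addr0.
- by rewrite linearZ /= => ->; rewrite scaler0.
Defined.

Definition im : submodClosed N.
Proof.
apply: (@submod_of _ _ (range f)) => /= [|_ _ [x _ <-] [y _ <-]|a _ [x _ <-]].
- by exists 0 => //; rewrite linear0.
- by exists (x + y) => //; rewrite linearD.
- by exists (a *: x) => //; rewrite linearZ.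
Defined.

Definition preimage_submod (L : submodClosed N) : submodClosed M.
Proof.
apply: (@submod_of _ _ [set x | f x \in L]) => /= [|x y|a x].
- by rewrite linear0 rpred0.
- by rewrite linearD; exact: rpredD.
- by rewrite linearZ; exact: rpredZ.
Defined.
End LinearMaps.

Definition finitely_generated (A : pzRingType) (M : lmodType A) : Prop :=
  exists (n : nat) (g : 'I_n -> M),
    forall x, exists c : 'I_n -> A, x = \sum_(i < n) c i *: g i.

Definition finite_length (A : pzRingType) (M : lmodType A) : Prop :=
  exists (n : nat) (F : nat -> submodClosed M),
    [/\ forall x, x \in F 0 -> x = 0,
        forall x, x \in F n
      & forall i, (i < n)%N ->
          [/\ {subset F i <= F i.+1}, ~ (F i =i F i.+1)
            & forall G : submodClosed M,
                {subset F i <= G} -> {subset G <= F i.+1} ->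
                G =i F i \/ G =i F i.+1]].

Definition left_noetherian (A : pzRingType) : Prop :=
  forall I : submodClosed A^o, finitely_generated (submodule I).

Definition noetherian (A : pzRingType) : Prop :=
  left_noetherian A /\ left_noetherian A^c.

Definition maximal_left_ideal (A : pzRingType) (L : submodClosed A^o) : Prop :=
  ~ (1 : A) \in L /\
  forall G : submodClosed A^o,
    {subset L <= G} -> (1 : A) \in G \/ G =i L.

Definition jacobson (A : pzRingType) : set A :=
  [set x | forall L : submodClosed A^o, maximal_left_ideal L -> x \in L].

Definition ideal_mul (A : pzRingType) (I J : set A) : set A :=
  [set x | exists (n : nat) (a b : 'I_n -> A),
     [/\ forall i, I (a i), forall i, J (b i) & x = \sum_(i < n) a i * b i]].

Definition ideal_exp (A : pzRingType) (I : set A) (n : nat) : set A :=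
  iter n (fun J => ideal_mul J I) setT.

(* The free left A-module on T, as the finitely supported functions T -> A. *)
Section FreeModule.
Variables (A : pzRingType) (T : choiceType).

Definition finsupp_submod : submodClosed (T -> A^o).
Proof.
apply: (@submod_of _ _ [set f | finite_set [set x | f x != 0]]) => /= [|f g|a f].
- rewrite (_ : [set _ | _] = set0) //.
  by rewrite -subset0 => x /=; rewrite eqxx.
- move=> ff fg; apply: (@sub_finite_set _ _ ([set x | f x != 0] `|` [set x | g x != 0])).
    move=> x /=; have [fx0|] := eqVneq (f x) 0; last by left.
    have -> : (f + g) x = g x by rewrite -[RHS]add0r -fx0.
    by right.
  by rewrite finite_setU.
- apply: sub_finite_set => x /=; apply: contra_neq => fx0.
  by rewrite (_ : (a *: f) x = a *: f x) // fx0; exact: scaler0.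
Defined.

Definition free_module : lmodType A := submodule finsupp_submod.

Definition free_coef (f : free_module) (x : T) : A := val f x.

Variables (M : lmodType A) (c : T -> M).

Definition lincomb (f : free_module) : M :=
  \sum_(x \in [set: T]) free_coef f x *: c x.

Lemma lincombE (r : seq T) f : uniq r ->
  (forall x, x \notin r -> free_coef f x = 0) ->
  lincomb f = \sum_(x <- r) free_coef f x *: c x.
Proof.
move=> ur fr; rewrite /lincomb (fsbigE r) //=.
  by apply: eq_bigl => x; rewrite in_setT.
by move=> x _ /fr ->; rewrite scale0r.
Qed.

Lemma free_coef_support (f : free_module) :
  exists2 r : seq T, uniq r & forall x, x \notin r -> free_coef f x = 0.
Proof.
have /submod_ofP/= /finite_seqP[r fr] := valP f.
exists (undup r) => [|x]; first exact: undup_uniq.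
rewrite mem_undup; apply: contraNeq => fx.
by have : [set` r] x by rewrite -fr.
Qed.

Fact lincomb_is_linear : linear lincomb.
Proof.
move=> a f g; have [r ur fr] := free_coef_support f.
have [s us gs] := free_coef_support g.
have ht (h : free_module) :
    (forall x, x \notin r -> x \notin s -> free_coef h x = 0) ->
    lincomb h = \sum_(x <- undup (r ++ s)) free_coef h x *: c x.
  move=> h0; apply: lincombE; first exact: undup_uniq.
  by move=> x; rewrite mem_undup mem_cat negb_or => /andP[]; exact: h0.
rewrite !ht => [|x _ /gs //|x /fr //|x /fr fx /gs gx].
  rewrite scaler_sumr -big_split; apply: eq_bigr => x _ /=.
  by rewrite scalerA -scalerDl.
suff -> : free_coef (a *: f + g) x = a * free_coef f x + free_coef g x.
  by rewrite fx gx mulr0 addr0.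
by [].
Qed.
HB.instance Definition _ := GRing.isLinear.Build A free_module M *:%R
  lincomb lincomb_is_linear.

End FreeModule.

Definition projective (A : pzRingType) (P : lmodType A) : Prop :=
  forall (M N : lmodType A) (g : {linear M -> N}) (f : {linear P -> N}),
    (forall y, exists x, g x = y) ->
    exists h : {linear P -> M}, forall p, g (h p) = f p.

Section FreeIsProjective.
Variables (A : pzRingType) (T : choiceType).

Lemma free_delta_subproof (t : T) :
  (fun x : T => if x == t then 1 else 0 : A^o) \in finsupp_submod A T.
Proof.
apply/submod_ofP/(@sub_finite_set _ _ [set t]); last exact: finite_set1.
by move=> x /=; case: (x =P t) => // _; rewrite eqxx.
Qed.

Definition free_delta (t : T) : free_module A T :=
  exist (fun f => f \in finsupp_submod A T) _ (free_delta_subproof t).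

Lemma lincomb_delta (f : free_module A T) : lincomb free_delta f = f.
Proof.
have [r ur fr] := free_coef_support f.
rewrite (lincombE _ ur fr); apply: val_inj; apply: funext => y.
pose ev (h : free_module A T) : A^o := val h y.
have evs : {morph ev : h k / h + k} by [].
rewrite -/(ev _) (big_morph ev evs (erefl : ev 0 = 0)).
have E x : ev (free_coef f x *: free_delta x) =
           (if x == y then free_coef f y else 0 : A).
  rewrite (_ : ev _ = free_coef f x * (if y == x then 1 else 0)) //.
  by have [->|] := eqVneq y x; rewrite ?mulr1 ?mulr0.
rewrite (eq_bigr _ (fun x _ => E x)) -big_mkcond /=.
have [yr|/fr fy0] := boolP (y \in r).
  rewrite (big_rem y) //= eqxx big1_seq ?addr0 // => x /andP[/eqP ->].
  by rewrite mem_rem_uniqF.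
by rewrite big1 // => x _.
Qed.

Lemma free_projective : projective (free_module A T).
Proof.
move=> M N g f /choice[s gs].
exists (lincomb (fun t => s (f (free_delta t)))) => p.
have [r ur pr] := free_coef_support p.
rewrite /= -[in RHS](lincomb_delta p) !(lincombE _ ur pr) !linear_sum.
by apply: eq_bigr => t _; rewrite !linearZ /= gs.
Qed.
End FreeIsProjective.

(* Hom_A(M, A) for a left A-module M, as a right A-module: (f a)(x) = f(x) a.
   The codomain A^c^o is A as a module over A^c, i.e. with right multiplication. *)
Section Dual.
Variables (A : pzRingType) (M : lmodType A).

Definition dual_submod : submodClosed (M -> A^c^o).
Proof.
apply: (@submod_of A^c _ [set f : M -> A^c^o | linear (f : M -> A^o)]) => /=.
- move=> a x y; suff : (0 : A) = a * 0 + 0 by [].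
  by rewrite mulr0 addr0.
- move=> f g lf lg a x y.
  suff : f (a *: x + y) + g (a *: x + y)
       = a * (f x + g x) + (f y + g y) :> A by [].
  by rewrite (lf a x y : _ = a * f x + f y) (lg a x y : _ = a * g x + g y)
             mulrDr addrACA.
- move=> b f lf a x y.
  suff : (f (a *: x + y) : A) * b = a * ((f x : A) * b) + (f y : A) * b by [].
  by rewrite (lf a x y : _ = a * f x + f y) mulrDl mulrA.
Defined.

Definition dual : lmodType A^c := submodule dual_submod.

Definition dual_app (f : dual) (x : M) : A := val f x.

Lemma dual_app_linear (f : dual) : linear (dual_app f : M -> A^o).
Proof. by have /submod_ofP := valP f. Qed.
End Dual.

Section Transpose.
Variables (A : pzRingType) (M N : lmodType A) (f : {linear M -> N}).

Fact transpose_subproof (g : dual N) :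
  (fun x => dual_app g (f x) : A^c^o) \in dual_submod M.
Proof.
by apply/submod_ofP => a x y /=; rewrite linearP; exact: dual_app_linear.
Qed.

Definition transpose (g : dual N) : dual M :=
  exist (fun h => h \in dual_submod M) _ (transpose_subproof g).

Fact transpose_is_linear : linear transpose.
Proof.
move=> a g h; apply: val_inj; rewrite [RHS]linearP; apply: funext => x.
by rewrite /= /dual_app linearP.
Qed.
HB.instance Definition _ := GRing.isLinear.Build A^c (dual N) (dual M) *:%R
  transpose transpose_is_linear.
End Transpose.

Record projective_resolution (A : pzRingType) (N : lmodType A) := {
  res_obj :> nat -> lmodType A;
  res_diff : forall i, {linear res_obj i.+1 -> res_obj i};
  res_aug : {linear res_obj 0%N -> N};
  res_projective : forall i, projective (res_obj i);
  res_aug_surj : forall y, exists x, res_aug x = y;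
  res_exact0 : forall x, res_aug x = 0 <-> exists y, res_diff 0%N y = x;
  res_exactS : forall i x,
    res_diff i x = 0 <-> exists y, res_diff i.+1 y = x }.

(* The i-th cohomology of Hom_A(P_0, A) -> Hom_A(P_1, A) -> ... *)
Section Cohomology.
Variables (A : pzRingType) (N : lmodType A) (P : projective_resolution N).

Definition cocycles (i : nat) : submodClosed (dual (P i)) :=
  ker (transpose (res_diff P i)).

Definition coboundaries (i : nat) : submodClosed (dual (P i)) :=
  match i with
  | 0%N => zero_submod (dual (P 0%N))
  | i'.+1 => im (transpose (res_diff P i'))
  end.

Definition submodule_val (B : pzRingType) (V : lmodType B) (W : submodClosed V) :
  {linear submodule W -> V} := val.

Definition cohomology (i : nat) : lmodType A^c :=
  quotient_module (preimage_submod (submodule_val (cocycles i)) (coboundaries i)).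
End Cohomology.

(* The standard resolution: P_i is the free module on the i-th syzygy, each
   syzygy being the kernel of the evaluation map of the previous free module. *)
Section StandardResolution.
Variables (A : pzRingType) (N : lmodType A).

Fixpoint syzygy (i : nat) : lmodType A :=
  if i is i'.+1 then submodule (ker (lincomb (@id (syzygy i')))) else N.

Definition standard_obj (i : nat) : lmodType A := free_module A (syzygy i).

Definition standard_diff (i : nat) : {linear standard_obj i.+1 -> standard_obj i} :=
  submodule_val _ \o lincomb (@id (syzygy i.+1)).

Lemma lincomb_surj (M : lmodType A) (y : M) :
  exists x : free_module A M, lincomb id x = y.
Proof.
exists (free_delta A y); rewrite (@lincombE _ _ _ _ [:: y]) // => [|x].
  by rewrite big_seq1 /free_coef /= eqxx scale1r.
by rewrite inE /free_coef /= => /negPf ->.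
Qed.

Lemma standard_exact i (x : standard_obj i) :
  lincomb (@id (syzygy i)) x = 0 <-> exists y, standard_diff i y = x.
Proof.
split=> [x0|[y <-]].
  have xK : x \in ker (lincomb (@id (syzygy i))) by apply/submod_ofP.
  have [y yx] := @lincomb_surj (syzygy i.+1) (exist _ x xK).
  by exists y; rewrite /= yx.
by have /submod_ofP := valP (lincomb (@id (syzygy i.+1)) y).
Qed.

Definition standard_resolution : projective_resolution N.
Proof.
apply: (@Build_projective_resolution A N standard_obj standard_diff
  (lincomb (@id N))).
- by move=> i; exact: free_projective.
- exact: lincomb_surj.
- exact: (@standard_exact 0%N).
- move=> i x; rewrite -(@standard_exact i.+1).
  by split=> [x0|/= ->]; [exact: val_inj|].
Defined.
End StandardResolution.

Definition Ext (A : pzRingType) (i : nat) (N : lmodType A) : lmodType A^c :=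
  cohomology (standard_resolution N) i.

Definition Ext_neq0 (A : pzRingType) (N : lmodType A) : pred nat :=
  fun i => `[< exists x : Ext i N, x <> 0 >].

(* j_A(N); [None] stands for the minimum +oo of the empty set. *)
Definition grade (A : pzRingType) (N : lmodType A) : option nat :=
  if pselect (exists i, Ext_neq0 N i) is left ex then Some (ex_minn ex) else None.

Definition le_grade (k : nat) (j : option nat) : bool :=
  if j is Some i then (k <= i)%N else true.

Definition finite_projective_resolution (A : pzRingType) (N : lmodType A) : Prop :=
  exists (P : projective_resolution N) (n : nat),
    (forall i, finitely_generated (P i)) /\
    (forall i, (n < i)%N -> forall x : P i, x = 0).

Definition left_auslander_regular (A : pzRingType) : Prop :=
  (forall N : lmodType A,
     finitely_generated N -> finite_projective_resolution N) /\
  (forall N : lmodType A, finitely_generated N ->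
     forall (k : nat) (N' : submodClosed (Ext k N)),
       le_grade k (grade (submodule N'))).

Definition auslander_regular (A : pzRingType) : Prop :=
  left_auslander_regular A /\ left_auslander_regular A^c.

(* Membership in the full subcategory M^j(A) of finitely generated left modules. *)
Definition codim_category (A : pzRingType) (j : nat) (M : lmodType A) : Prop :=
  finitely_generated M /\
  forall (M' : submodClosed M) (i : nat), (i < j)%N ->
    forall x : Ext i (submodule M'), x = 0.

Definition restrict_scalars (R S : pzRingType) (f : {rmorphism R -> S})
  (M : lmodType S) : Type := M.

Section RestrictScalars.
Variables (R S : pzRingType) (f : {rmorphism R -> S}) (M : lmodType S).
Local Notation restrict_scalars := (restrict_scalars f M).

HB.instance Definition _ := GRing.Zmodule.on restrict_scalars.

Definition restrict_scale (a : R) (x : restrict_scalars) : restrict_scalars :=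
  f a *: (x : M).

Fact restrict_scaleA a b x :
  restrict_scale a (restrict_scale b x) = restrict_scale (a * b) x.
Proof. by rewrite /restrict_scale scalerA rmorphM. Qed.
Fact restrict_scale1 : left_id 1 restrict_scale.
Proof. by move=> x; rewrite /restrict_scale rmorph1 scale1r. Qed.
Fact restrict_scaleDr : right_distributive restrict_scale +%R.
Proof. by move=> a x y; exact: scalerDr. Qed.
Fact restrict_scaleDl x : {morph restrict_scale^~ x : a b / a + b}.
Proof. by move=> a b; rewrite /restrict_scale rmorphD; exact: scalerDl. Qed.

HB.instance Definition _ := GRing.Zmodule_isLmodule.Build R restrict_scalars
  restrict_scaleA restrict_scale1 restrict_scaleDr restrict_scaleDl.
End RestrictScalars.

HB.mixin Record TopologicalZmodule_isTopologicalPzRing R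
    of Topological R & GRing.PzRing R := {
  mul_continuous : continuous (fun x : R * R => x.1 * x.2) }.

#[short(type="topologicalPzRingType")]
HB.structure Definition TopologicalPzRing :=
  {R of TopologicalZmodule R & GRing.PzRing R
        & TopologicalZmodule_isTopologicalPzRing R}.

Section PseudocompactRing.
Variable R : topologicalPzRingType.

Definition cauchy_filter (F : set_system R) : Prop :=
  forall U : set R, nbhs 0 U ->
    exists2 B, F B & forall x y, B x -> B y -> U (x - y).

Definition complete_ring : Prop :=
  forall F : set_system R, ProperFilter F -> cauchy_filter F ->
    exists l : R, F --> l.

Definition left_pseudocompact : Prop :=
  [/\ hausdorff_space R, complete_ring &
      forall U : set R, nbhs 0 U ->
        exists L : submodClosed R^o,
          [/\ open [set x : R | x \in L], [set x : R | x \in L] `<=` U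
            & finite_length (quotient_module L)]].

Definition topological_automorphism (sigma : {rmorphism R -> R}) (sigmaV : R -> R) :=
  [/\ cancel sigma sigmaV, cancel sigmaV sigma,
      continuous sigma & continuous sigmaV].

End PseudocompactRing.

Section SkewDerivations.
Variable R : pzRingType.
Implicit Types (sigma sigmaV delta : R -> R).

Definition left_sigma_derivation sigma delta : Prop :=
  (forall a b, delta (a + b) = delta a + delta b) /\
  (forall a b, delta (a * b) = delta a * b + sigma a * delta b).

Inductive letter := Y | Z | Z'.

Definition is_Y (c : letter) : bool := if c is Y then true else false.

Definition monomial_eval delta sigma sigmaV (w : seq letter) (x : R) : R :=
  foldr (fun c => match c with Y => delta | Z => sigma | Z' => sigmaV end) x w.

Definition sigma_nilpotent delta sigma sigmaV : Prop :=
  forall n, (1 <= n)%N -> exists2 m, (1 <= m)%N &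
    forall w : seq letter, (m <= count is_Y w)%N ->
      range (monomial_eval delta sigma sigmaV w) `<=` ideal_exp (@jacobson R) n.

(* M_{k,l}(delta, sigma); the words in Y, Z are the bit strings, true being Y *)
Definition skew_monomial_sum delta sigma (k l : nat) (x : R) : R :=
  \sum_(w : (k + l).-tuple bool | count id w == k)
    foldr (fun b : bool => if b then delta else sigma) x w.
End SkewDerivations.

(* S is a realisation of R[[t; sigma, delta]]: [sps_coef] identifies S with the
   sequences of coefficients, [sps_const] embeds R as the constant series, and the
   product is given by the explicit formula, c n being the sum over j >= n of
   a_j M_{j-n,n}(delta, sigma)(b_{m-n}), convergent in the topology of R. Since R
   is Hausdorff this determines S up to a unique coefficient-preserving
   isomorphism. *)
Record skew_power_series_ring (R : topologicalPzRingType)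
    (sigma delta : R -> R) (S : pzRingType) := {
  sps_const : {rmorphism R -> S};
  sps_coef : S -> nat -> R;
  sps_coef_bij : bijective sps_coef;
  sps_coefD : forall f g m, sps_coef (f + g) m = sps_coef f m + sps_coef g m;
  sps_coefC : forall a m, sps_coef (sps_const a) m = if m is 0%N then a else 0;
  sps_coefM : forall f g m, exists2 c : nat -> R,
    (forall n, (n <= m)%N ->
       (fun N => \sum_(n <= j < N) sps_coef f j *
          skew_monomial_sum delta sigma (j - n) n (sps_coef g (m - n)%N))
         @ \oo --> c n)
    & sps_coef (f * g) m = \sum_(n < m.+1) c n }.

(* Main.v *)
(* Let M be an S-module finitely generated over R. A filtration of R by closed
   two-sided ideals I_q stable under sigma, sigma^-1 and delta, each containing the
   values of all words with many deltas, is complete with R/I_1 artinian; it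
   follows that t acts nilpotently on M modulo I_1 M, so that M has R-generators
   on which t acts through a topologically nilpotent matrix B. For such B both
   left and right division by t - B in S^n leave unique remainders in R^n. Hence a
   free resolution of M over R, with t lifted to matrices B_i, gives a resolution
   of M over S: the cone of t - B_i. Dualizing it and dividing by t - B_i once more
   shows Hom_S(M, S) = 0 and that Ext^{i+1}_S(M, S) vanishes if and only if
   Ext^i_R(M, R) does. Applied to S-submodules this proves one inclusion. For the
   other, M itself has Ext^i_R(M, R) = 0 for i < j, and the Auslander condition on
   R carries this over to all R-submodules N: if n is minimal with
   Ext^n(N, R) <> 0, the long exact sequence embeds Ext^n(N, R) into
   Ext^{n+1}(M/N, R), so it has grade > n, while a module whose first nonzero
   Ext is in degree n is recovered from dual cosyzygies as one of grade <= n. *)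

Require Import Defs.
From HB Require Import structures.
From mathcomp Require Import all_boot all_order all_algebra.
From mathcomp Require Import boolp classical_sets functions cardinality fsbigop.
From mathcomp Require Import topology tvs.
Import GRing.Theory.
Local Open Scope classical_set_scope.
Local Open Scope ring_scope.

Set Implicit Arguments.
Unset Strict Implicit.
Unset Printing Implicit Defensive.

(** The radical powers are not stable under delta, which may lower the exponent by one. The radical
    K used here is the intersection of the open maximal left ideals; it contains the Jacobson
    radical, so nilpotency of delta still applies. I_q collects the elements all of whose images
    under words lie in the closure of K^q. It contains the closure of some K^m: few deltas cost few
    exponents, and many deltas land in a power of the Jacobson radical anyway. Left multiplication
    by constants is transparent on coefficients written left of t^m, right multiplication on
    coefficients written to its right. Column division uses the first expansion, row division the
    second, and the second is itself obtained from column division with B = 0. Rows give exactness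
    of the cone over S, columns compute its dual. A matrix lifting t to an arbitrary free cover need
    not be topologically nilpotent. Each syzygy is therefore treated as an S-module finitely
    generated over R, and its generators are enlarged by multiples t^l g before the next step. *)

Definition lin_of (A : pzRingType) (M N : lmodType A) (f : M -> N)
    (hf : linear f) : {linear M -> N} :=
  HB.pack f (GRing.isLinear.Build A M N *:%R f hf).

(** * Linear maps, quotients and subquotients *)

Section Linear.
Variables (A : pzRingType).

Lemma submodN (M : lmodType A) (W : submodClosed M) x : x \in W -> - x \in W.
Proof. by move=> xW; rewrite -scaleN1r rpredZ. Qed.

Lemma submodB (M : lmodType A) (W : submodClosed M) x y :
  x \in W -> y \in W -> x - y \in W.
Proof. by move=> xW yW; rewrite rpredD // submodN. Qed.

Lemma corestrict_linear (M N : lmodType A) (f : {linear M -> N})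
    (W : submodClosed N) (hW : forall x, f x \in W) :
  linear (fun x => exist (fun y => y \in W) (f x) (hW x) : submodule W).
Proof. by move=> a x y; apply: val_inj; rewrite [LHS]linearP. Qed.

Definition corestrict (M N : lmodType A) (f : {linear M -> N})
    (W : submodClosed N) (hW : forall x, f x \in W) : {linear M -> submodule W} :=
  lin_of (corestrict_linear hW).

Lemma kerP (M N : lmodType A) (f : {linear M -> N}) x : x \in ker f <-> f x = 0.
Proof. exact: submod_ofP. Qed.

Lemma imP (M N : lmodType A) (f : {linear M -> N}) y :
  y \in im f <-> exists x, f x = y.
Proof. by rewrite submod_ofP; split=> [[x _ <-]|[x <-]]; exists x. Qed.

Lemma im_mem (M N : lmodType A) (f : {linear M -> N}) x : f x \in im f.
Proof. by apply/imP; exists x. Qed.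

Lemma preimageP (M N : lmodType A) (f : {linear M -> N}) (L : submodClosed N) x :
  x \in preimage_submod f L <-> f x \in L.
Proof. exact: submod_ofP. Qed.

Lemma zero_submodP (M : lmodType A) (x : M) : x \in zero_submod M <-> x = 0.
Proof. exact: submod_ofP. Qed.

(** Cutting the target down to [im g] removes the need for [g] to be surjective; this is the form
    used along exact sequences. *)
Lemma projective_lift (P X Y : lmodType A) (f : {linear P -> Y}) (g : {linear X -> Y}) :
  projective P -> (forall p, exists x, g x = f p) ->
  exists h : {linear P -> X}, forall p, g (h p) = f p.
Proof.
move=> prP fg; have hf p : f p \in im g by apply/imP.
have [|h hh] := prP _ _ (corestrict (im_mem g)) (corestrict hf).
  by move=> [y yW]; have [x xy] := (imP g y).1 yW; exists x; apply: val_inj.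
by exists h => p; have := congr1 val (hh p).
Qed.

Lemma quotient_surj (M : lmodType A) (N : submodClosed M) (x : quotient_module N) :
  exists y, quotient_proj N y = x.
Proof. by exists (repr x); exact: quotient_projK. Qed.

Lemma quotient_eq0 (M : lmodType A) (N : submodClosed M) x :
  quotient_proj N x = 0 <-> x \in N.
Proof. by rewrite -(linear0 (quotient_proj N)) quotient_projP subr0. Qed.

Lemma quotient_lift (M X : lmodType A) (N : submodClosed M) (f : {linear M -> X}) :
  (forall x, x \in N -> f x = 0) ->
  exists h : {linear quotient_module N -> X}, forall x, h (quotient_proj N x) = f x.
Proof.
move=> fN; pose h0 (x : quotient_module N) : X := f (repr x).
have hE x : h0 (quotient_proj N x) = f x.
  apply/eqP; rewrite -subr_eq0 -linearB; apply/eqP/fN/quotient_projP.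
  exact: quotient_projK.
have h0l : linear h0.
  move=> a x y; have [x' <-] := quotient_surj x; have [y' <-] := quotient_surj y.
  by rewrite -linearP !hE linearP.
by exists (lin_of h0l).
Qed.

Section Subquotient.
Variables (V : lmodType A) (Z B : submodClosed V).

(** Shaped so that [cohomology P i] is convertible to it. *)
Definition subquotient : lmodType A :=
  quotient_module (preimage_submod (submodule_val Z) B).

(** A relation rather than a map on Z, so that membership proofs of representatives stay out of the
    statements. *)
Definition class_of (v : V) (x : subquotient) : Prop :=
  exists vZ : v \in Z,
    x = quotient_proj _ (exist (fun v => v \in Z) v vZ : submodule Z).

Lemma class_exists v : v \in Z -> exists x, class_of v x.
Proof. by move=> vZ; exists (quotient_proj _ (exist _ v vZ : submodule Z)); exists vZ. Qed.

Lemma class_repr x : exists2 v, v \in Z & class_of v x.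
Proof.
by have [[v vZ] <-] := quotient_surj x; exists v => //; exists vZ.
Qed.

Lemma class_mem v x : class_of v x -> v \in Z.
Proof. by case. Qed.

Lemma class_eq0 v x : class_of v x -> x = 0 <-> v \in B.
Proof. by case=> vZ ->; rewrite quotient_eq0 preimageP. Qed.

Lemma class_lin a v w x y : class_of v x -> class_of w y ->
  class_of (a *: v + w) (a *: x + y).
Proof.
case=> vZ -> [wZ ->].
have avZ : a *: v + w \in Z by rewrite rpredD // rpredZ.
by exists avZ; rewrite -linearP; congr quotient_proj; apply: val_inj.
Qed.
End Subquotient.

Lemma subquotient_lift (V X : lmodType A) (Z B : submodClosed V) (f : {linear V -> X}) :
  (forall v, v \in Z -> v \in B -> f v = 0) ->
  exists h : {linear subquotient Z B -> X}, forall v x, class_of v x -> h x = f v.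
Proof.
move=> fB.
have [|h hh] := @quotient_lift (submodule Z) X (preimage_submod (submodule_val Z) B)
  (f \o submodule_val Z).
  by move=> [v vZ] /preimageP; exact: fB.
by exists h => v x [vZ ->]; rewrite hh.
Qed.

Lemma subquotient_map (V V' : lmodType A) (Z B : submodClosed V)
    (Z' B' : submodClosed V') (f : {linear V -> V'}) :
  (forall v, v \in Z -> f v \in Z') ->
  (forall v, v \in Z -> v \in B -> f v \in B') ->
  exists h : {linear subquotient Z B -> subquotient Z' B'},
    forall v x, class_of v x -> class_of (f v) (h x).
Proof.
move=> fZ fB.
pose g : {linear submodule Z -> submodule Z'} :=
  @corestrict _ _ (f \o submodule_val Z) Z' (fun x => fZ _ (valP x)).
pose q : {linear submodule Z' -> subquotient Z' B'} := quotient_proj _.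
have [|h hh] := @quotient_lift (submodule Z) (subquotient Z' B')
    (preimage_submod (submodule_val Z) B) (q \o g).
  by move=> [v vZ] /preimageP vB; apply/quotient_eq0/preimageP/fB.
exists h => v x [vZ ->]; exists (fZ _ vZ); rewrite hh.
by congr (quotient_proj _ _); apply: val_inj.
Qed.
End Linear.

(** * Duals, cocycles and coboundaries *)

Section Dual.
Variables (A : pzRingType).

Lemma to_dual_subproof (P : lmodType A) (f : {linear P -> A^o}) :
  (f : P -> A^c^o) \in dual_submod P.
Proof. by apply/submod_ofP => a x y /=; exact: linearP. Qed.

Definition to_dual (P : lmodType A) (f : {linear P -> A^o}) : dual P :=
  exist (fun h => h \in dual_submod P) _ (to_dual_subproof f).

Definition of_dual (P : lmodType A) (v : dual P) : {linear P -> A^o} :=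
  lin_of (dual_app_linear v).

Arguments of_dual P v : simpl never.

Lemma dual_eq (P : lmodType A) (v w : dual P) :
  (forall x, of_dual v x = of_dual w x) -> v = w.
Proof. by move=> vw; apply: val_inj; apply: funext. Qed.

Lemma fun_linE (B : pzRingType) (T : Type) (V : lmodType B) b (f g : T -> V) x :
  (b *: f + g) x = b *: f x + g x.
Proof. by []. Qed.

Lemma converse_linE (b : A^c) (y z : A^c^o) : b *: y + z = (y : A) * b + z :> A.
Proof. by []. Qed.

Lemma of_dualP (P : lmodType A) b (v w : dual P) x :
  of_dual (b *: v + w) x = (of_dual v x : A) * b + of_dual w x.
Proof. by rewrite /of_dual /= /dual_app linearP fun_linE -converse_linE. Qed.

Lemma of_dual_transpose (P Q : lmodType A) (f : {linear P -> Q}) v x :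
  of_dual (transpose f v) x = of_dual v (f x).
Proof. by []. Qed.

Lemma transpose_eq0 (P Q : lmodType A) (f : {linear P -> Q}) v :
  transpose f v = 0 <-> forall x, of_dual v (f x) = 0.
Proof.
split=> [v0 x|v0]; first by rewrite -of_dual_transpose v0.
by apply: dual_eq => x; rewrite of_dual_transpose v0.
Qed.
End Dual.

Section Cocycle.
Variables (A : pzRingType) (N : lmodType A) (P : projective_resolution N).

Lemma cocycleP i v : v \in cocycles P i <-> forall x, of_dual v (res_diff P i x) = 0.
Proof. by rewrite kerP transpose_eq0. Qed.

Lemma coboundary0P v : v \in coboundaries P 0 <-> forall x, of_dual v x = 0.
Proof.
rewrite zero_submodP; split=> [-> //|v0].
by apply: dual_eq => x; rewrite v0.
Qed.

Lemma coboundarySP i v : v \in coboundaries P i.+1 <->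
  exists w : {linear P i -> A^o}, forall x, of_dual v x = w (res_diff P i x).
Proof.
rewrite imP; split=> [[w <-]|[w vw]]; first by exists (of_dual w).
by exists (to_dual w); apply: dual_eq => x; rewrite vw.
Qed.

Definition exact_at (i : nat) : Prop :=
  forall v, v \in cocycles P i -> v \in coboundaries P i.

Lemma cohomology_eq0 i : (forall x : cohomology P i, x = 0) <-> exact_at i.
Proof.
split=> [h v vZ|h x].
  have [x xv] := class_exists (coboundaries P i) vZ.
  by apply/(class_eq0 xv)/h.
have [v vZ vx] := @class_repr _ _ (cocycles P i) (coboundaries P i) x.
by apply/(class_eq0 vx)/h.
Qed.

Lemma diffK i x : res_diff P i (res_diff P i.+1 x) = 0.
Proof. by apply/res_exactS; exists x. Qed.

Lemma augK x : res_aug P (res_diff P 0 x) = 0.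
Proof. by apply/res_exact0; exists x. Qed.

End Cocycle.

(** * Independence of Ext from the resolution *)

Section ChainMaps.
Variables (A : pzRingType).

Definition aug_obj (N : lmodType A) (P : projective_resolution N) (i : nat) : lmodType A :=
  if i is i'.+1 then P i' else N.

Definition aug_diff (N : lmodType A) (P : projective_resolution N) (i : nat) :
    {linear aug_obj P i.+1 -> aug_obj P i} :=
  match i with 0%N => res_aug P | i'.+1 => res_diff P i' end.

Lemma aug_exact (N : lmodType A) (P : projective_resolution N) i x :
  aug_diff P i x = 0 <-> exists y, aug_diff P i.+1 y = x.
Proof. by case: i x => [|i] x; [exact: res_exact0|exact: res_exactS]. Qed.

Lemma aug_diffK (N : lmodType A) (P : projective_resolution N) i x :
  aug_diff P i (aug_diff P i.+1 x) = 0.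
Proof. by apply/aug_exact; exists x. Qed.

Variables (N N' : lmodType A) (P : projective_resolution N) (Q : projective_resolution N').

(* Both conditions refer to the augmented complexes, whose 0-th term is the module. *)
Record chain_map := {
  chain_fun :> forall i, {linear aug_obj P i -> aug_obj Q i};
  chain_comm : forall i x, chain_fun i (aug_diff P i x) = aug_diff Q i (chain_fun i.+1 x) }.

Lemma chain_lift (g : {linear N -> N'}) : exists phi : chain_map, forall x, phi 0%N x = g x.
Proof.
have [f0 hf0] : exists f : {linear aug_obj P 1 -> aug_obj Q 1},
   forall x, aug_diff Q 0 (f x) = g (aug_diff P 0 x).
  apply: (projective_lift (f := g \o aug_diff P 0)); first exact: res_projective.
  by move=> p; exact: res_aug_surj.
have step i (f : {linear aug_obj P i -> aug_obj Q i} * {linear aug_obj P i.+1 -> aug_obj Q i.+1}) :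
  (forall x, f.1 (aug_diff P i x) = aug_diff Q i (f.2 x)) ->
  exists h : {linear aug_obj P i.+2 -> aug_obj Q i.+2},
    forall x, f.2 (aug_diff P i.+1 x) = aug_diff Q i.+1 (h x).
  move=> hf; have [|p|h hh] := @projective_lift _ _ _ _ (f.2 \o aug_diff P i.+1) (aug_diff Q i.+1).
  - exact: res_projective.
  - by apply/aug_exact; rewrite /= -hf aug_diffK linear0.
  - by exists h => x; rewrite hh.
(* The state holds two consecutive maps and their commuting square. The second map of one state is
   by computation the first map of the next, so the squares fit together without casts. *)
pose S i := {f : {linear aug_obj P i -> aug_obj Q i} * {linear aug_obj P i.+1 -> aug_obj Q i.+1} |
  forall x, f.1 (aug_diff P i x) = aug_diff Q i (f.2 x)}.
pose nxt i (s : S i) : S i.+1 :=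
  let h := cid (step i (sval s) (svalP s)) in
  exist (fun f : {linear aug_obj P i.+1 -> aug_obj Q i.+1} * {linear aug_obj P i.+2 -> aug_obj Q i.+2} =>
    forall x, f.1 (aug_diff P i.+1 x) = aug_diff Q i.+1 (f.2 x))
    ((sval s).2, sval h) (svalP h).
pose s0 : S 0%N := exist (fun f : {linear aug_obj P 0 -> aug_obj Q 0} * {linear aug_obj P 1 -> aug_obj Q 1} =>
    forall x, f.1 (aug_diff P 0 x) = aug_diff Q 0 (f.2 x)) (g, f0) (fun x => esym (hf0 x)).
pose s := nat_rect S s0 nxt.
by exists (@Build_chain_map (fun i => (sval (s i)).1) (fun i => svalP (s i))).
Qed.

Definition zero_lin (M M' : lmodType A) : {linear M -> M'} :=
  @lin_of A M M' (fun=> 0) (fun a _ _ => esym (eq_trans (addr0 _) (scaler0 _ a))).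

(** Comparing cohomology in one degree needs no coherent family of homotopies. The first property of
    [s] makes phi - psi - s d take values in cycles, so that projectivity yields [s'], and [s']
    inherits the property one degree up. *)
Lemma homotopy_step (phi psi : chain_map) : (forall x, phi 0%N x = psi 0%N x) ->
  forall i, exists2 s : {linear aug_obj P i -> aug_obj Q i.+1},
    (forall x, aug_diff Q i (s (aug_diff P i x)) = phi i (aug_diff P i x) - psi i (aug_diff P i x))
  & exists s' : {linear aug_obj P i.+1 -> aug_obj Q i.+2}, forall x,
      phi i.+1 x - psi i.+1 x = s (aug_diff P i x) + aug_diff Q i.+1 (s' x).
Proof.
move=> pp.
have next i (s : {linear aug_obj P i -> aug_obj Q i.+1}) :
    (forall x, aug_diff Q i (s (aug_diff P i x)) = phi i (aug_diff P i x) - psi i (aug_diff P i x)) ->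
    exists s' : {linear aug_obj P i.+1 -> aug_obj Q i.+2}, forall x,
      phi i.+1 x - psi i.+1 x = s (aug_diff P i x) + aug_diff Q i.+1 (s' x).
  move=> hs.
  pose f : {linear aug_obj P i.+1 -> aug_obj Q i.+1} :=
    (phi i.+1 \- psi i.+1) \- (s \o aug_diff P i).
  have [|p|s' hs'] := @projective_lift _ _ _ _ f (aug_diff Q i.+1).
  - exact: res_projective.
  - by apply/aug_exact; rewrite /f /= !linearB hs /= !chain_comm subrr.
  - by exists s' => x; rewrite hs' /f /= [RHS]addrC subrK.
elim=> [|i [s hs [s' hs']]].
  have h0 x : aug_diff Q 0 (zero_lin _ _ (aug_diff P 0 x)) =
              phi 0%N (aug_diff P 0 x) - psi 0%N (aug_diff P 0 x).
    by rewrite pp subrr /= linear0.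
  by exists (zero_lin _ _) => //; exact: next.
have hs1 x : aug_diff Q i.+1 (s' (aug_diff P i.+1 x)) =
    phi i.+1 (aug_diff P i.+1 x) - psi i.+1 (aug_diff P i.+1 x).
  by rewrite hs' aug_diffK linear0 add0r.
by exists s' => //; exact: next.
Qed.

Lemma transpose_cocycle (phi : chain_map) i v : v \in cocycles Q i ->
  transpose (phi i.+1) v \in cocycles P i.
Proof.
move=> /cocycleP vZ; apply/cocycleP => x.
rewrite of_dual_transpose.
have -> : phi i.+1 (res_diff P i x) = res_diff Q i (phi i.+2 x) := chain_comm phi (i := i.+1) x.
exact: vZ.
Qed.

Lemma transpose_coboundary (phi : chain_map) i v : v \in coboundaries Q i ->
  transpose (phi i.+1) v \in coboundaries P i.
Proof.
case: i v => [|i] v.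
  by move=> /coboundary0P v0; apply/coboundary0P => x; rewrite of_dual_transpose v0.
move=> /coboundarySP[w vw]; apply/coboundarySP; exists (w \o phi i.+1) => x.
by rewrite of_dual_transpose vw /=; congr (w _); rewrite (chain_comm phi (i := i.+1) x).
Qed.

Lemma coh_map (phi : chain_map) i : exists h : {linear cohomology Q i -> cohomology P i},
  forall v x, class_of (B := coboundaries Q i) v x ->
    class_of (B := coboundaries P i) (transpose (phi i.+1) v) (h x).
Proof.
apply: subquotient_map => v; first exact: transpose_cocycle.
by move=> _; exact: transpose_coboundary.
Qed.

Lemma homotopic_coboundary (phi psi : chain_map) i v :
  (forall x, phi 0%N x = psi 0%N x) -> v \in cocycles Q i ->
  transpose (phi i.+1) v - transpose (psi i.+1) v \in coboundaries P i.
Proof.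
move=> pp /cocycleP vZ; have [s hs [s' hs']] := homotopy_step pp i.
have E x : of_dual (transpose (phi i.+1) v - transpose (psi i.+1) v) x =
           of_dual v (s (aug_diff P i x)).
  have -> : of_dual (transpose (phi i.+1) v - transpose (psi i.+1) v) x =
            of_dual v (phi i.+1 x) - of_dual v (psi i.+1 x).
    rewrite addrC -scaleN1r of_dualP.
    by rewrite !of_dual_transpose addrC mulrN1.
  rewrite -linearB hs' linearD.
  have -> : of_dual v (aug_diff Q i.+1 (s' x)) = 0 by exact: vZ.
  by rewrite addr0.
case: i v vZ s hs s' hs' E => [|i] v vZ s hs s' hs' E.
  (* In degree 0 the term in [s] cannot be absorbed as a coboundary. But phi = psi on the module
     puts the values of [s] after the augmentation in the kernel of the augmentation of Q, hence in
     the image of the differential, which [v] kills. *)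
  apply/coboundary0P => x; rewrite E.
  have /(_ (s (aug_diff P 0 x))) := @aug_exact _ Q 0.
  by rewrite hs !pp subrr => -[/(_ erefl)[y <-] _]; exact: vZ.
by apply/coboundarySP; exists (of_dual v \o s) => x; rewrite E.
Qed.

End ChainMaps.

Section Comparison.
Variables (A : pzRingType).

Program Definition chain_comp (N1 N2 N3 : lmodType A) (P1 : projective_resolution N1)
    (P2 : projective_resolution N2) (P3 : projective_resolution N3)
    (phi : chain_map P1 P2) (psi : chain_map P2 P3) : chain_map P1 P3 :=
  {| chain_fun i := psi i \o phi i |}.
Next Obligation. by move=> *; rewrite /= !chain_comm. Qed.

Program Definition chain_id (N : lmodType A) (P : projective_resolution N) : chain_map P P :=
  {| chain_fun i := idfun |}.
Next Obligation. by []. Qed.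

(** Lifts of the identity in both directions compose to chain maps homotopic to the identity. *)
Lemma comparison (N : lmodType A) (P Q : projective_resolution N) i :
  exists2 h : {linear cohomology Q i -> cohomology P i},
    (forall x, h x = 0 -> x = 0) & (forall y, exists x, h x = y).
Proof.
have [phi phi0] := chain_lift P Q idfun; have [psi psi0] := chain_lift Q P idfun.
have [h hh] := coh_map phi i; have [k kk] := coh_map psi i.
exists h => [x|y].
  have [v vZ vx] := @class_repr _ _ (cocycles Q i) (coboundaries Q i) x.
  have hvx := hh _ _ vx.
  move=> /(class_eq0 hvx) /(transpose_coboundary psi) pB; apply/(class_eq0 vx).
  have := @homotopic_coboundary _ _ _ _ _ (chain_comp psi phi) (chain_id Q) i v.
  move=> /(_ _ vZ) vB.
  have {}vB : transpose (chain_comp psi phi i.+1) v - transpose (chain_id Q i.+1) v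
      \in coboundaries Q i by apply: vB => z /=; rewrite phi0 psi0.
  have -> : v = transpose (psi i.+1) (transpose (phi i.+1) v) -
    (transpose (chain_comp psi phi i.+1) v - transpose (chain_id Q i.+1) v).
    have -> : transpose (chain_id Q i.+1) v = v by apply: dual_eq.
    have -> : transpose (chain_comp psi phi i.+1) v =
      transpose (psi i.+1) (transpose (phi i.+1) v) by apply: dual_eq.
    by rewrite opprB addrCA subrr addr0.
  exact: submodB.
have [w wZ wy] := @class_repr _ _ (cocycles P i) (coboundaries P i) y.
have [x xw] := class_exists (coboundaries Q i) (transpose_cocycle psi wZ).
exists x; have hx := hh _ _ xw.
apply/eqP; rewrite -subr_eq0; apply/eqP.
have := class_lin (-1) wy hx; rewrite scaleN1r scaleN1r => cl.
rewrite addrC; apply/(class_eq0 cl).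
have := @homotopic_coboundary _ _ _ _ _ (chain_comp phi psi) (chain_id P) i w.
move=> /(_ _ wZ) wB; rewrite addrC.
have -> : transpose (phi i.+1) (transpose (psi i.+1) w) - w =
  transpose (chain_comp phi psi i.+1) w - transpose (chain_id P i.+1) w.
  by congr (_ - _); apply: dual_eq.
by apply: wB => z /=; rewrite phi0 psi0.
Qed.
End Comparison.

Lemma linear_inverse (A : pzRingType) (M N : lmodType A) (h : {linear M -> N}) :
  (forall x, h x = 0 -> x = 0) -> (forall y, exists x, h x = y) ->
  exists2 k : {linear N -> M}, cancel h k & cancel k h.
Proof.
move=> hI /choice[k kK].
have hinj x y : h x = h y -> x = y.
  by move=> hxy; apply/eqP; rewrite -subr_eq0; apply/eqP/hI; rewrite linearB hxy subrr.
have kl : linear k by move=> a x y; apply: hinj; rewrite linearP !kK.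
by exists (lin_of kl) => [x|x]; [apply: hinj; rewrite /= kK|exact: kK].
Qed.

Section ExtVanish.
Variables (A : pzRingType).

Definition Ext_vanish (i : nat) (N : lmodType A) : Prop := forall x : Ext i N, x = 0.

(** [Ext] is fixed by the free resolution on all elements; this allows vanishing to be tested on any
    convenient resolution. *)
Lemma Ext_vanishP (N : lmodType A) (P : projective_resolution N) i :
  Ext_vanish i N <-> exact_at P i.
Proof.
rewrite -cohomology_eq0; have [h hI hS] := comparison (standard_resolution N) P i.
split=> [v x|v x]; first by apply: hI; exact: v.
by have [y <-] := hS x; rewrite (v y) linear0.
Qed.

Lemma resolution_iso (N N' : lmodType A) (f : {linear N -> N'})
    (P : projective_resolution N) :
  (forall x, f x = 0 -> x = 0) -> (forall y, exists x, f x = y) ->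
  exists P' : projective_resolution N', forall i, exact_at P' i <-> exact_at P i.
Proof.
move=> fI fS.
have e0 x : (f \o res_aug P) x = 0 <-> exists y, res_diff P 0 y = x.
  by rewrite -res_exact0 /=; split=> [/fI//|->]; rewrite linear0.
have sj y : exists x, (f \o res_aug P) x = y.
  by have [z <-] := fS y; have [x <-] := res_aug_surj P z; exists x.
by exists (@Build_projective_resolution A N' P (res_diff P) (f \o res_aug P)
  (@res_projective _ _ P) sj e0 (@res_exactS _ _ P)).
Qed.

Lemma Ext_vanish_iso (N N' : lmodType A) (f : {linear N -> N'}) i :
  (forall x, f x = 0 -> x = 0) -> (forall y, exists x, f x = y) ->
  Ext_vanish i N <-> Ext_vanish i N'.
Proof.
move=> fI fS; have [P' PP'] := resolution_iso (standard_resolution N) fI fS.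
by rewrite (Ext_vanishP P') PP' (Ext_vanishP (standard_resolution N)).
Qed.

End ExtVanish.

Section Products.
Variables (A : pzRingType) (M N X : lmodType A).

Lemma pair_sum_linear (f : {linear M -> X}) (g : {linear N -> X}) :
  linear (fun p : M * N => f p.1 + g p.2).
Proof. by move=> a x y /=; rewrite !linearP scalerDr addrACA. Qed.

Definition pair_sum (f : {linear M -> X}) (g : {linear N -> X}) : {linear (M * N)%type -> X} := lin_of (pair_sum_linear f g).

Lemma pair_sumE (f : {linear M -> X}) (g : {linear N -> X}) x y :
  pair_sum f g (x, y) = f x + g y.
Proof. by []. Qed.

Lemma pair_linear (f : {linear X -> M}) (g : {linear X -> N}) :
  linear (fun x => (f x, g x)).
Proof. by move=> a x y; rewrite !linearP. Qed.

Definition pair_lin (f : {linear X -> M}) (g : {linear X -> N}) : {linear X -> (M * N)%type} := lin_of (pair_linear f g).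

Lemma pair_eqI (p q : M * N) : p.1 = q.1 -> p.2 = q.2 -> p = q.
Proof. by case: p q => [a b] [c d] /= -> ->. Qed.

Lemma fst_linear : linear (@fst M N). Proof. by []. Qed.
Lemma snd_linear : linear (@snd M N). Proof. by []. Qed.
Definition fst_lin : {linear (M * N)%type -> M} := lin_of fst_linear.
Definition snd_lin : {linear (M * N)%type -> N} := lin_of snd_linear.

End Products.

Lemma projective_prod (A : pzRingType) (M N : lmodType A) : projective M -> projective N -> projective (M * N)%type.
Proof.
move=> pM pN Y Z g f gs.
have [h hh] := pM Y Z g (f \o pair_lin (@idfun M) (zero_lin M N)) gs.
have [k kk] := pN Y Z g (f \o pair_lin (zero_lin N M) (@idfun N)) gs.
exists (pair_sum h k) => -[x y].
rewrite /= linearD hh kk /= -linearD; congr (f _).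
by apply: pair_eqI; rewrite /= ?addr0 ?add0r.
Qed.

(** * The long exact sequence of Ext *)

Section Cone.
Variables (A : pzRingType) (K F X : lmodType A).
Variables (iota : {linear K -> F}) (pi : {linear F -> X}).
Hypothesis iota_inj : forall x, iota x = 0 -> x = 0.
Hypothesis pi_surj : forall y, exists x, pi x = y.
Hypothesis exact_mid : forall x, pi x = 0 <-> exists y, iota y = x.
Variables (PK : projective_resolution K) (PF : projective_resolution F).
Variable phi : chain_map PK PF.
Hypothesis phi0 : forall x, phi 0%N x = iota x.

(** The mapping cone of a lift [phi] of the inclusion. As [iota] is injective it resolves the
    cokernel X, and the long exact sequence is then read off its dual. *)
Definition cone_obj (i : nat) : lmodType A :=
  if i is i'.+1 then (PF i * PK i')%type : lmodType A else PF 0.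

Definition cone_diff (i : nat) : {linear cone_obj i.+1 -> cone_obj i} :=
  match i with
  | 0%N => pair_sum (res_diff PF 0) (phi 1%N)
  | i'.+1 => pair_lin (pair_sum (res_diff PF i'.+1) (phi i'.+2))
                      (pair_sum (zero_lin _ _) (\- res_diff PK i'))
  end.

Lemma phi_comm0 x : res_aug PF (phi 1%N x) = iota (res_aug PK x).
Proof. by rewrite -phi0; exact/esym/(chain_comm phi (i := 0)). Qed.

Lemma phi_comm i x : res_diff PF i (phi i.+2 x) = phi i.+1 (res_diff PK i x).
Proof. exact/esym/(chain_comm phi (i := i.+1)). Qed.

Lemma cone_diff0E x y : cone_diff 0 (x, y) = res_diff PF 0 x + phi 1%N y.
Proof. by []. Qed.

Lemma cone_diffSE i x y :
  cone_diff i.+1 (x, y) = (res_diff PF i.+1 x + phi i.+2 y, - res_diff PK i y).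
Proof. by rewrite /= add0r. Qed.

Lemma cone_projective i : projective (cone_obj i).
Proof. by case: i => [|i]; last apply: projective_prod; exact: res_projective. Qed.

Lemma cone_aug_surj y : exists x, (pi \o res_aug PF) x = y.
Proof.
by have [z <-] := pi_surj y; have [x <-] := res_aug_surj PF z; exists x.
Qed.

Lemma cone_exact0 x : (pi \o res_aug PF) x = 0 <-> exists y, cone_diff 0 y = x.
Proof.
rewrite [(_ \o _) _]/=; split.
  move=> /exact_mid[k kx]; have [y yk] := res_aug_surj PK k.
  have /(@res_exact0 _ _ PF)[u ux] : res_aug PF (x - phi 1%N y) = 0.
    by rewrite linearB /= phi_comm0 yk kx subrr.
  by exists (u, y); rewrite cone_diff0E ux subrK.
move=> [[u y] <-]; rewrite cone_diff0E linearD /= augK add0r phi_comm0.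
by apply/exact_mid; exists (res_aug PK y).
Qed.

Lemma cone_exactS i x : cone_diff i x = 0 <-> exists y, cone_diff i.+1 y = x.
Proof.
split; last first.
  case=> -[u y] <- {x}; rewrite cone_diffSE.
  case: i u y => [|i] u y.
    by rewrite cone_diff0E linearD /= diffK add0r phi_comm linearN addrN.
  rewrite cone_diffSE linearD /= diffK add0r phi_comm linearN addrN.
  by rewrite linearN /= diffK !oppr0.
case: i x => [|i] [u y].
  rewrite cone_diff0E => uy.
  have /(@res_exact0 _ _ PK)[y0 y0y] : res_aug PK y = 0.
    apply: iota_inj; rewrite -phi_comm0; have := congr1 (res_aug PF) uy.
    by rewrite linearD linear0 /= augK add0r.
  have /(@res_exactS _ _ PF)[u0 u0u] : res_diff PF 0 (u + phi 2%N y0) = 0.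
    by rewrite linearD /= phi_comm y0y.
  by exists (u0, - y0); rewrite cone_diffSE !linearN u0u addrK opprK y0y.
rewrite cone_diffSE => -[uy dy].
have /(@res_exactS _ _ PK)[y0 y0y] : res_diff PK i y = 0 by apply: oppr_inj; rewrite dy oppr0.
have /(@res_exactS _ _ PF)[u0 u0u] : res_diff PF i.+1 (u + phi i.+3 y0) = 0.
  by rewrite linearD /= phi_comm y0y.
by exists (u0, - y0); rewrite cone_diffSE !linearN u0u addrK opprK y0y.
Qed.

Definition cone : projective_resolution X :=
  @Build_projective_resolution A X cone_obj cone_diff (pi \o res_aug PF)
    cone_projective cone_aug_surj cone_exact0 cone_exactS.

Definition cone_snd i : {linear cone i.+1 -> PK i} := snd_lin _ _.
Definition cone_inl i : {linear PF i -> cone i} :=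
  match i with
  | 0%N => idfun
  | i'.+1 => pair_lin (@idfun (PF i'.+1)) (zero_lin _ _)
  end.

Lemma cone_inlE i x : cone_inl i.+1 x = (x, 0). Proof. by []. Qed.

Definition cone_fst i : {linear cone i -> PF i} :=
  match i with 0%N => idfun | i'.+1 => fst_lin _ _ end.

Lemma cone_fst_inl i x : cone_fst i (cone_inl i x) = x.
Proof. by case: i x. Qed.

Lemma cone_pairE i (x : PF i.+1) (y : PK i) :
  (x, y) = cone_inl i.+1 x + (0, y) :> cone i.+1.
Proof. by apply: pair_eqI => /=; rewrite ?addr0 ?add0r. Qed.

Lemma cone_diff_pairE i (x : PF i.+2) (y : PK i.+1) : res_diff cone i.+1 (x, y) =
  (res_diff PF i.+1 x + phi i.+2 y, - res_diff PK i y).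
Proof. exact: cone_diffSE. Qed.

Lemma cone_snd_diff i (y : PK i.+1) : (0, res_diff PK i y) =
  cone_inl i.+1 (phi i.+2 y) - res_diff cone i.+1 (0, y) :> cone i.+1.
Proof.
rewrite cone_diff_pairE (linear0 (res_diff PF i.+1)) add0r.
by apply: pair_eqI; rewrite /= ?subrr ?sub0r ?opprK.
Qed.

Lemma cone_diff_inl i x : res_diff cone i (cone_inl i.+1 x) = cone_inl i (res_diff PF i x).
Proof.
rewrite cone_inlE; case: i x => [|i] x.
  by rewrite [LHS]cone_diff0E (linear0 (phi 1%N)) addr0.
rewrite [LHS]cone_diffSE cone_inlE.
by rewrite (linear0 (phi i.+2)) addr0 (linear0 (res_diff PK i)) oppr0.
Qed.

Lemma cone_snd_class i : exists c : {linear cohomology PK i -> cohomology cone i.+1},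
  forall v x, class_of (B := coboundaries PK i) v x ->
    class_of (B := coboundaries cone i.+1) (transpose (cone_snd i) v) (c x).
Proof.
apply: subquotient_map => v.
  move=> /cocycleP vZ; apply/cocycleP => -[x y].
  rewrite of_dual_transpose [res_diff _ _ _]cone_diffSE.
  by rewrite (linearN (of_dual v)) vZ oppr0.
move=> _; case: i v => [|i] v.
  move=> /coboundary0P v0; apply/coboundarySP; exists (zero_lin _ _) => x.
  by rewrite of_dual_transpose v0.
move=> /coboundarySP[w vw]; apply/coboundarySP.
exists (\- (w \o cone_snd i)) => -[x y].
rewrite of_dual_transpose vw [res_diff cone _ _]cone_diffSE /=.
by rewrite linearN opprK.
Qed.

Lemma cone_inl_class i : exists a : {linear cohomology cone i.+1 -> cohomology PF i.+1},
  forall v x, class_of (B := coboundaries cone i.+1) v x ->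
    class_of (B := coboundaries PF i.+1) (transpose (cone_inl i.+1) v) (a x).
Proof.
apply: subquotient_map => v.
  move=> /cocycleP vZ; apply/cocycleP => x.
  by rewrite of_dual_transpose -cone_diff_inl vZ.
move=> _ /coboundarySP[w vw]; apply/coboundarySP.
exists (w \o cone_inl i) => x; rewrite of_dual_transpose vw.
by rewrite cone_diff_inl.
Qed.

Lemma class_eq (V : lmodType A^c) (Z B : submodClosed V) (v w : V)
    (x y : subquotient Z B) :
  class_of v x -> class_of w y -> v - w \in B -> x = y.
Proof.
move=> vx wy vw; apply/eqP; rewrite -subr_eq0; apply/eqP.
have := class_lin (-1) wy vx; rewrite !scaleN1r addrC [- y + x]addrC => cl.
exact/(class_eq0 cl).
Qed.

Lemma of_dualB (P : lmodType A) (v w : dual P) x :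
  of_dual (v - w) x = of_dual v x - of_dual w x.
Proof. by rewrite addrC -scaleN1r of_dualP mulrN1 addrC. Qed.

Lemma of_to_dual (P : lmodType A) (f : {linear P -> A^o}) x : of_dual (to_dual f) x = f x.
Proof. by []. Qed.

(** The connecting map [c] is pullback along the projection of the cone to [PK], [a] is restriction
    to [PF], and [b], [b'] are pullback along [phi]; exactness becomes a computation with pairs of
    functionals. *)
Lemma cone_les i : exists (b : {linear cohomology PF i -> cohomology PK i})
    (c : {linear cohomology PK i -> cohomology cone i.+1})
    (a : {linear cohomology cone i.+1 -> cohomology PF i.+1})
    (b' : {linear cohomology PF i.+1 -> cohomology PK i.+1}),
  [/\ forall x, c x = 0 <-> exists y, b y = x,
      forall x, a x = 0 <-> exists y, c y = x
    & forall x, b' x = 0 <-> exists y, a y = x].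
Proof.
have [b hb] := coh_map phi i; have [c hc] := cone_snd_class i.
have [a ha] := cone_inl_class i; have [b' hb'] := coh_map phi i.+1.
exists b, c, a, b'; split=> x.
- have [v vZ vx] := class_repr x; rewrite (class_eq0 (hc _ _ vx)); split.
    (* If [v], extended by zero on [PF], is g d, then the restriction of [g] to [PF] is a cocycle
       with pullback [v] up to a coboundary. *)
    move=> /coboundarySP[g vg]; pose w := to_dual (g \o cone_inl i).
    have vE y : of_dual v y = g (res_diff cone i (0, y)) by rewrite -vg.
    have wE y : of_dual w y = g (cone_inl i y) by [].
    have wZ : w \in cocycles PF i.
      apply/cocycleP => y; rewrite of_to_dual /= -cone_diff_inl.
      by rewrite -vg of_dual_transpose; exact: (linear0 (of_dual v)).
    have [y wy] := class_exists (coboundaries PF i) wZ.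
    exists y; apply: (class_eq (hb _ _ wy) vx).
    clearbody w; case: i g v w {b c a b' hb hc ha hb' x vZ vx vg wZ y wy} vE wE
      => [|i] g v w vE wE.
      apply/coboundary0P => y; rewrite of_dualB vE of_dual_transpose wE.
      rewrite [res_diff cone _ _]cone_diff0E (linear0 (res_diff PF 0)) add0r.
      exact: subrr.
    apply/coboundarySP; exists (g \o pair_lin (zero_lin _ _) (@idfun (PK i))) => y.
    rewrite of_dualB vE of_dual_transpose wE [res_diff cone _ _]cone_diffSE.
    rewrite (linear0 (res_diff PF i.+1)) add0r -linearB; congr (g _).
    by apply: pair_eqI; rewrite /= ?subrr ?sub0r ?opprK.
  move=> [y yx]; have [w wZ wy] := class_repr y.
  have vw : transpose (phi i.+1) w - v \in coboundaries PK i.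
    have := class_lin (-1) vx (hb _ _ wy).
    by rewrite yx !scaleN1r addNr [- v + _]addrC => cl; apply/(class_eq0 cl).
  move/cocycleP: wZ => wZ.
  apply/coboundarySP; have [g gE] : exists g : {linear cone i -> A^o}, 
      forall p q, of_dual v q = g (res_diff cone i (p, q)).
    case: i v w x y {b c a b' hb hc ha hb' vZ vx yx wy} wZ vw => [|i] v w x y wZ vw.
      exists (of_dual w) => p q; rewrite [res_diff cone _ _]cone_diff0E linearD wZ add0r.
      move/coboundary0P/(_ q): vw; rewrite of_dualB of_dual_transpose => /eqP.
      by rewrite subr_eq0 => /eqP.
    have /coboundarySP[u uE] := vw.
    exists (pair_sum (of_dual w) u) => p q; rewrite [res_diff cone _ _]cone_diffSE.
    rewrite pair_sumE linearD wZ add0r linearN -uE of_dualB of_dual_transpose.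
    by rewrite opprB addrC subrK.
  by exists g => -[p q]; rewrite -gE.
- have [v vZ vx] := class_repr x; rewrite (class_eq0 (ha _ _ vx)); split.
    (* Extending [u] by zero on [PK] and subtracting its coboundary leaves a cocycle that vanishes
       on [PF], that is, one pulled back from [PK]. *)
    move=> /coboundarySP[u uE]; pose g : {linear cone i -> A^o} := u \o cone_fst i.
    have vinl p : of_dual v (cone_inl i.+1 p) = u (res_diff PF i p).
      by rewrite -uE of_dual_transpose.
    have ginl p : g (res_diff cone i (cone_inl i.+1 p)) = u (res_diff PF i p).
      have -> : g (res_diff cone i (cone_inl i.+1 p)) =
        u (cone_fst i (res_diff cone i (cone_inl i.+1 p))) by [].
      by rewrite cone_diff_inl cone_fst_inl.
    pose zero_snd : {linear PK i -> cone i.+1} := pair_lin (zero_lin (PK i) (PF i.+1)) (@idfun (PK i)).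
    pose w := to_dual ((of_dual v \o zero_snd) \- ((g \o res_diff cone i) \o zero_snd)).
    have wE q : of_dual w q = of_dual v (0, q) - g (res_diff cone i (0, q)) by [].
    clearbody w; clearbody g.
    have wZ : w \in cocycles PK i.
      apply/cocycleP => q; rewrite wE cone_snd_diff linearB vinl.
      rewrite (linearB (res_diff cone i)) (linearB g) ginl diffK (linear0 g) subr0.
      by rewrite ((cocycleP _).1 vZ) subr0 subrr.
    have [y wy] := class_exists (coboundaries PK i) wZ.
    exists y; apply/esym/(class_eq vx (hc _ _ wy)).
    apply/coboundarySP; exists g => -[p q].
    rewrite of_dualB of_dual_transpose (wE q) cone_pairE linearD vinl.
    rewrite (linearD (res_diff cone i)) (linearD g) ginl.
    by rewrite opprB addrACA subrr addr0.
  move=> [y yx]; have [w wZ wy] := class_repr y.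
  have vw : transpose (cone_snd i) w - v \in coboundaries cone i.+1.
    have := class_lin (-1) vx (hc _ _ wy).
    by rewrite yx !scaleN1r addNr [- v + _]addrC => cl; apply/(class_eq0 cl).
  move/coboundarySP: vw => [g gE]; apply/coboundarySP.
  exists (\- (g \o cone_inl i)) => p.
  rewrite of_dual_transpose /= -cone_diff_inl -gE of_dualB of_dual_transpose.
  by rewrite (linear0 (of_dual w)) sub0r opprK.
- have [v vZ vx] := class_repr x; rewrite (class_eq0 (hb' _ _ vx)); split.
    (* When the pullback of [v] is u d, the pair (v, u) is a cocycle of the cone: the sign in the
       cone cancels the two terms. *)
    move=> /coboundarySP[u uE]; pose w := to_dual (pair_sum (of_dual v) u : {linear cone i.+1 -> A^o}).
    have wE p q : of_dual w (p, q) = of_dual v p + u q by [].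
    clearbody w; move/cocycleP: vZ => vZ.
    have wZ : w \in cocycles cone i.+1.
      apply/cocycleP => -[p q]; rewrite cone_diff_pairE wE linearD vZ add0r.
      by rewrite linearN -uE of_dual_transpose subrr.
    have [y wy] := class_exists (coboundaries cone i.+1) wZ.
    exists y; apply: (class_eq (ha _ _ wy) vx).
    rewrite (_ : _ - v = 0) ?rpred0 //; apply/eqP; rewrite subr_eq0; apply/eqP.
    by apply: dual_eq => p; rewrite of_dual_transpose cone_inlE wE linear0 addr0.
  move=> [y yx]; have [w wZ wy] := class_repr y.
  have /coboundarySP[g gE] : transpose (cone_inl i.+1) w - v \in coboundaries PF i.+1.
    have := class_lin (-1) vx (ha _ _ wy).
    by rewrite yx !scaleN1r addNr [- v + _]addrC => cl; apply/(class_eq0 cl).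
  pose zero_snd : {linear PK i -> cone i.+1} := pair_lin (zero_lin (PK i) (PF i.+1)) (@idfun (PK i)).
  apply/coboundarySP; exists ((of_dual w \o zero_snd) \- (g \o phi i.+1)) => q.
  have vE p : of_dual v p = of_dual w (cone_inl i.+1 p) - g (res_diff PF i p).
    by rewrite -gE of_dualB of_dual_transpose opprB addrC subrK.
  rewrite [RHS](_ : _ = of_dual w (0, res_diff PK i q) -
    g (phi i.+1 (res_diff PK i q))) // of_dual_transpose vE phi_comm.
  congr (_ - _); rewrite cone_snd_diff linearB ((cocycleP _).1 wZ).
  by rewrite subr0.
Qed.
End Cone.

Lemma exact_transport (B : pzRingType) (F0 K0 C X F1 K1 : lmodType B)
    (b : {linear F0 -> K0}) (c : {linear K0 -> C}) (a : {linear C -> F1})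
    (b' : {linear F1 -> K1}) (h : {linear C -> X}) :
  (forall x, h x = 0 -> x = 0) -> (forall y, exists x, h x = y) ->
  (forall x, c x = 0 <-> exists y, b y = x) ->
  (forall x, a x = 0 <-> exists y, c y = x) ->
  (forall x, b' x = 0 <-> exists y, a y = x) ->
  exists (b : {linear F0 -> K0}) (c : {linear K0 -> X}) (a : {linear X -> F1})
    (b' : {linear F1 -> K1}),
  [/\ forall x, c x = 0 <-> exists y, b y = x,
      forall x, a x = 0 <-> exists y, c y = x
    & forall x, b' x = 0 <-> exists y, a y = x].
Proof.
move=> hI hS cb ac ba; have [k hK kK] := linear_inverse hI hS.
exists b, (h \o c), (a \o k), b'; split=> x.
- by rewrite -cb /=; split=> [/hI//|->]; rewrite linear0.
- rewrite /= ac; split=> -[y].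
    by move=> yx; exists y; rewrite -[RHS]kK -yx.
  by move=> <-; exists y; rewrite -[c y]hK.
- rewrite ba; split=> -[y yx]; last by exists (k y).
  by exists (h y); rewrite /= hK.
Qed.

Lemma Ext_les (A : pzRingType) (K F X : lmodType A)
    (iota : {linear K -> F}) (pi : {linear F -> X}) i :
  (forall x, iota x = 0 -> x = 0) -> (forall y, exists x, pi x = y) ->
  (forall x, pi x = 0 <-> exists y, iota y = x) ->
  exists (b : {linear Ext i F -> Ext i K}) (c : {linear Ext i K -> Ext i.+1 X})
    (a : {linear Ext i.+1 X -> Ext i.+1 F}) (b' : {linear Ext i.+1 F -> Ext i.+1 K}),
  [/\ forall x, c x = 0 <-> exists y, b y = x,
      forall x, a x = 0 <-> exists y, c y = x
    & forall x, b' x = 0 <-> exists y, a y = x].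
Proof.
move=> iI pS ex.
have [phi phi0] := chain_lift (standard_resolution K) (standard_resolution F) iota.
have [b [c [a [b' [cb ac ba]]]]] := cone_les iI pS ex phi0 i.
have [h hI hS] := comparison (standard_resolution X) (cone iI pS ex phi0) i.+1.
exact: (exact_transport hI hS cb ac ba).
Qed.

(** * Restriction of scalars and isomorphic rings *)

Section RestrictLinear.
Variables (A B : pzRingType) (f : {rmorphism A -> B}).

Lemma restrict_scaleE (M : lmodType B) (a : A) (x : restrict_scalars f M) :
  a *: x = f a *: (x : M) :> M.
Proof. by []. Qed.

Lemma restrict_linear (M N : lmodType B) (h : {linear M -> N}) :
  linear (h : restrict_scalars f M -> restrict_scalars f N).
Proof. by move=> a x y; rewrite !restrict_scaleE; exact: linearP. Qed.

Definition restrict_lin (M N : lmodType B) (h : {linear M -> N}) :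
  {linear restrict_scalars f M -> restrict_scalars f N} := lin_of (restrict_linear h).
End RestrictLinear.

Section RingIso.
Variables (A B : pzRingType) (f : {rmorphism A -> B}) (g : {rmorphism B -> A}).
Hypotheses (fK : cancel f g) (gK : cancel g f).

Lemma restrict_projective (P : lmodType B) :
  projective P -> projective (restrict_scalars f P : lmodType A).
Proof.
move=> prP X Y p h pS.
have hl : linear (h : P -> restrict_scalars g Y).
  move=> b x y; rewrite -{1}[b]gK -restrict_scaleE.
  exact: linearP.
have [k kh] := prP _ _ (restrict_lin g p) (lin_of hl) pS.
have kl : linear (k : restrict_scalars f P -> X).
  move=> a x y; rewrite restrict_scaleE.
  by have := linearP k (f a) x y; rewrite (restrict_scaleE (f := g)) fK.
by exists (lin_of kl).
Qed.

(** Meant for a ring and its double converse, which have the same operations but are different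
    structures. *)
Lemma restrict_Ext_vanish (N : lmodType B) i :
  Ext_vanish i N -> Ext_vanish i (restrict_scalars f N : lmodType A).
Proof.
pose P := standard_resolution N; move=> /(Ext_vanishP P) v.
pose Q := @Build_projective_resolution A (restrict_scalars f N)
  (fun i => restrict_scalars f (P i)) (fun i => restrict_lin f (res_diff P i))
  (restrict_lin f (res_aug P)) (fun i => restrict_projective (@res_projective _ _ P i))
  (@res_aug_surj _ _ P) (@res_exact0 _ _ P) (@res_exactS _ _ P).
apply/(Ext_vanishP Q) => w /cocycleP wZ.
have upl j (u : {linear Q j -> A^o}) : linear (fun x : P j => f (u x) : B^o).
  move=> b x y; rewrite -{1}[b]gK -restrict_scaleE linearP rmorphD.
  by rewrite [u _ in LHS]/= rmorphM gK.
have downl j (u : {linear P j -> B^o}) : linear (fun x : Q j => g (u x) : A^o).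
  move=> a x y; rewrite restrict_scaleE linearP rmorphD.
  by rewrite [u _ in LHS]/= rmorphM fK.
have vZ : to_dual (lin_of (upl _ (of_dual w))) \in cocycles P i.
  apply/cocycleP => x; rewrite of_to_dual /= -[RHS](rmorph0 f); congr (f _).
  exact: wZ.
have := v _ vZ; move: vZ => _.
case: i v w wZ => [|i] v w wZ.
  move=> /coboundary0P w0; apply/coboundary0P => x.
  by rewrite -[of_dual w x]fK -[RHS](rmorph0 g); congr (g _); exact: w0.
move=> /coboundarySP[u uE]; apply/coboundarySP; exists (lin_of (downl _ u)) => x.
by rewrite -[of_dual w x]fK /=; congr (g _); exact: uE.
Qed.
End RingIso.

(** * Resolutions by matrices *)

Section Rows.
Variable A : pzRingType.

Lemma rowmul_linear (m n : nat) (D : 'M[A]_(m, n)) : linear (fun x : 'rV[A]_m => x *m D).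
Proof. by move=> a x y; rewrite mulmxDl scalemxAl. Qed.

Definition rowmul m n (D : 'M[A]_(m, n)) : {linear 'rV[A]_m -> 'rV[A]_n} :=
  lin_of (rowmul_linear D).

Lemma rowcomb_linear (N : lmodType A) n (g : 'I_n -> N) :
  linear (fun x : 'rV[A]_n => \sum_i x 0 i *: g i).
Proof.
move=> a x y; rewrite scaler_sumr -big_split; apply: eq_bigr => i _.
by rewrite !mxE scalerDl scalerA.
Qed.

Definition rowcomb (N : lmodType A) n (g : 'I_n -> N) : {linear 'rV[A]_n -> N} :=
  lin_of (rowcomb_linear g).

Lemma rowcombE (N : lmodType A) n (g : 'I_n -> N) x : rowcomb g x = \sum_i x 0 i *: g i.
Proof. by []. Qed.

Lemma row_linE (N : lmodType A) n (f : {linear 'rV[A]_n -> N}) x :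
  f x = rowcomb (fun i => f (delta_mx 0 i)) x.
Proof. by rewrite {1}[x]row_sum_delta linear_sum; apply: eq_bigr => i _; rewrite linearZ. Qed.

Lemma row_projective n : projective 'rV[A]_n.
Proof.
move=> X Y g f /choice[s gs]; exists (rowcomb (fun i => s (f (delta_mx 0 i)))) => p.
rewrite [RHS]row_linE rowcombE linear_sum; apply: eq_bigr => i _.
by rewrite linearZ gs.
Qed.

(** An arbitrary finite index type lets two generating families be joined over a sum type, and
    generators taken in M avoid the subtype. *)
Definition fin_span (M : lmodType A) (W : {pred M}) : Prop :=
  exists (T : finType) (g : T -> M), (forall i, g i \in W) /\
    forall x, x \in W -> exists c : T -> A, x = \sum_i c i *: g i.

Definition noeth_module (M : lmodType A) : Prop := forall W : submodClosed M, fin_span W.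

Lemma fin_span_fg (M : lmodType A) (W : submodClosed M) :
  finitely_generated (submodule W) -> fin_span W.
Proof.
case=> n [g gP]; exists 'I_n, (fun i => val (g i)); split=> [i|x xW].
  exact: valP.
have [c xc] := gP (exist _ x xW); exists c.
by rewrite -[x]/(submodule_val W (exist _ x xW)) xc linear_sum; apply: eq_bigr => i _; rewrite linearZ.
Qed.

Lemma noeth_extension (M E N : lmodType A) (f : {linear M -> E}) (p : {linear E -> N}) :
  noeth_module M -> noeth_module N -> (forall x, p x = 0 -> exists y, f y = x) ->
  noeth_module E.
Proof.
move=> nM nN ex W.
have [T [g [gW gS]]] := nM (preimage_submod f W).
have [T' [h [hW hS]]] := nN (im (p \o submodule_val W)).
have /choice[w ww] i : exists w, w \in W /\ p w = h i.
  by have /imP[[w wW] wi] := hW i; exists w.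
exists (T + T')%type, (fun i => match i with inl i => f (g i) | inr i => w i end); split.
  case=> i; last by have [] := ww i.
  by have /preimageP := gW i.
move=> x xW.
have [c xc] : exists c : T' -> A, p x = \sum_i c i *: h i.
  by apply: hS; apply/imP; exists (exist _ x xW).
have [|y yx] := ex (x - \sum_i c i *: w i).
  rewrite linearB xc linear_sum; apply/eqP; rewrite subr_eq0; apply/eqP.
  by apply: eq_bigr => i _; rewrite linearZ (proj2 (ww i)).
have /gS[d yd] : y \in preimage_submod f W.
  apply/preimageP; rewrite yx submodB // rpred_sum // => i _.
  by rewrite rpredZ // (proj1 (ww i)).
exists (fun i => match i with inl i => d i | inr i => c i end).
rewrite big_sumType /= -[LHS](subrK (\sum_i c i *: w i)) -yx yd linear_sum.
by congr (_ + _); apply: eq_bigr => i _; rewrite linearZ.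
Qed.

Lemma noeth_regular : left_noetherian A -> noeth_module A^o.
Proof. by move=> nA W; apply/fin_span_fg/nA. Qed.

Lemma noeth_rows n : left_noetherian A -> noeth_module 'rV[A]_n.
Proof.
move=> nA; elim: n => [|n IHn].
  move=> W; exists void, (fun i : void => match i with end); split; first by case.
  by move=> x _; exists (fun=> 0); rewrite big1 ?thinmx0 // => -[].
have fl : linear (fun x : 'rV[A]_n => row_mx 0 x : 'rV[A]_(1 + n)).
  by move=> a x y; rewrite scale_row_mx add_row_mx scaler0 addr0.
have pl : linear (fun x : 'rV[A]_(1 + n) => x 0 0 : A^o).
  by move=> a x y; rewrite !mxE.
pose f := lin_of fl; pose p := lin_of pl.
apply: (@noeth_extension _ _ _ f p IHn (noeth_regular nA)) => x px.
exists (rsubmx x); rewrite /f /= -[RHS]hsubmxK; congr row_mx.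
apply/rowP => i; rewrite !mxE ord1 -[LHS]px /p /=; congr (x _ _); exact: val_inj.
Qed.

Lemma noeth_kernel_mx (N : lmodType A) n (f : {linear 'rV[A]_n -> N}) :
  left_noetherian A ->
  exists k (D : 'M[A]_(k, n)), forall x, f x = 0 <-> exists y, y *m D = x.
Proof.
move=> nA; have [T [g [gW gS]]] := noeth_rows nA (ker f).
pose D := \matrix_(i < #|T|) g (enum_val i); exists #|T|, D => x.
have DE (y : 'rV[A]_#|T|) : y *m D = \sum_i y 0 (enum_rank i) *: g i.
  rewrite [RHS](reindex (fun i : 'I_#|T| => enum_val i : T)) /=; last by exists enum_rank => i _; rewrite ?enum_valK ?enum_rankK.
  rewrite mulmx_sum_row; apply: eq_bigr => i _.
  by rewrite rowK enum_valK.
split=> [fx|[y <-]].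
  have /gS[c ->] : x \in ker f by apply/kerP.
  exists (\row_i c (enum_val i)); rewrite DE; apply: eq_bigr => i _.
  by rewrite mxE enum_rankK.
rewrite DE linear_sum big1 // => i _; rewrite linearZ.
by have /kerP -> := gW i; rewrite /= scaler0.
Qed.

Lemma noeth_image (M N : lmodType A) (f : {linear M -> N}) :
  (forall y, exists x, f x = y) -> noeth_module M -> noeth_module N.
Proof.
move=> fS nM W; have [T [g [gW gS]]] := nM (preimage_submod f W).
exists T, (fun i => f (g i)); split=> [i|x xW]; first exact/preimageP/gW.
have [y yx] := fS x; have /gS[c yc] : y \in preimage_submod f W by apply/preimageP; rewrite yx.
exists c; rewrite -yx yc linear_sum; apply: eq_bigr => i _; exact: linearZ.
Qed.

Lemma fg_noeth (M : lmodType A) : left_noetherian A -> finitely_generated M -> noeth_module M.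
Proof.
move=> nA [n [g gS]]; apply: (noeth_image (f := rowcomb g)) (noeth_rows (n := n) nA).
move=> y; have [c ->] := gS y; exists (\row_i c i); rewrite rowcombE.
by apply: eq_bigr => i _; rewrite mxE.
Qed.

Lemma fin_span_full (M : lmodType A) (T : finType) (g : T -> M) :
  (forall x, exists c : T -> A, x = \sum_i c i *: g i) -> finitely_generated M.
Proof.
move=> gS; exists #|T|, (fun i => g (enum_val i)) => x; have [c ->] := gS x.
exists (fun i => c (enum_val i)).
by rewrite (reindex (fun i : 'I_#|T| => enum_val i : T)) //=; exists enum_rank => i _; rewrite ?enum_valK ?enum_rankK.
Qed.

Lemma fg_submodule (M : lmodType A) (W : submodClosed M) :
  left_noetherian A -> finitely_generated M -> finitely_generated (submodule W).
Proof.
move=> nA /(fg_noeth nA)/(_ W)[T [g [gW gS]]].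
apply: (@fin_span_full (submodule W) T
  (fun i => exist (fun x => x \in W) (g i) (gW i))) => -[x xW].
have [c xc] := gS x xW; exists c; apply: val_inj.
rewrite -[RHS]/(submodule_val W _) linear_sum /= xc.
by apply: eq_bigr => i _.
Qed.

Lemma fg_image (M N : lmodType A) (f : {linear M -> N}) :
  (forall y, exists x, f x = y) -> finitely_generated M -> finitely_generated N.
Proof.
move=> fS [n [g gS]]; exists n, (fun i => f (g i)) => y.
have [x <-] := fS y; have [c ->] := gS x; exists c.
by rewrite linear_sum; apply: eq_bigr => i _; rewrite linearZ.
Qed.

End Rows.

Section MatrixResolution.
Variable A : pzRingType.

Lemma colfun_linear n (c : 'cV[A]_n) : linear (fun x : 'rV[A]_n => (x *m c) 0 0 : A^o).
Proof. by move=> a x y; rewrite mulmxDl -scalemxAl !mxE. Qed.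

Definition colfun n (c : 'cV[A]_n) : {linear 'rV[A]_n -> A^o} := lin_of (colfun_linear c).

Lemma colfunE n (c : 'cV[A]_n) x : colfun c x = (x *m c) 0 0.
Proof. by []. Qed.

Definition coords n (f : {linear 'rV[A]_n -> A^o}) : 'cV[A]_n :=
  \col_i f (delta_mx 0 i).

Lemma coordsK n (f : {linear 'rV[A]_n -> A^o}) x : colfun (coords f) x = f x.
Proof.
rewrite [RHS]row_linE rowcombE colfunE mxE; apply: eq_bigr => i _.
by rewrite mxE.
Qed.

Lemma mul_delta_row n (c : 'cV[A]_n) i : ((delta_mx 0 i : 'rV[A]_n) *m c) 0 0 = c i 0.
Proof. by rewrite -rowE mxE. Qed.

Lemma colfunK n (c : 'cV[A]_n) : coords (colfun c) = c.
Proof. by apply/colP => i; rewrite mxE colfunE mul_delta_row. Qed.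

Lemma coords_eq n (f g : {linear 'rV[A]_n -> A^o}) :
  coords f = coords g <-> (forall x, f x = g x).
Proof.
split=> [fg x|fg]; first by rewrite -[f x]coordsK fg coordsK.
by apply/colP => i; rewrite !mxE fg.
Qed.

Lemma coords_rowmul m n (D : 'M[A]_(m, n)) (f : {linear 'rV[A]_n -> A^o}) :
  coords (f \o rowmul D) = D *m coords f.
Proof.
rewrite -[RHS]colfunK; apply/coords_eq => x.
by rewrite colfunE mulmxA -[RHS]colfunE coordsK.
Qed.

Record mx_resolution (N : lmodType A) := {
  mx_size : nat -> nat;
  mx_diff : forall i, 'M[A]_(mx_size i.+1, mx_size i);
  mx_gen : 'I_(mx_size 0%N) -> N;
  mx_surj : forall y, exists x, rowcomb mx_gen x = y;
  mx_exact0 : forall x, rowcomb mx_gen x = 0 <-> exists y, y *m mx_diff 0 = x;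
  mx_exactS : forall i (x : 'rV[A]_(mx_size i.+1)), x *m mx_diff i = 0 <-> exists y, y *m mx_diff i.+1 = x }.

Lemma mx_resolution_exists (N : lmodType A) :
  left_noetherian A -> finitely_generated N -> inhabited (mx_resolution N).
Proof.
move=> nA [n0 [g0 g0S]].
pose state := {k : nat & {n : nat & 'M[A]_(k, n)}}.
have [k0 [D0 D0P]] := noeth_kernel_mx (rowcomb g0) nA.
have step (s : state) := cid (noeth_kernel_mx (rowmul (projT2 (projT2 s))) nA).
(* The next matrix has by computation as many columns as the last one has rows, so [sz] and [Df]
   typecheck without casts. *)
pose nxt (s : state) : state := existT _ (sval (step s))
  (existT _ (projT1 s) (sval (cid (svalP (step s))))).
pose st i : state := iter i nxt (existT _ k0 (existT _ n0 D0)).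
pose sz i : nat := if i is j.+1 then projT1 (st j) else n0.
pose Df i : 'M[A]_(sz i.+1, sz i) :=
  match i return 'M[A]_(sz i.+1, sz i) with
  | 0%N => D0 | j.+1 => projT2 (projT2 (st j.+1)) end.
have DfE i : existT (fun k => {n : nat & 'M[A]_(k, n)}) (sz i.+1) (existT _ (sz i) (Df i)) = st i.
  by case: i.
constructor; apply: (@Build_mx_resolution N sz Df g0).
- move=> y; have [c ->] := g0S y; exists (\row_i c i); rewrite rowcombE.
  by apply: eq_bigr => i _; rewrite mxE.
- exact: D0P.
- move=> i x; have := svalP (cid (svalP (step (st i)))).
  move: (DfE i) => E.
  by case: i x E => [|i] x E; exact.
Qed.

Definition mx_res (N : lmodType A) (P : mx_resolution N) : projective_resolution N :=
  @Build_projective_resolution A N (fun i => 'rV[A]_(mx_size P i))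
    (fun i => rowmul (mx_diff P i)) (rowcomb (mx_gen (m := P)))
    (fun i => @row_projective A (mx_size P i)) (@mx_surj _ P) (@mx_exact0 _ P) (@mx_exactS _ P).

Definition mx_boundary (N : lmodType A) (P : mx_resolution N) i : 'cV[A]_(mx_size P i) -> Prop :=
  match i with
  | 0%N => fun v => v = 0
  | j.+1 => fun v => exists w, v = mx_diff P j *m w
  end.

Lemma mx_Ext_vanish (N : lmodType A) (P : mx_resolution N) i :
  Ext_vanish i N <-> forall v : 'cV_(mx_size P i), mx_diff P i *m v = 0 -> mx_boundary v.
Proof.
rewrite (Ext_vanishP (mx_res P)); split=> [ex v Dv|ex v /cocycleP vZ].
  have vB : to_dual (colfun v : {linear mx_res P i -> A^o}) \in coboundaries (mx_res P) i.
    apply: ex; apply/cocycleP => x.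
    by rewrite of_to_dual [LHS]colfunE -mulmxA Dv mulmx0 mxE.
  case: i v Dv vB {ex} => [|i] v _.
    move=> /coboundary0P v0; apply/colP => k; have := v0 (delta_mx 0 k).
    by rewrite of_to_dual [LHS]colfunE mul_delta_row mxE.
  case/coboundarySP => w wE; exists (coords w); rewrite -coords_rowmul -[LHS]colfunK.
  by apply/coords_eq => x; exact: wE.
pose f : {linear 'rV[A]_(mx_size P i) -> A^o} := of_dual v.
have Dc : mx_diff P i *m coords f = 0.
  by rewrite -coords_rowmul; apply/colP => k; rewrite mxE [RHS]mxE; exact: vZ.
have := ex _ Dc; case: i v vZ @f {ex Dc} => [|i] v _ f.
  by move=> c0; apply/coboundary0P => x; rewrite -[LHS](coordsK f) c0 colfunE mulmx0 mxE.
case=> w wE; apply/coboundarySP; exists (colfun w) => x.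
by rewrite -[LHS](coordsK f) wE !colfunE mulmxA.
Qed.
End MatrixResolution.

(** * Grades of submodules over an Auslander regular ring *)

Section TwoTerm.
Variables (A : pzRingType) (P1 P0 X : lmodType A) (d : {linear P1 -> P0}) (p : {linear P0 -> X}).
Hypotheses (pr1 : projective P1) (pr0 : projective P0).
Hypothesis d_inj : forall x, d x = 0 -> x = 0.
Hypothesis p_surj : forall y, exists x, p x = y.
Hypothesis ex : forall x, p x = 0 <-> exists y, d y = x.

Definition two_obj (i : nat) : lmodType A :=
  match i with 0%N => P0 | 1%N => P1 | _ => 'rV[A]_0 end.

Definition two_diff (i : nat) : {linear two_obj i.+1 -> two_obj i} :=
  match i with 0%N => d | 1%N => zero_lin _ _ | _ => zero_lin _ _ end.

Lemma two_projective i : projective (two_obj i).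
Proof. by case: i => [|[|i]] //=; exact: row_projective. Qed.

Lemma two_exact i x : two_diff i x = 0 <-> exists y, two_diff i.+1 y = x.
Proof.
case: i x => [|i] x.
  by split=> [/d_inj ->|[y <-]]; [exists 0|exact: linear0].
have x0 : x = 0 by case: i x => [|i] x; exact: thinmx0.
by rewrite x0; split=> _; [exists 0|]; exact: linear0.
Qed.

Definition two_term : projective_resolution X :=
  @Build_projective_resolution A X two_obj two_diff p two_projective p_surj ex two_exact.

Lemma two_term_coboundary w : w \in coboundaries two_term 1 <->
  exists u : {linear P0 -> A^o}, forall x, of_dual w x = u (d x).
Proof. exact: coboundarySP. Qed.

Lemma two_term_cocycle w : w \in cocycles two_term 1.
Proof. by apply/cocycleP => x; exact: (linear0 (of_dual w)). Qed.

End TwoTerm.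

Lemma projective_Ext_vanish (A : pzRingType) (P : lmodType A) i :
  projective P -> Ext_vanish i.+1 P.
Proof.
move=> prP; pose d := zero_lin 'rV[A]_0 P.
have dI x : d x = 0 -> x = 0 by move=> _; exact: thinmx0.
have pS y : exists x, @idfun P x = y by exists y.
have ex x : @idfun P x = 0 <-> exists y, d y = x.
  by split=> [x0|[y <-] //]; exists 0; rewrite linear0; exact: (esym x0).
apply/(Ext_vanishP (two_term (row_projective (n := 0)) prP dI pS ex)) => v _.
apply/coboundarySP; exists (zero_lin _ _) => x.
by rewrite (_ : x = 0) ?linear0 //; case: i x v => [|i] x v; exact: thinmx0.
Qed.

Section ColumnMaps.
Variable A : pzRingType.
Local Notation B := (A^c).

Lemma converse_rowE n (b : B) (y z : 'rV[B]_n) j :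
  (b *: y + z) 0 j = (y 0 j : A) * b + z 0 j :> A.
Proof. by rewrite !mxE. Qed.

Lemma cmul_linear m n (D : 'M[A]_(m, n)) :
  linear (fun y : 'rV[B]_n => \row_i (\sum_j D i j * (y 0 j : A)) : 'rV[B]_m).
Proof.
move=> b y z; apply/rowP => i; rewrite converse_rowE !mxE mulr_suml -big_split /=.
by apply: eq_bigr => j _; rewrite converse_rowE mulrDr mulrA.
Qed.

(** Multiplication of columns by D on the left. Columns form a right module, so they are written as
    rows over the converse ring. *)
Definition cmul m n (D : 'M[A]_(m, n)) : {linear 'rV[B]_n -> 'rV[B]_m} :=
  lin_of (cmul_linear D).

Lemma cmulE m n (D : 'M[A]_(m, n)) y i : cmul D y 0 i = \sum_j D i j * (y 0 j : A) :> A.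
Proof. by rewrite mxE. Qed.

Lemma dual_row_linear n : linear (fun u : dual 'rV[A]_n => \row_i of_dual u (delta_mx 0 i) : 'rV[B]_n).
Proof. by move=> b u v; apply/rowP => i; rewrite converse_rowE !mxE of_dualP. Qed.

Definition dual_row n : {linear dual 'rV[A]_n -> 'rV[B]_n} := lin_of (@dual_row_linear n).

Lemma dual_rowE n u i : dual_row n u 0 i = of_dual u (delta_mx 0 i) :> A.
Proof. by rewrite mxE. Qed.

Lemma dual_row_inj n u v : dual_row n u = dual_row n v -> u = v.
Proof.
move=> uv; apply: dual_eq => x; rewrite [LHS]row_linE [RHS]row_linE; congr (rowcomb _ x).
by apply: funext => i; rewrite -!dual_rowE uv.
Qed.

Lemma dual_row_surj n y : exists u, dual_row n u = y.
Proof.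
exists (to_dual (colfun (\col_i (y 0 i : A)))); apply/rowP => i.
by rewrite dual_rowE of_to_dual colfunE mul_delta_row mxE.
Qed.

Lemma dual_row_transpose m n (D : 'M[A]_(m, n)) u :
  dual_row m (transpose (rowmul D) u) = cmul D (dual_row n u).
Proof.
apply/rowP => i; rewrite dual_rowE cmulE of_dual_transpose [LHS]row_linE.
have -> : rowmul D (delta_mx 0 i) = row i D by rewrite rowE.
by rewrite rowcombE; apply: eq_bigr => j _; rewrite dual_rowE mxE.
Qed.
End ColumnMaps.

Arguments dual_row {A} n.

Lemma grade_vanish (A : pzRingType) (N : lmodType A) k i :
  le_grade k (grade N) -> (i < k)%N -> Ext_vanish i N.
Proof.
rewrite /grade; case: pselect => [ex|nex] /= kN ik x; apply: contrapT => x0.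
  case: ex_minnP kN => m _ /(_ i) mP km.
  have /mP mi : Ext_neq0 N i by apply/asboolP; exists x.
  by have := leq_ltn_trans (leq_trans km mi) ik; rewrite ltnn.
by apply: nex; exists i; apply/asboolP; exists x.
Qed.

Lemma corestrict_vanish (A : pzRingType) (E F : lmodType A) (f : {linear E -> F}) i :
  (forall x, f x = 0 -> x = 0) ->
  Ext_vanish i (submodule (im f)) -> Ext_vanish i E.
Proof.
move=> fI; apply: (Ext_vanish_iso _ (f := corestrict (im_mem f)) _ _).2.
  by move=> x fx; apply: fI; have := congr1 val fx.
by move=> [y yW]; have [x xy] := (imP f y).1 yW; exists x; apply: val_inj.
Qed.

Lemma auslander_vanish (A : pzRingType) (N : lmodType A) k (E : lmodType A^c)
    (f : {linear E -> Ext k N}) i :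
  left_auslander_regular A -> finitely_generated N ->
  (forall x, f x = 0 -> x = 0) -> (i < k)%N -> Ext_vanish i E.
Proof.
move=> [_ regA] fgN fI ik; apply: (corestrict_vanish fI).
exact: grade_vanish (regA N fgN k (im f)) ik.
Qed.

Section Shift.
Variables (A : pzRingType) (K F X : lmodType A) (iota : {linear K -> F}) (pi : {linear F -> X}).
Hypothesis iota_inj : forall x, iota x = 0 -> x = 0.
Hypothesis pi_surj : forall y, exists x, pi x = y.
Hypothesis exact_mid : forall x, pi x = 0 <-> exists y, iota y = x.

(** The connecting map from Ext^i(K) to Ext^(i+1)(X) is bijective. *)
Lemma les_shift i m : Ext_vanish i F -> Ext_vanish i.+1 F ->
  Ext_vanish m (Ext i.+1 X) <-> Ext_vanish m (Ext i K).
Proof.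
move=> v v'; have [b [c [a [b' [cb ac ba]]]]] := Ext_les i iota_inj pi_surj exact_mid.
apply: iff_sym; apply: (Ext_vanish_iso _ (f := c)) => [x /cb[y <-]|y].
  by rewrite (v y) linear0.
exact/ac/v'.
Qed.

Lemma les_iso i m : Ext_vanish i K -> Ext_vanish i.+1 K ->
  Ext_vanish m (Ext i.+1 X) <-> Ext_vanish m (Ext i.+1 F).
Proof.
move=> v v'; have [b [c [a [b' [cb ac ba]]]]] := Ext_les i iota_inj pi_surj exact_mid.
apply: (Ext_vanish_iso _ (f := a)) => [x /ac[y <-]|y].
  by rewrite (v y) linear0.
exact/ba/v'.
Qed.

Lemma les_embed i : Ext_vanish i F ->
  exists c : {linear Ext i K -> Ext i.+1 X}, forall x, c x = 0 -> x = 0.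
Proof.
move=> v; have [b [c [a [b' [cb ac ba]]]]] := Ext_les i iota_inj pi_surj exact_mid.
by exists c => x /cb[y <-]; rewrite (v y) linear0.
Qed.
End Shift.

Lemma quotient_exact (A : pzRingType) (M N : lmodType A) (f : {linear M -> N}) x :
  quotient_proj (im f) x = 0 <-> exists y, f y = x.
Proof. by rewrite quotient_eq0 imP. Qed.

Section Transpose.
Variables (A : pzRingType) (N : lmodType A) (P : mx_resolution N).
Local Notation B := (A^c).
Local Notation sz := (mx_size P).
Local Notation D := (mx_diff P).

Lemma mx_cocycleP i u : u \in cocycles (mx_res P) i <-> cmul (D i) (dual_row _ u) = 0.
Proof.
rewrite kerP -dual_row_transpose; split=> [->|]; first exact: linear0.
by rewrite -[in X in X -> _](linear0 (dual_row _)) => /dual_row_inj.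
Qed.

Lemma mx_coboundarySP i u : u \in coboundaries (mx_res P) i.+1 <->
  exists z, dual_row _ u = cmul (D i) z.
Proof.
rewrite imP; split=> [[w <-]|[z]].
  by exists (dual_row _ w); rewrite -dual_row_transpose.
have [w <-] := dual_row_surj z; rewrite -dual_row_transpose => /dual_row_inj ->.
by exists w.
Qed.

Lemma cmul_cmul i y : cmul (D i.+1) (cmul (D i) y) = 0.
Proof.
have [w <-] := dual_row_surj y; rewrite -dual_row_transpose; apply/mx_cocycleP.
apply/cocycleP => x; rewrite of_dual_transpose.
have -> : rowmul (D i) (res_diff (mx_res P) i.+1 x) = 0 by exact: (@diffK _ _ (mx_res P) i x).
exact: (linear0 (of_dual w)).
Qed.

(** In positive degree, the Auslander transposes of the syzygies, that is, the cokernels of the dual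
    differentials. The next dual differential induces a map out of [cosyz i] whose kernel is the
    cohomology in degree i. *)
Definition cosyz (i : nat) : lmodType B :=
  match i with 0%N => 'rV[B]_(sz 0%N) | j.+1 => quotient_module (im (cmul (D j))) end.

Definition cosyz_proj i : {linear 'rV[B]_(sz i) -> cosyz i} :=
  match i with 0%N => idfun | j.+1 => quotient_proj _ end.

Lemma cosyz_proj_surj i y : exists x, cosyz_proj i x = y.
Proof. by case: i y => [|i] y; [exists y|exact: quotient_surj]. Qed.

Lemma cosyz_map i : exists tau : {linear cosyz i -> 'rV[B]_(sz i.+1)},
  forall y, tau (cosyz_proj i y) = cmul (D i) y.
Proof.
case: i => [|i]; first by exists (cmul (D 0)).
by apply: quotient_lift => x /imP[y <-]; exact: cmul_cmul.
Qed.

Lemma cosyz_map_inj i (tau : {linear cosyz i -> 'rV[B]_(sz i.+1)}) :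
  (forall y, tau (cosyz_proj i y) = cmul (D i) y) -> exact_at (mx_res P) i ->
  forall x, tau x = 0 -> x = 0.
Proof.
move=> tauE ex x; have [y <-] := cosyz_proj_surj x; rewrite tauE.
have [u <-] := dual_row_surj y => /mx_cocycleP/ex.
case: i tau tauE ex x y u => [|i] tau tauE ex x y u.
  by move/zero_submodP => ->; rewrite (linear0 (dual_row _)) linear0.
by move=> /mx_coboundarySP[z ->]; apply/quotient_exact; exists z.
Qed.

Lemma cosyz_exact i (tau : {linear cosyz i -> 'rV[B]_(sz i.+1)}) :
  (forall y, tau (cosyz_proj i y) = cmul (D i) y) ->
  forall x, cosyz_proj i.+1 x = 0 <-> exists y, tau y = x.
Proof.
move=> tauE x; rewrite quotient_exact; split=> -[y <-].
  by exists (cosyz_proj i y); rewrite tauE.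
by have [z <-] := cosyz_proj_surj y; exists z; rewrite tauE.
Qed.

Lemma cosyz_shift i m : exact_at (mx_res P) i.+1 ->
  Ext_vanish m (Ext i.+2 (cosyz i.+2)) <-> Ext_vanish m (Ext i.+1 (cosyz i.+1)).
Proof.
move=> ex; have [tau tauE] := cosyz_map i.+1.
have fv j : Ext_vanish j.+1 'rV[B]_(sz i.+2) by apply/projective_Ext_vanish/row_projective.
apply: (les_shift (cosyz_map_inj tauE ex) (@cosyz_proj_surj i.+2) (cosyz_exact tauE)).
all: exact: fv.
Qed.

End Transpose.

Section DoubleConverse.
Variable A : pzRingType.

Fact converse2_zmod : zmod_morphism (fun x : A => x : A^c^c). Proof. by []. Qed.
Fact converse2_monoid : monoid_morphism (fun x : A => x : A^c^c). Proof. by split. Qed.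
Definition to_cc : {rmorphism A -> A^c^c} := HB.pack (fun x : A => x : A^c^c)
  (GRing.isZmodMorphism.Build A A^c^c _ converse2_zmod)
  (GRing.isMonoidMorphism.Build A A^c^c _ converse2_monoid).

Fact of_converse2_zmod : zmod_morphism (fun x : A^c^c => x : A). Proof. by []. Qed.
Fact of_converse2_monoid : monoid_morphism (fun x : A^c^c => x : A). Proof. by split. Qed.
Definition of_cc : {rmorphism A^c^c -> A} := HB.pack (fun x : A^c^c => x : A)
  (GRing.isZmodMorphism.Build A^c^c A _ of_converse2_zmod)
  (GRing.isMonoidMorphism.Build A^c^c A _ of_converse2_monoid).

Lemma vanish_of_cc (N : lmodType A) m :
  Ext_vanish m (restrict_scalars of_cc N : lmodType A^c^c) -> Ext_vanish m N.
Proof.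
have c1 : cancel to_cc of_cc by []. have c2 : cancel of_cc to_cc by [].
move=> /(restrict_Ext_vanish c1 c2).
pose h (x : restrict_scalars to_cc (restrict_scalars of_cc N)) : N := x.
have hl : linear h by [].
by apply: (Ext_vanish_iso _ (f := lin_of hl) _ _).1 => // y; exists y.
Qed.
End DoubleConverse.

Section Base.
Variables (A : pzRingType) (N : lmodType A) (P : mx_resolution N).
Local Notation B := (A^c).
Local Notation sz := (mx_size P).
Local Notation D := (mx_diff P).

Lemma dual_value_linear :
  linear (fun u : dual 'rV[B]_(sz 0%N) =>
    rowcomb (mx_gen (m := P)) (\row_i (of_dual u (delta_mx 0 i) : A)) : restrict_scalars (@of_cc A) N).
Proof.
move=> a u v; rewrite restrict_scaleE -linearP; congr (rowcomb _ _).
by apply/rowP => i; rewrite !mxE of_dualP.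
Qed.

(** If Hom(N, A) = 0, the dual of P_0 embeds in the dual of P_1, so these two resolve [cosyz P 1].
    Dualizing once more returns P_1 and P_0, hence Ext^1 of [cosyz P 1] is the cokernel N, over the
    double converse ring. *)
Lemma cosyz_base m : exact_at (mx_res P) 0 ->
  Ext_vanish m (Ext 1 (cosyz P 1)) -> Ext_vanish m N.
Proof.
move=> ex; have [tau tauE] := cosyz_map P 0.
have tauI := cosyz_map_inj tauE ex.
have pS := @cosyz_proj_surj A N P 1; have cex := cosyz_exact tauE.
pose Q := two_term (@row_projective B (sz 0%N)) (@row_projective B (sz 1%N)) tauI pS cex.
have dE x j : tau x 0 j = \sum_k D 0 j k * (x 0 k : A) :> A.
  by rewrite -cmulE -tauE.
(* A functional on the dual of P_0 is a row; it is a coboundary exactly if this row is a relation of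
   N. *)
have cbP u : u \in coboundaries Q 1 <->
    rowcomb (mx_gen (m := P)) (\row_i (of_dual u (delta_mx 0 i) : A)) = 0.
  rewrite mx_exact0 two_term_coboundary; split=> [[w uw]|[y yE]].
    exists (\row_i (w (delta_mx 0 i) : A)); apply/rowP => j; rewrite !mxE uw.
    rewrite (row_linE w) rowcombE; apply: eq_bigr => i _; rewrite dE mxE.
    rewrite (bigD1 j) //= big1 ?addr0 => [|k kj]; rewrite mxE ?(negPf kj) ?mulr0 //.
    by rewrite !eqxx mulr1.
  exists (colfun (\col_i (y 0 i : B))) => x.
  rewrite [LHS](row_linE (of_dual u)) [RHS](row_linE (colfun _ \o tau)).
  congr (rowcomb _ _); apply: funext => j; rewrite [RHS](_ : _ = colfun (\col_i (y 0 i : B)) (tau (delta_mx 0 j))) // colfunE mxE.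
  have := congr1 (fun r : 'rV[A]_(sz 0%N) => r 0 j) yE; rewrite !mxE => <-.
  apply: eq_bigr => i _; rewrite mxE [RHS](_ : _ = y 0 i * (tau (delta_mx 0 j) 0 i : A)) // dE.
  congr (_ * _); rewrite (bigD1 j) //= big1 ?addr0 => [|k kj]; rewrite mxE ?(negPf kj) ?mulr0 //.
  by rewrite !eqxx mulr1.
have [h hE] := subquotient_lift (Z := cocycles Q 1) (B := coboundaries Q 1) (f := lin_of dual_value_linear) (fun u _ => (cbP u).1).
move=> v; apply: vanish_of_cc.
have hI x : h x = 0 -> x = 0.
  by have [u uZ ux] := class_repr x; rewrite (hE _ _ ux) => /cbP uB; apply/(class_eq0 ux).
have hS y : exists x, h x = y.
  have [r ry] := mx_surj P y.
  pose u : dual 'rV[B]_(sz 0%N) := to_dual (colfun (\col_i (r 0 i : B))).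
  have uE i : of_dual u (delta_mx 0 i) = r 0 i.
    by rewrite of_to_dual colfunE mul_delta_row mxE.
  clearbody u; have [x ux] := class_exists (coboundaries Q 1) (two_term_cocycle u : u \in cocycles Q 1).
  exists x; rewrite (hE _ _ ux) -ry; congr (rowcomb _ _); apply/rowP => i.
  by rewrite mxE uE.
apply: (Ext_vanish_iso _ hI hS).1.
have [k kI kS] := comparison Q (standard_resolution (cosyz P 1)) 1.
exact: (Ext_vanish_iso _ kI kS).1.
Qed.
End Base.

Section GradeSubmodule.
Variable A : pzRingType.
Local Notation B := (A^c).
Hypothesis nA : left_noetherian A.
Hypothesis regA : left_auslander_regular A.
Hypothesis regB : left_auslander_regular A^c.

(** Evaluation at a point of P_0 is a functional on Hom(N, A). If all such functionals vanish, every
    element of Hom(N, A) is zero at every point. *)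
Lemma grade0 (N : lmodType A) : Ext_vanish 0 (Ext 0 N) -> Ext_vanish 0 N.
Proof.
pose P := standard_resolution N; move=> v.
apply/(Ext_vanishP P) => u uZ; apply/coboundary0P => p.
have evl : linear (fun w : dual (P 0%N) => of_dual w p : B^o).
  by move=> b w1 w2; rewrite of_dualP.
have [|h hE] := subquotient_lift (Z := cocycles P 0) (B := coboundaries P 0) (f := lin_of evl).
  by move=> w _ /coboundary0P; exact.
have [x ux] := class_exists (coboundaries P 0) uZ.
rewrite -[of_dual u p]/(lin_of evl u) -(hE _ _ ux).
pose Q := standard_resolution (Ext 0 N).
have /coboundary0P h0 : to_dual (h \o res_aug Q) \in coboundaries Q 0.
  apply: (Ext_vanishP Q 0).1 v _ _; apply/cocycleP => y.
  by rewrite -[LHS]/(h (res_aug Q (res_diff Q 0 y))) augK linear0.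
by have [y <-] := res_aug_surj Q x; exact: h0.
Qed.

(* Put m = n + 1. With T = cosyz m the module presented by the m-th dual
   differential and X the image of the next one, Ext^m(N) sits in T with quotient
   X; as its own Ext vanishes in degrees <= m, Ext^m(T), that is N, is identified
   with Ext^{m+1} of a finitely generated right module. *)
Lemma gradeS (N : lmodType A) (P : mx_resolution N) n :
  (forall i, (i <= n)%N -> Ext_vanish i N) ->
  (forall i, (i <= n.+1)%N -> Ext_vanish i (Ext n.+1 N)) -> Ext_vanish n.+1 N.
Proof.
move=> vN vE; have ex i : (i <= n)%N -> exact_at (mx_res P) i by move/vN/Ext_vanishP.
pose D := mx_diff P; pose K := cohomology (mx_res P) n.+1.
have vK i : (i <= n.+1)%N -> Ext_vanish i K.
  move/vE; have [k kI kS] := comparison (mx_res P) (standard_resolution N) n.+1.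
  exact: (Ext_vanish_iso _ kI kS).1.
(* Shifting down one degree at a time ends at [cosyz_base], so Ext^(n+1) of [cosyz P n.+1] stands in
   for N. *)
have vT m : Ext_vanish m (Ext n.+1 (cosyz P n.+1)) -> Ext_vanish m N.
  elim: {-2}n (leqnn n) => [|k IHk] kn; first by apply: cosyz_base; exact: ex.
  by move=> /(cosyz_shift _ (ex _ kn)); apply: IHk; exact: ltnW.
apply: vT.
have [tau tauE] := cosyz_map P n.+1.
pose X := submodule (im (cmul (D n.+1))).
have tauX y : tau y \in im (cmul (D n.+1)).
  by have [z <-] := cosyz_proj_surj y; rewrite tauE im_mem.
pose pi : {linear cosyz P n.+1 -> X} := corestrict tauX.
have piS y : exists x, pi x = y.
  case: y => y yW; have [z zy] := (imP _ _).1 yW.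
  by exists (cosyz_proj P n.+1 z); apply: val_inj; rewrite /= tauE.
have [h hE] : exists h : {linear K -> cosyz P n.+1}, forall v x, class_of v x ->
    h x = cosyz_proj P n.+1 (dual_row _ v).
  have [|h hE] := subquotient_lift (Z := cocycles (mx_res P) n.+1)
    (B := coboundaries (mx_res P) n.+1) (f := cosyz_proj P n.+1 \o dual_row _).
    move=> u _ /mx_coboundarySP[z uz].
    rewrite -[LHS]/(cosyz_proj P n.+1 (dual_row _ u)) uz.
    by apply/quotient_exact; exists z.
  by exists h.
have hI x : h x = 0 -> x = 0.
  have [u uZ ux] := class_repr x; rewrite (hE _ _ ux) => /quotient_exact[z zu].
  by apply/(class_eq0 ux)/mx_coboundarySP; exists z.
have hpi x : pi x = 0 <-> exists y, h y = x.
  have [z <-] := cosyz_proj_surj x; have [u <-] := dual_row_surj z; split.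
    move=> /(congr1 val); rewrite /= tauE => /mx_cocycleP uZ.
    have [y uy] := class_exists (coboundaries (mx_res P) n.+1) uZ.
    by exists y; rewrite (hE _ _ uy).
  move=> [y yE]; apply: val_inj; rewrite /= -yE.
  have [v vZ vy] := class_repr y; rewrite (hE _ _ vy) tauE.
  exact/mx_cocycleP.
apply: (les_iso hI piS hpi n.+1 (vK n (leqnSn _)) (vK n.+1 (leqnn _))).1.
have fv j : Ext_vanish j.+1 'rV[B]_(mx_size P n.+2).
  by apply/projective_Ext_vanish/row_projective.
pose Q := quotient_module (im (cmul (D n.+1))).
have iI (x : X) : submodule_val _ x = 0 -> x = 0 by move=> x0; apply: val_inj.
have iE x : quotient_proj (im (cmul (D n.+1))) x = 0 <-> exists y : X, submodule_val _ y = x.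
  rewrite quotient_eq0; split=> [xW|[[y yW] <-] //].
  by exists (exist _ x xW).
apply: (les_shift iI (@quotient_surj _ _ _) iE n.+1 (fv n) (fv n.+1)).1.
(* The Auslander condition over the converse ring for Q, in degree n + 1 < n + 2. *)
apply: (auslander_vanish (N := Q) (k := n.+2) (f := idfun)) => //.
apply: (fg_image (f := quotient_proj _) (@quotient_surj _ _ _)).
by exists (mx_size P n.+2), (fun i => delta_mx 0 i) => x; exists (fun i => x 0 i);
  exact: row_sum_delta.
Qed.

Lemma vanish_submodule (M : lmodType A) (j : nat) (W : submodClosed M) :
  finitely_generated M -> (forall i, (i < j)%N -> Ext_vanish i M) ->
  forall i, (i < j)%N -> Ext_vanish i (submodule W).
Proof.
move=> fgM vM; have fgW := fg_submodule W nA fgM.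
have [P] := mx_resolution_exists nA fgW.
have fgQ : finitely_generated (quotient_module W).
  exact: (fg_image (f := quotient_proj W) (@quotient_surj _ _ _)).
have iI (x : submodule W) : submodule_val _ x = 0 -> x = 0 by move=> x0; apply: val_inj.
have iE x : quotient_proj W x = 0 <-> exists y : submodule W, submodule_val _ y = x.
  rewrite quotient_eq0; split=> [xW|[[y yW] <-] //].
  by exists (exist _ x xW).
have vE n i : (n < j)%N -> (i <= n)%N -> Ext_vanish i (Ext n (submodule W)).
  move=> nj ik; have [c cI] := les_embed iI (@quotient_surj _ _ W) iE (vM n nj).
  exact: (auslander_vanish regA fgQ cI).
(* Strong induction, since [gradeS] requires vanishing in all lower degrees; degree 0 is settled by
   [grade0]. *)
elim/ltn_ind => -[|n] IHn nj; first exact/grade0/vE.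
apply: (gradeS P) => i ik; last exact: vE.
by apply: IHn; [exact: ik|exact: leq_ltn_trans (leqW ik) nj].
Qed.
End GradeSubmodule.

(** * Pseudocompact rings *)

(** Says that M/W is artinian without forming the quotient: W is a bare set, which suits powers of a
    radical. *)
Definition artinian_over (A : pzRingType) (M : lmodType A) (W : set M) : Prop :=
  forall F : nat -> submodClosed M,
    (forall n x, x \in F n.+1 -> x \in F n) -> (forall n x, W x -> x \in F n) ->
    exists k, forall n x, (k <= n)%N -> x \in F k -> x \in F n.

Section Artinian.
Variables (A : pzRingType).

Lemma decreasing_le (M : lmodType A) (F : nat -> submodClosed M) :
  (forall n x, x \in F n.+1 -> x \in F n) ->
  forall m n x, (m <= n)%N -> x \in F n -> x \in F m.
Proof.
move=> dF m n x; elim: n => [|n IHn]; first by rewrite leqn0 => /eqP ->.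
by rewrite leq_eqVlt => /orP[/eqP -> //|mn /dF]; exact: IHn.
Qed.

Definition submod_add (M : lmodType A) (W W' : submodClosed M) : submodClosed M.
Proof.
apply: (@submod_of _ _ [set x | exists y z, [/\ y \in W, z \in W' & x = y + z]]) => /=.
- by exists 0, 0; rewrite !rpred0 addr0.
- move=> _ _ [y [z [yW zW ->]]] [y' [z' [yW' zW' ->]]].
  by exists (y + y'), (z + z'); rewrite !rpredD // addrACA.
- move=> a _ [y [z [yW zW ->]]]; exists (a *: y), (a *: z).
  by rewrite !rpredZ // scalerDr.
Defined.

Lemma submod_addP (M : lmodType A) (W W' : submodClosed M) x :
  x \in submod_add W W' <-> exists y z, [/\ y \in W, z \in W' & x = y + z].
Proof. exact: submod_ofP. Qed.

Definition submod_cap (M : lmodType A) (W W' : submodClosed M) : submodClosed M.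
Proof.
apply: (@submod_of _ _ [set x | x \in W /\ x \in W']) => /=.
- by rewrite !rpred0.
- by move=> x y [? ?] [? ?]; rewrite !rpredD.
- by move=> a x [? ?]; rewrite !rpredZ.
Defined.

Lemma submod_capP (M : lmodType A) (W W' : submodClosed M) x :
  x \in submod_cap W W' <-> x \in W /\ x \in W'.
Proof. exact: submod_ofP. Qed.

Lemma artinian_sub (M : lmodType A) (W W' : set M) :
  W `<=` W' -> artinian_over W -> artinian_over W'.
Proof. by move=> WW aW F dF WF; apply: aW => // n x /WW; exact: WF. Qed.

(** Induction along the composition series, for chains whose first term lies in the preimage of its
    i-th member. *)
Lemma finite_length_artinian (M : lmodType A) (W : submodClosed M) :
  finite_length (quotient_module W) -> artinian_over [set x | x \in W].
Proof.
move=> [n [G [G0 Gn Gs]]] F dF WF.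
pose pr (i : nat) : submodClosed M := preimage_submod (quotient_proj W) (G i).
suff H i : (i <= n)%N -> forall F : nat -> submodClosed M,
    (forall n x, x \in F n.+1 -> x \in F n) -> (forall n x, x \in W -> x \in F n) ->
    (forall x, x \in F 0%N -> x \in pr i) ->
    exists k, forall n x, (k <= n)%N -> x \in F k -> x \in F n.
  by apply: (H n) => // x _; apply/preimageP.
move: F dF WF => _ _ _; elim: i => [|i IHi] iLn F dF WF F0.
  exists 0%N => m x _ /F0/preimageP/G0/quotient_eq0; exact: WF.
have [] := Gs i iLn => Gsub _ Gmax.
have dFle := decreasing_le dF.
(* Either some term falls into [pr i], and the tail is covered by induction, or every term fills the
   simple factor; then stationarity of the traces on [pr i] is enough, by the modular law. *)
have [[k kF]|nk] := pselect (exists k, forall x, x \in F k -> x \in pr i).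
  have [|m x|x|l lP] := IHi (ltnW iLn) (fun m => F (k + m)%N) _ _ _.
  - by move=> m x; rewrite addnS; exact: dF.
  - exact: WF.
  - by rewrite addn0; exact: kF.
  exists (k + l)%N => m x klm; rewrite -(subnKC (leq_trans (leq_addr l k) klm)).
  by apply: lP; rewrite leq_subRL ?(leq_trans (leq_addr l k) klm).
have [|m x|x|k kP] := IHi (ltnW iLn) (fun m => submod_cap (F m) (pr i)) _ _ _.
- by move=> m x /submod_capP[/dF ? ?]; apply/submod_capP.
- move=> xW; apply/submod_capP; split; first exact: WF.
  by apply/preimageP; have /quotient_eq0 := xW; rewrite /= => ->; rewrite rpred0.
- by case/submod_capP.
exists k => m x km xk.
pose H : submodClosed (quotient_module W) :=
  submod_add (G i) (im (quotient_proj W \o submodule_val (F m))).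
have [||HG|HG] := Gmax H.
- by move=> y yG; apply/submod_addP; exists y, 0; rewrite yG rpred0 addr0.
- move=> y /submod_addP[u [v [uG /imP[[w wF] <-] ->]]]; rewrite rpredD //; first exact: Gsub.
  by apply/preimageP/F0; apply: (dFle 0%N m).
- case: nk; exists m => y yF; apply/preimageP; rewrite -HG; apply/submod_addP.
  by exists 0, (quotient_proj W y); rewrite rpred0 add0r; split=> //; apply/imP;
    exists (exist _ y yF).
have /preimageP : x \in pr i.+1 by apply: F0; apply: (dFle 0%N k).
rewrite -HG => /submod_addP[u [v [uG /imP[[w wF] <-] /= xE]]].
have xw : x - w \in pr i by apply/preimageP; rewrite linearB /= xE addrK.
have /submod_capP[xwF _] : x - w \in submod_cap (F m) (pr i).
  apply: (kP _ _ km); apply/submod_capP; split=> //.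
  by rewrite submodB //; apply: (dFle _ _ _ km wF).
by rewrite -(subrK w x) rpredD.
Qed.

(** A chain is stationary once its first coordinates and its members with first coordinate zero both
    are. *)
Lemma artinian_rows (W : set A) n : W 0 -> @artinian_over A A^o W ->
  artinian_over [set x : 'rV[A]_n | forall i, W (x 0 i)].
Proof.
move=> W0 aW; elim: n => [|n IHn] F dF WF.
  by exists 0%N => m x _ _; rewrite (thinmx0 x) rpred0.
have il : linear (fun x : 'rV[A]_n => row_mx (0 : 'rV_1) x : 'rV[A]_(1 + n)).
  by move=> a x y; rewrite scale_row_mx add_row_mx scaler0 addr0.
have pl : linear (fun x : 'rV[A]_(1 + n) => x 0 0 : A^o) by move=> a x y; rewrite !mxE.
have i0 x : lin_of il x = row_mx 0 x by [].
pose F1 k := im (lin_of pl \o submodule_val (F k)).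
pose F2 k := preimage_submod (lin_of il) (F k).
have F1P k a : a \in F1 k <-> exists2 x : 'rV[A]_(1 + n), x \in F k & x 0 0 = a.
  rewrite imP; split=> [[[x xF] <-]|[x xF <-]]; first by exists x.
  by exists (exist _ x xF).
have [k1 k1P] : exists k, forall m a, (k <= m)%N -> a \in F1 k -> a \in F1 m.
  apply: aW => [m a /F1P[x /dF xF <-]|m a aW']; first by apply/F1P; exists x.
  apply/F1P; exists (row_mx (a%:M : 'M_1) 0); last first.
    by rewrite mxE; case: splitP => l // _; rewrite mxE (ord1 l).
  apply: WF => j; rewrite /= mxE; case: splitP => l _; rewrite !mxE //.
  by rewrite ord1.
have [k2 k2P] : exists k, forall m a, (k <= m)%N -> a \in F2 k -> a \in F2 m.
  apply: IHn => [m a /preimageP/dF aF|m a aW']; first exact/preimageP.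
  apply/preimageP/WF => j; rewrite i0 mxE; case: splitP => l _ //.
  by rewrite mxE.
exists (maxn k1 k2) => m x; rewrite geq_max => /andP[k1m k2m] xk.
have dFle := decreasing_le dF.
have /(k1P m _ k1m)/F1P[y yF y0] : x 0 0 \in F1 k1.
  by apply/F1P; exists x => //; apply: (dFle _ _ _ (leq_maxl k1 k2)).
pose w := rsubmx (x - y : 'rV[A]_(1 + n)).
have xyE : x - y = (row_mx (0 : 'rV_1) w : 'rV[A]_(1 + n)).
  apply/rowP => j; rewrite [RHS]mxE; case: splitP => l jl; rewrite !mxE.
    have -> : j = 0 by apply: val_inj; rewrite /= jl (ord1 l).
    by rewrite y0 subrr.
  by congr (x _ _ - y _ _); apply: val_inj.
have /(k2P m _ k2m)/preimageP : w \in F2 k2.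
  apply/preimageP; rewrite /= -xyE submodB //; first exact: (dFle _ _ _ (leq_maxr k1 k2)).
  exact: (dFle _ _ _ k2m).
by rewrite /= -xyE => xyF; rewrite -(subrK y x) rpredD.
Qed.
End Artinian.

(** * Open left ideals *)

Section OpenIdeals.
Variable R : topologicalPzRingType.
Local Notation lideal := (submodClosed R^o).

Definition open_ideal (L : lideal) : Prop := open [set x : R | x \in L].

Lemma ideal0 (L : lideal) : (0 : R) \in L. Proof. exact: (rpred0 L). Qed.

Lemma idealD (L : lideal) (x y : R) : x \in L -> y \in L -> x + y \in L.
Proof. exact: (@rpredD _ L). Qed.

Lemma idealMl (L : lideal) (a x : R) : x \in L -> a * x \in L.
Proof. exact: (@rpredZ _ _ L a). Qed.

Lemma idealN (L : lideal) (x : R) : x \in L -> - x \in L.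
Proof. exact: (@submodN _ R^o L). Qed.

Lemma idealB (L : lideal) (x y : R) : x \in L -> y \in L -> x - y \in L.
Proof. exact: (@submodB _ R^o L). Qed.

Lemma continuous_addr (b : R) : continuous (fun x : R => x + b).
Proof.
move=> x; apply: (@cvg_comp _ _ _ (fun y : R => (y, b)) (fun p : R * R => p.1 + p.2)
  _ (nbhs (x, b)) _ _ (@add_continuous R (x, b))).
by apply: cvg_pair; [exact: cvg_id|exact: cvg_cst].
Qed.

Lemma continuous_mulr (b : R) : continuous (fun x : R => x * b).
Proof.
move=> x; apply: (@cvg_comp _ _ _ (fun y : R => (y, b)) (fun p : R * R => p.1 * p.2)
  _ (nbhs (x, b)) _ _ (@mul_continuous R (x, b))).
by apply: cvg_pair; [exact: cvg_id|exact: cvg_cst].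
Qed.

Lemma coset_nbhs (L : lideal) (x : R) : open_ideal L -> nbhs x [set y : R | y - x \in L].
Proof.
move=> oL; apply: open_nbhs_nbhs; split; last by rewrite /= subrr ideal0.
by have /continuousP/(_ _ oL) := @continuous_addr (- x).
Qed.

Lemma open_ideal_nbhs (L : lideal) : nbhs (0 : R) [set x : R | x \in L] -> open_ideal L.
Proof.
rewrite /open_ideal nbhsE => -[U [oU U0] UL]; rewrite openE => x /= xL.
rewrite /interior nbhsE; exists [set y | U (y - x)]; last first.
  by move=> y /= /UL /= yx; rewrite -(subrK x y); apply: idealD.
split; last by rewrite /= subrr.
by have /continuousP/(_ _ oU) := @continuous_addr (- x).
Qed.

Lemma open_ideal_sub (L L' : lideal) : {subset L <= L'} -> open_ideal L -> open_ideal L'.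
Proof.
move=> LL' oL; apply: open_ideal_nbhs; apply: filterS (coset_nbhs 0 oL) => x /=.
by rewrite subr0; exact: LL'.
Qed.

Lemma open_ideal_cap (L L' : lideal) :
  open_ideal L -> open_ideal L' -> open_ideal (submod_cap L L').
Proof.
move=> oL oL'; rewrite /open_ideal (_ : [set _ | _] = [set x : R | x \in L] `&` [set x : R | x \in L']).
  exact: openI.
by apply/seteqP; split=> x /= /submod_capP.
Qed.

(** The annihilator of the class of b in R/L. *)
Definition ideal_shift (L : lideal) (b : R) : lideal.
Proof.
apply: (@submod_of _ R^o [set a : R | (a : R) * b \in L]) => /=.
- by rewrite mul0r ideal0.
- by move=> x y xL yL; rewrite mulrDl idealD.
- by move=> a x xL; rewrite -[a *: x]/((a : R) * x) -mulrA; exact: idealMl.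
Defined.

Lemma ideal_shiftP (L : lideal) (b a : R) : a \in ideal_shift L b <-> a * b \in L.
Proof. exact: (@submod_ofP R R^o _ _ _ _ a). Qed.

Lemma open_ideal_shift (L : lideal) b : open_ideal L -> open_ideal (ideal_shift L b).
Proof.
move=> oL; rewrite /open_ideal (_ : [set _ | _] = (fun x : R => x * b) @^-1` [set x : R | x \in L]).
  by have /continuousP/(_ _ oL) := @continuous_mulr b.
by apply/seteqP; split=> x /= /ideal_shiftP.
Qed.

Hypothesis pcR : left_pseudocompact R.

Lemma open_ideal_base (U : set R) : nbhs 0 U -> exists L : lideal,
  [/\ open_ideal L, [set x : R | x \in L] `<=` U & finite_length (quotient_module L)].
Proof. by case: pcR => _ _ h /h[L [oL LU fL]]; exists L. Qed.

Lemma open_ideal_artinian (L : lideal) : open_ideal L -> artinian_over [set x : R^o | x \in L].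
Proof.
move=> oL; have [|L' [oL' LU /finite_length_artinian]] := @open_ideal_base [set x : R | x \in L].
  by have := coset_nbhs 0 oL; apply: filterS => x /=; rewrite subr0.
exact: artinian_sub.
Qed.

Lemma open_ideal_separated (x : R) : (forall L : lideal, open_ideal L -> x \in L) -> x = 0.
Proof.
case: pcR => hR _ _ xL; apply: hR => U V nU nV.
have := @continuous_addr x 0; rewrite /continuous_at add0r => /(_ U nU).
move=> /open_ideal_base[L [oL LU _]].
exists 0; split; last exact: nbhs_singleton.
have : - x \in L by apply: idealN; exact: xL.
by move/LU; rewrite /= addNr.
Qed.

End OpenIdeals.

(** * Linear compactness *)

Section LinearCompactness.
Variable R : topologicalPzRingType.
Hypothesis pcR : left_pseudocompact R.
Local Notation lideal := (submodClosed R^o).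

Definition coset (y : R) (L : lideal) : set R := [set x | x - y \in L].

Lemma coset_self y L : coset y L y. Proof. by rewrite /coset /= subrr ideal0. Qed.

Lemma coset_eq (y z : R) L : coset y L z -> coset z L = coset y L.
Proof.
rewrite /coset /= => zy; apply/seteqP; split=> x /= xz.
  by rewrite -(subrKA z); exact: idealD.
by rewrite -(subrKA y) idealD // -opprB; apply: idealN.
Qed.

Lemma coset_cap (y : R) L L' : coset y L `&` coset y L' = coset y (submod_cap L L').
Proof. by apply/seteqP; split=> x /= => [[? ?]|/submod_capP//]; apply/submod_capP. Qed.

(* Families of cosets of open left ideals closed under finite intersections;
   a maximal one contains a coset of every open left ideal, hence is a Cauchy
   filter base. *)
Definition coset_family (G : set (set R)) : Prop :=
  [/\ G setT,
      forall A, G A -> exists y L, open_ideal L /\ A = coset y L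
    & forall A A', G A -> G A' -> G (A `&` A')].

(** The alternative of the empty family is there because [Zorn_bigcup] also quantifies over the
    empty chain. *)
Lemma coset_family_bigcup (G0 : set (set R)) (F : set (set (set R))) :
  F `<=` [set G | G = set0 \/ coset_family G /\ G0 `<=` G] -> total_on F subset ->
  \bigcup_(G in F) G = set0 \/
  coset_family (\bigcup_(G in F) G) /\ G0 `<=` \bigcup_(G in F) G.
Proof.
move=> FP Ftot; have [[G FG Gne]|ne] := pselect (exists2 G, F G & G !=set0); last first.
  left; apply/seteqP; split=> // A [G FG GA]; apply: ne; exists G => //.
  by exists A.
have good G' A : F G' -> G' A -> coset_family G' /\ G0 `<=` G'.
  by move=> /FP[-> []|].
case: Gne => A GA; have [[GT Gc GI] G0G] := good G A FG GA.
right; split; last by move=> B /G0G GB; exists G.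
split; first by exists G.
  by move=> B [G' FG' G'B]; have [[_ + _] _] := good _ _ FG' G'B; exact.
move=> B B' [G1 F1 G1B] [G2 F2 G2B].
have [[_ _ I1] _] := good _ _ F1 G1B; have [[_ _ I2] _] := good _ _ F2 G2B.
have [G12|G21] := Ftot _ _ F1 F2.
  by exists G2 => //; apply: I2 => //; exact: G12.
by exists G1 => //; apply: I1 => //; exact: G21.
Qed.

Lemma coset_family_maximal (G0 : set (set R)) : coset_family G0 ->
  exists G, [/\ coset_family G, G0 `<=` G &
    forall G', coset_family G' -> G `<=` G' -> G' `<=` G].
Proof.
move=> cG0; have [G [[->|[cG G0G]] maxG]] := Zorn_bigcup (@coset_family_bigcup G0).
  exfalso; apply: (maxG G0); last by right; split.
  rewrite properEneq; split; last exact: sub0set.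
  by apply/eqP => G00; case: cG0 => G0T _ _; rewrite -G00 in G0T.
exists G; split=> // G' cG' GG' A G'A; apply: contrapT => nGA.
apply: (maxG G'); last by rewrite /=; right; split=> // B /G0G/GG'.
by split=> // /(_ A G'A).
Qed.

Lemma coset_family_point (G : set (set R)) : coset_family G ->
  exists l, forall A, G A -> A l.
Proof.
move=> cG0; have [G1 [[GT Gc GI] G0G maxG]] := coset_family_maximal cG0.
(* Members are nonempty because they are cosets; with closure under intersection this is the finite
   intersection property. *)
have Gne A : G1 A -> A !=set0 by move=> /Gc[y [L [_ ->]]]; exists y; exact: coset_self.
have key (L : lideal) : open_ideal L -> exists x, G1 (coset x L).
  move=> oL.
  (* a member whose image modulo L is minimal *)
  have [A GA minA] : exists2 A, G1 A & forall A', G1 A' -> forall x, A x ->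
      exists2 z, A' z & z - x \in L.
    apply: contrapT => nomin.
    (* Without a minimal image, members could be intersected so that their images modulo L shrink
       for ever, although R/L is artinian. *)
    have bad (A : {A | G1 A}) : exists A', G1 A' /\ exists2 x, sval A x &
        forall z, A' z -> ~ z - x \in L.
      apply: contrapT => nA; apply: nomin; exists (sval A); first exact: svalP.
      move=> A' GA' x Ax; apply: contrapT => nz; apply: nA; exists A'; split=> //.
      by exists x => // z A'z zx; apply: nz; exists z.
    have [nxt nxtP] := choice bad.
    have nxtG (A : {A | G1 A}) : G1 (sval A `&` nxt A).
      by apply: GI; [exact: svalP|exact: (nxtP A).1].
    pose st n := iter n (fun A => exist G1 _ (nxtG A)) (exist G1 _ GT).
    have stS n : sval (st n.+1) = sval (st n) `&` nxt (st n) by [].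
    have /choice[yL yLP] n : exists yL : R * lideal, open_ideal yL.2 /\
        sval (st n) = coset yL.1 yL.2.
      by have [y [L' [? ?]]] := Gc _ (svalP (st n)); exists (y, L').
    have dL n v : v \in (yL n.+1).2 -> v \in (yL n).2.
      move=> vL; have [_ En] := yLP n; have [_ ES] := yLP n.+1.
      have sub z : coset (yL n.+1).1 (yL n.+1).2 z -> coset (yL n).1 (yL n).2 z.
        by rewrite -ES -En stS => -[].
      have -> : v = (yL n.+1).1 + v - (yL n).1 - ((yL n.+1).1 - (yL n).1).
        by rewrite opprB addrA subrK addrC addKr.
      apply: idealB; apply: sub; last exact: coset_self.
      by rewrite /coset /= addrC addKr.
    have [|n v vL|k kP] := open_ideal_artinian pcR oL (F := fun n => submod_add (yL n).2 L).
      move=> n v /submod_addP[u [w [uL wL ->]]]; apply/submod_addP.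
      by exists u, w; split=> //; exact: dL.
      by apply/submod_addP; exists 0, v; rewrite rpred0 add0r.
    have [GN [x stx xN]] := nxtP (st k).
    have [w stw] := Gne _ (svalP (st k.+1)).
    have [w1 w2] : sval (st k) w /\ nxt (st k) w by move: stw; rewrite stS.
    have [_ Ek] := yLP k; have [_ ES] := yLP k.+1.
    have /(kP k.+1 _ (leqnSn _))/submod_addP[u [v [uL vL xE]]] :
        x - w \in submod_add (yL k).2 L.
      apply/submod_addP; exists (x - w), 0; rewrite rpred0 addr0; split=> //.
      rewrite Ek in w1 stx; rewrite -(subrKA (yL k).1); apply: idealD => //.
      by rewrite -opprB; apply: idealN.
    have : sval (st k.+1) (w + u).
      by rewrite ES /coset /= addrAC; apply: idealD => //; rewrite ES in stw.
    rewrite stS => -[_ /xN]; apply.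
    have -> : w + u - x = - v.
      have -> : w + u - x = u - (x - w) by rewrite opprB addrA (addrC u w).
      by rewrite xE opprD addrA subrr add0r.
    exact: idealN.
  have [x Ax] := Gne _ GA; exists x.
  (* By minimality of the image of A, the coset x + L meets every member; the family stays
     admissible when its traces are added, and maximality puts x + L into [G1]. *)
  pose G2 := G1 `|` [set B | exists2 A', G1 A' & B = A' `&` coset x L].
  apply: (maxG G2); first split.
  - by left.
  - move=> B [/Gc//|[A' GA' ->]]; have [z A'z zx] := minA A' GA' x Ax.
    have [y [L' [oL' A'E]]] := Gc _ GA'; exists z, (submod_cap L' L).
    split; first exact: open_ideal_cap.
    by rewrite -coset_cap -(coset_eq zx) A'E -(@coset_eq y z) // -A'E.
  - move=> B B' [GB|[A1 GA1 ->]] [GB'|[A2 GA2 ->]].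
    + by left; exact: GI.
    + by right; exists (B `&` A2); [exact: GI|rewrite setIA].
    + by right; exists (A1 `&` B'); [exact: GI|rewrite setIAC].
    + by right; exists (A1 `&` A2); [exact: GI|rewrite setIACA setIid].
  - by move=> B GB; left.
  - by right; exists setT => //; rewrite setTI.
have [hR cR _] := pcR.
have FF : ProperFilter (filter_from G1 id).
  apply: filter_from_proper => //; apply: filter_from_filter; first by exists setT.
  by move=> A B GA GB; exists (A `&` B) => //; exact: GI.
have [l Fl] : exists l : R, filter_from G1 id --> l.
  apply: cR => U /(open_ideal_base pcR)[L [oL LU _]]; have [x Gx] := key L oL.
  exists (coset x L); first by exists (coset x L).
  move=> y z yx zx; apply: LU; rewrite /= -(subrKA x); apply: idealD => //.
  by rewrite -opprB; exact: idealN.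
(* Cosets of open left ideals are closed: a member inside l + L meets A, so l lies in A. *)
exists l => A /G0G GA; have [y [L [oL AE]]] := Gc _ GA.
have [B GB Bl] := Fl _ (coset_nbhs l oL).
have [z [Bz Az]] : A `&` B !=set0 by apply: Gne; exact: GI.
rewrite AE; have := coset_eq (y := y) (z := z) (L := L).
rewrite AE in Bz; move=> /(_ Bz) <-.
by rewrite /coset /= -opprB; apply: idealN; exact: Bl.
Qed.

(** The L n need not shrink to zero, so this is more than completeness: it asks for a common point
    of nested cosets. *)
Lemma coset_sequence_limit (x : nat -> R) (L : nat -> lideal) :
  (forall n, open_ideal (L n)) -> (forall n y, y \in L n.+1 -> y \in L n) ->
  (forall n, x n.+1 - x n \in L n) -> exists l, forall n, l - x n \in L n.
Proof.
move=> oL dL xL; have dLe := @decreasing_le R R^o L dL.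
have xm m n : (m <= n)%N -> x n - x m \in L m.
  elim: n => [|n IHn]; first by rewrite leqn0 => /eqP ->; rewrite subrr ideal0.
  rewrite leq_eqVlt => /orP[/eqP ->|mn]; first by rewrite subrr ideal0.
  rewrite -(subrKA (x n)); apply: idealD; last exact: IHn.
  exact: dLe (mn : (m <= n)%N) (xL n).
have cE m n : (m <= n)%N -> coset (x m) (L m) `&` coset (x n) (L n) = coset (x n) (L n).
  move=> mn; apply/seteqP; split=> y; first by case.
  move=> yn; split=> //; rewrite /coset /= -(subrKA (x n)); apply: idealD.
    exact: (dLe _ _ _ mn yn).
  exact: xm.
pose G := [set A | A = setT \/ exists n, A = coset (x n) (L n)].
have [|l lG] := @coset_family_point G; last by exists l => n; apply: (lG (coset (x n) (L n))); right; exists n.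
split; first by left.
  move=> A [->|[n ->]]; last by exists (x n), (L n).
  have oT : open_ideal (ker (zero_lin R^o R^o)).
    rewrite /open_ideal (_ : [set _ | _] = setT); first exact: openT.
    by apply/seteqP; split=> // y _; apply: ((@kerP R R^o R^o (zero_lin R^o R^o) _).2).
  exists 0, (ker (zero_lin R^o R^o)); split=> //.
  by apply/seteqP; split=> // y _; apply: ((@kerP R R^o R^o (zero_lin R^o R^o) _).2).
move=> A A' [->|[m ->]] [->|[n ->]].
- by left; rewrite setTI.
- by right; exists n; rewrite setTI.
- by right; exists m; rewrite setIT.
- right; have [mn|/ltnW nm] := leqP m n; first by exists n; exact: cE.
  by exists m; rewrite setIC; exact: cE.
Qed.

End LinearCompactness.

(** * Powers of ideals and the open radical *)

Section IdealPowers.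
Variables (A : pzRingType) (J : set A).

Lemma ideal_exp_ind (P : set A) n : P 0 -> (forall x y, P x -> P y -> P (x + y)) ->
  (forall a b, ideal_exp J n a -> J b -> P (a * b)) -> forall x, ideal_exp J n.+1 x -> P x.
Proof.
move=> P0 PD PM x [k [a [b [aJ bJ ->]]]].
by apply: big_ind => // i _; exact: (PM _ _ (aJ i) (bJ i)).
Qed.

Lemma ideal_exp_mul n a b : ideal_exp J n a -> J b -> ideal_exp J n.+1 (a * b).
Proof.
move=> aJ bJ; exists 1%N, (fun=> a), (fun=> b); split=> //.
by rewrite big_ord1.
Qed.

Lemma ideal_expD n x y : ideal_exp J n x -> ideal_exp J n y -> ideal_exp J n (x + y).
Proof.
case: n => // n [k [a [b [aJ bJ ->]]]] [l [c [d [cJ dJ ->]]]].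
exists (k + l)%N, (fun i => match fintype.split i with inl i => a i | inr i => c i end),
  (fun i => match fintype.split i with inl i => b i | inr i => d i end); split.
- by move=> i; case: fintype.split => j; [exact: aJ|exact: cJ].
- by move=> i; case: fintype.split => j; [exact: bJ|exact: dJ].
- rewrite big_split_ord /=; congr (_ + _); apply: eq_bigr => i _.
    by rewrite (unsplitK (inl i)).
  by rewrite (unsplitK (inr i)).
Qed.

Lemma ideal_exp0 n : ideal_exp J n 0.
Proof.
case: n => // n; exists 0%N, (fun=> 0), (fun=> 0).
by split=> [[]|[]|] //; rewrite big_ord0.
Qed.

Hypothesis JM : forall x c, J x -> J (x * c).

Lemma ideal_expMr n x c : ideal_exp J n x -> ideal_exp J n (x * c).
Proof.
case: n => // n; move: x; apply: ideal_exp_ind => [|x y xc yc|a b aJ bJ].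
- by rewrite mul0r; exact: ideal_exp0.
- by rewrite mulrDl; exact: ideal_expD.
- by rewrite -mulrA; apply: ideal_exp_mul => //; exact: JM.
Qed.

Lemma ideal_exp_decr n x : ideal_exp J n.+1 x -> ideal_exp J n x.
Proof.
move: x; apply: ideal_exp_ind => [|x y|a b aJ _]; first exact: ideal_exp0.
  exact: ideal_expD.
exact: ideal_expMr.
Qed.

Lemma ideal_exp_le m n x : (m <= n)%N -> ideal_exp J n x -> ideal_exp J m x.
Proof.
elim: n => [|n IHn]; first by rewrite leqn0 => /eqP ->.
by rewrite leq_eqVlt => /orP[/eqP -> //|mn /ideal_exp_decr]; exact: IHn.
Qed.
End IdealPowers.

Lemma ideal_exp_sub (A : pzRingType) (J J' : set A) n :
  J `<=` J' -> ideal_exp J n `<=` ideal_exp J' n.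
Proof.
move=> JJ'; elim: n => // n IHn x [k [a [b [aJ bJ ->]]]].
by exists k, a, b; split=> // i; [apply: IHn; exact: aJ|apply: JJ'; exact: bJ].
Qed.

Section Simple.
Variables (A : pzRingType) (M : lmodType A).

Definition colon_ideal (U : submodClosed M) (x : M) : submodClosed A^o.
Proof.
apply: (@submod_of A A^o [set a : A | a *: x \in U]) => /=.
- by rewrite scale0r rpred0.
- by move=> a b aU bU; rewrite scalerDl rpredD.
- by move=> a b bU; rewrite -[a *: b]/((a : A) * b) -scalerA rpredZ.
Defined.

Lemma colon_idealP (U : submodClosed M) x (a : A) : a \in colon_ideal U x <-> a *: x \in U.
Proof. exact: (@submod_ofP A A^o _ _ _ _ a). Qed.

(** It is the annihilator of a nonzero element of the simple module V/U. *)
Lemma colon_maximal (U V : submodClosed M) x :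
  {subset U <= V} -> x \in V -> ~ x \in U ->
  (forall G : submodClosed M, {subset U <= G} -> {subset G <= V} -> G =i U \/ G =i V) ->
  maximal_left_ideal (colon_ideal U x).
Proof.
move=> UV xV xU UVmax; split; first by move=> /colon_idealP; rewrite scale1r.
move=> H UH.
have sxl : linear (fun a : A^o => a *: x) by move=> a b c; rewrite scalerDl scalerA.
pose G := submod_add U (im (lin_of sxl \o submodule_val H)).
have GP y : y \in G <-> exists u (h : A), [/\ u \in U, h \in H & y = u + h *: x].
  rewrite submod_addP; split=> [[u [v [uU /imP[[h hH] <-] ->]]]|[u [h [uU hH ->]]]].
    by exists u, h.
  by exists u, (h *: x); split=> //; apply/imP; exists (exist _ h hH).
have [| |GU|GV] := UVmax G.
- by move=> u uU; apply/GP; exists u, 0; rewrite scale0r addr0 (rpred0 H).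
- by move=> y /GP[u [h [uU hH ->]]]; rewrite rpredD ?rpredZ //; exact: UV.
- right=> h; apply/idP/idP; last exact: UH.
  move=> hH; apply/colon_idealP; rewrite -GU; apply/GP; exists 0, h.
  by rewrite rpred0 add0r.
- left; have /GP[u [h [uU hH xE]]] : x \in G by rewrite GV.
  have : 1 - h \in H.
    by apply: UH; apply/colon_idealP; rewrite scalerBl scale1r {1}xE addrK.
  by move=> h1; rewrite -(subrK h 1); exact: (rpredD h1 hH).
Qed.
End Simple.

Section OpenRadical.
Variable R : topologicalPzRingType.
Hypothesis pcR : left_pseudocompact R.
Local Notation lideal := (submodClosed R^o).

Definition open_maximal (L : lideal) : Prop := open_ideal L /\ maximal_left_ideal L.

(** With open maximal left ideals only, the radical is closed and remains within reach of linear
    compactness; it contains the Jacobson radical, which is the inclusion that nilpotency of delta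
    calls for. *)
Definition open_radical : set R := [set x | forall L : lideal, open_maximal L -> x \in L].
Local Notation K := open_radical.

Lemma jacobson_open_radical : @jacobson R `<=` K.
Proof. by move=> x xJ L [_ mL]; exact: xJ. Qed.

Lemma radicalMl a x : K x -> K (a * x).
Proof. by move=> xK L mL; apply/idealMl/xK. Qed.

Lemma radicalD x y : K x -> K y -> K (x + y).
Proof. by move=> xK yK L mL; apply: idealD; [exact: xK|exact: yK]. Qed.

Lemma radical0 : K 0. Proof. by move=> L _; exact: ideal0. Qed.

Definition full_ideal : lideal.
Proof. exact: (@submod_of R R^o setT). Defined.

Lemma full_idealP (x : R) : x \in full_ideal.
Proof. exact: ((@submod_ofP R R^o _ _ _ _ x).2 I). Qed.

Lemma open_full_ideal : open_ideal full_ideal.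
Proof.
rewrite /open_ideal (_ : [set _ | _] = setT); first exact: openT.
by apply/seteqP; split=> // x _; exact: full_idealP.
Qed.

(** For b outside L, the left ideal L : b is again open and maximal. *)
Lemma radicalMr x b : K x -> K (x * b).
Proof.
move=> xK L [oL mL]; have [bL|bL] := pselect (b \in L); first exact: idealMl.
have mS : maximal_left_ideal (colon_ideal (M := R^o) L b).
  apply: (@colon_maximal R R^o L full_ideal b) => //; first by move=> y _; exact: full_idealP.
    exact: full_idealP.
  move=> G LG _; have [G1|GL] := mL.2 G LG; [right=> y|by left].
  rewrite full_idealP -[y]/(y : R) -[y : R]mulr1; exact: idealMl.
have : x \in colon_ideal (M := R^o) L b.
  apply: xK; split=> //; apply: open_ideal_sub (open_ideal_shift b oL) => a.
  by move=> /ideal_shiftP ab; apply/colon_idealP.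
by move/colon_idealP.
Qed.

(** K kills each simple factor of a quotient R/L' of finite length, the annihilators of elements
    being open, so K^n kills R/L' when n is its length. *)
Lemma radical_exp_open (L : lideal) : open_ideal L -> exists n, forall x, ideal_exp K n x -> x \in L.
Proof.
move=> oL; have [|L' [oL' L'L [n [G [G0 Gn Gs]]]]] := open_ideal_base pcR (U := [set x | x \in L]).
  by have := coset_nbhs 0 oL; apply: filterS => x /=; rewrite subr0.
have KG i (a : R) x : (i < n)%N -> K a -> x \in G i.+1 -> a *: x \in G i.
  move=> /Gs[Gsub _ Gmax] aK xG; have [xi|xi] := pselect (x \in G i); first exact: rpredZ.
  suff : a \in colon_ideal (G i) x by move/colon_idealP.
  apply: aK; split; last exact: (colon_maximal Gsub xG xi Gmax).
  have [r rx] := quotient_surj x.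
  apply: open_ideal_sub (open_ideal_shift r oL') => b /ideal_shiftP bL.
  apply/colon_idealP; rewrite -rx.
  have -> : b *: quotient_proj L' r = quotient_proj L' (b * r) by rewrite -linearZ.
  by have /quotient_eq0 -> := bL; rewrite rpred0.
have KnG i : (i <= n)%N -> forall a x, ideal_exp K i a -> x \in G i -> a *: x = 0.
  elim: i => [|i IHi] iLn a x.
    by move=> _ /G0 ->; rewrite scaler0.
  move=> aK xG; move: a aK; apply: ideal_exp_ind => [|a b a0 b0|a b aK bK].
  - by rewrite scale0r.
  - by rewrite scalerDl a0 b0 addr0.
  - by rewrite -scalerA; apply: IHi => //; [exact: ltnW|exact: KG].
exists n => x xK; apply: L'L; apply/quotient_eq0.
have := KnG n (leqnn n) x (quotient_proj L' 1) xK (Gn _).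
have -> // : x *: quotient_proj L' 1 = quotient_proj L' x.
by rewrite -linearZ /=; congr (quotient_proj _ _); exact: mulr1.
Qed.

Hypothesis noethR : left_noetherian R.

(* If no open left ideal lay in K, there would be open maximal left ideals m_0,
   m_1, ... with intersections strictly decreasing; by linear compactness the left
   ideals of elements lying in all m_j, j > k, would increase strictly with k. *)
Lemma radical_open : exists2 L : lideal, open_ideal L & forall x, x \in L -> K x.
Proof.
apply: contrapT => nL.
(* An open L not inside K is not inside some open maximal m; then L + m is the whole ring, and e is
   the component of 1 in L. *)
have bad (L : {L : lideal | open_ideal L}) : exists m : lideal, open_maximal m /\
    exists2 e, e \in sval L & 1 - e \in m.
  apply: contrapT => nm; apply: nL; exists (sval L); first exact: svalP.
  move=> x xL m [om mm]; apply: contrapT => xm; apply: nm; exists m; split=> //.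
  pose G := submod_add m (sval L).
  have [|G1|Gm] := mm.2 G.
  - by move=> y ym; apply/submod_addP; exists y, 0; rewrite addr0 (ideal0 (sval L)).
  - have /submod_addP[y [z [ym zL E]]] := G1; exists z => //.
    by rewrite [X in X - z]E addrK.
  - case: xm; rewrite -Gm; apply/submod_addP; exists 0, x; rewrite add0r.
    by split=> //; exact: ideal0.
have [m mP] := choice bad.
have oC (L : {L : lideal | open_ideal L}) : open_ideal (submod_cap (sval L) (m L)).
  by apply: open_ideal_cap; [exact: svalP|exact: (mP L).1.1].
pose st n := iter n (fun L => exist (@open_ideal R) _ (oC L)) (exist (@open_ideal R) _ open_full_ideal).
pose mm n := m (st n); pose L n : lideal := sval (st n).
have LS n x : x \in L n.+1 <-> x \in L n /\ x \in mm n by exact: submod_capP.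
have dL n x : x \in L n.+1 -> x \in L n by case/LS.
have Lle := @decreasing_le R R^o L dL.
have /choice[e eP] n : exists e : R, e \in L n /\ 1 - e \in mm n.
  by have [_ [e ? ?]] := mP (st n); exists e.
pose X k : lideal := @submod_of R R^o [set x : R | forall j, (k < j)%N -> x \in mm j]
  (fun j _ => ideal0 (mm j)) (fun x y xX yX j kj => idealD (xX j kj) (yX j kj))
  (fun a x xX j kj => idealMl a (xX j kj)).
have XP k (x : R) : x \in X k <-> forall j, (k < j)%N -> x \in mm j.
  exact: (@submod_ofP R R^o _ _ _ _ x).
have Xle k l x : (k <= l)%N -> x \in X k -> x \in X l.
  by move=> kl /XP xX; apply/XP => j lj; apply: xX; exact: leq_ltn_trans lj.
have Xstrict k : exists2 l : R, l \in X k.+1 & ~ l \in X k.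
  (* Partial products e_(k+1) (1 - e_(k+2)) ... . Their limit lies in m_j for j > k + 1, thanks to
     the factor 1 - e_j, but is congruent to e_(k+1), hence to 1, modulo m_(k+1). *)
  pose x n := iteri n (fun i y => y * (1 - e (k.+2 + i)%N)) (e k.+1).
  have xS n : x n.+1 - x n = - (x n * e (k.+2 + n)%N).
    by rewrite /x /= -/(x n) mulrBr mulr1 addrAC subrr add0r.
  have [|n y|n|l lP] := @coset_sequence_limit R pcR x (fun n => L (k.+2 + n)%N).
  - by move=> n; exact: svalP.
  - by rewrite addnS; exact: dL.
  - by rewrite xS; apply/idealN/idealMl; exact: (eP _).1.
  have lm n : l - x n \in mm (k.+1 + n)%N.
    by have := lP n; rewrite addSn => /LS[].
  exists l.
    apply/XP => j kj; have -> : l = l - x (j - k.+1)%N + x (j - k.+1)%N by rewrite subrK.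
    apply: idealD; first by have := lm (j - k.+1)%N; rewrite subnKC // ltnW.
    have [i jE] : exists i, j = (k.+2 + i)%N by exists (j - k.+2)%N; rewrite subnKC.
    have -> : (j - k.+1 = i.+1)%N by rewrite jE addSnnS addKn.
    by rewrite /x /= -/(x i) -jE; apply: idealMl; exact: (eP j).2.
  move=> /XP/(_ k.+1 (ltnSn _)) lk; have [_ [m1 _]] := (mP (st k.+1)).1; apply: m1.
  have := lm 0%N; rewrite addn0 => l0.
  have -> : 1 = (1 - e k.+1) + (l - (l - e k.+1)) by rewrite opprB (addrC l) subrK subrK.
  apply: idealD; first exact: (eP _).2.
  exact: idealB.
pose W : lideal := @submod_of R R^o [set x : R | exists k, x \in X k]
  (ex_intro _ 0%N (ideal0 (X 0%N)))
  (fun x y xX yX => let: ex_intro k xk := xX in let: ex_intro l yl := yX in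
     ex_intro _ (maxn k l) (idealD (Xle _ _ _ (leq_maxl k l) xk) (Xle _ _ _ (leq_maxr k l) yl)))
  (fun a x xX => let: ex_intro k xk := xX in ex_intro _ k (idealMl a xk)).
have WP (x : R) : x \in W <-> exists k, x \in X k by exact: (@submod_ofP R R^o _ _ _ _ x).
(* The finitely many generators of the union lie in a single X k, which [Xstrict] forbids. *)
have [T [g [gW gS]]] := noeth_regular noethR W.
have /choice[kk kkP] i : exists k, g i \in X k by apply/WP/gW.
have [l lX] := Xstrict (\max_i kk i); apply.
have /gS[c ->] : l \in W by apply/WP; exists (\max_i kk i).+1.
apply: rpred_sum => i _; apply: (@rpredZ _ _ (X _)).
by apply: (Xle _ _ _ _ (kkP i)); exact: (leq_bigmax i).
Qed.

End OpenRadical.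

(** Everything that division and the study of modules use about the topology; from there on R is a
    plain ring. *)
Record skew_filtration (R : pzRingType) (sigma sigmaV delta : R -> R)
    (I : nat -> set R) : Prop := {
  fil0 : forall q, I q 0;
  filD : forall q x y, I q x -> I q y -> I q (x + y);
  filMl : forall q a x, I q x -> I q (a * x);
  filMr : forall q x a, I q x -> I q (x * a);
  fil_sigma : forall q x, I q x -> I q (sigma x);
  fil_sigmaV : forall q x, I q x -> I q (sigmaV x);
  fil_delta : forall q x, I q x -> I q (delta x);
  fil_words : forall q, exists m, forall w x, (m <= count is_Y w)%N ->
    I q (monomial_eval delta sigma sigmaV w x);
  fil_separated : forall x, (forall q, I q x) -> x = 0;
  fil_complete : forall u : nat -> R,
    (forall q, exists N, forall n, (N <= n)%N -> I q (u n.+1 - u n)) ->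
    exists l, forall q, exists N, forall n, (N <= n)%N -> I q (l - u n);
  fil_decr : forall q x, I q.+1 x -> I q x;
  fil_power : forall q, exists N, ideal_exp (I 1%N) N `<=` I q;
  fil_artinian : @artinian_over R R^o (I 1%N) }.

(** * A filtration stable under sigma and delta *)

Section Filtration.
Variable R : topologicalPzRingType.
Hypothesis pcR : left_pseudocompact R.
Hypothesis noethR : left_noetherian R.
Variables (sigma : {rmorphism R -> R}) (sigmaV delta : R -> R).
Hypothesis sigmaP : topological_automorphism sigma sigmaV.
Hypothesis deltaP : left_sigma_derivation sigma delta.
Hypothesis delta_cont : continuous delta.
Hypothesis nilp : sigma_nilpotent delta sigma sigmaV.
Local Notation lideal := (submodClosed R^o).
Local Notation K := (@open_radical R).
Local Notation pow := (ideal_exp K).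

Let powD := @ideal_expD R K.
Lemma powMr n x c : pow n x -> pow n (x * c).
Proof. by apply: ideal_expMr => y d; exact: radicalMr. Qed.
Lemma pow_le m n x : (m <= n)%N -> pow n x -> pow m x.
Proof. by apply: ideal_exp_le => y d; exact: radicalMr. Qed.

Lemma pow1 x : pow 1 x <-> K x.
Proof.
split=> [[k [a [b [_ bK ->]]]]|xK].
  apply: big_ind => [||i _]; [exact: radical0|exact: radicalD|exact/radicalMl/bK].
by rewrite -[x]mul1r; exact: ideal_exp_mul.
Qed.

(** R/K is artinian since K contains an open left ideal, and K/K^(n+1) is a quotient of a finite
    power of R/K^n because K is finitely generated on the left. *)
Lemma pow_artinian n : @artinian_over R R^o (pow n).
Proof.
elim: n => [|n IHn] F dF WF; first by exists 0%N => m x _ _; exact: WF.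
have [L oL LK] := radical_open pcR noethR.
have artK : @artinian_over R R^o K.
  by apply: artinian_sub (open_ideal_artinian pcR oL) => x; exact: LK.
pose Ki : lideal := @submod_of R R^o K (@radical0 R) (@radicalD R) (@radicalMl R).
have KiP (x : R) : x \in Ki <-> K x by exact: (@submod_ofP R R^o _ _ _ _ x).
have [T [g0 [gW gS]]] := noeth_regular noethR Ki.
pose g (i : 'I_#|T|) : R^o := g0 (enum_val i).
have [k1 k1P] : exists k, forall m x, (k <= m)%N ->
    x \in submod_add (F k) Ki -> x \in submod_add (F m) Ki.
  apply: artK => [m x /submod_addP[y [z [/dF yF zK ->]]]|m x xK].
    by apply/submod_addP; exists y, z.
  apply/submod_addP; exists 0, x; rewrite add0r; split=> //; first exact: ideal0.
  exact/KiP.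
have [k2 k2P] : exists k, forall m (v : 'rV[R]_#|T|), (k <= m)%N ->
    v \in preimage_submod (rowcomb g) (F k) -> v \in preimage_submod (rowcomb g) (F m).
  have := artinian_rows (n := #|T|) (@ideal_exp0 R K n) IHn; apply.
    by move=> m v /preimageP/dF ?; apply/preimageP.
  move=> m v vn; apply/preimageP/WF; rewrite rowcombE.
  apply: (big_ind (pow n.+1)) => [||i _]; [exact: ideal_exp0|exact: ideal_expD|].
  by apply: ideal_exp_mul; [exact: vn|apply/KiP/gW].
have dFle := @decreasing_le R R^o F dF.
exists (maxn k1 k2) => m x; rewrite geq_max => /andP[k1m k2m] xk.
have /(k1P m _ k1m)/submod_addP[y [z [yF zK xE]]] : x \in submod_add (F k1) Ki.
  apply/submod_addP; exists x, 0; rewrite addr0; split=> //; last exact: ideal0.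
  exact: (dFle _ _ _ (leq_maxl k1 k2)).
have zF : z \in F k2.
  have -> : z = x - y by rewrite xE addrAC subrr add0r.
  by apply: idealB; [apply: (dFle _ _ _ (leq_maxr k1 k2))|exact: (dFle _ _ _ k2m)].
have [c zE] : exists v, z = rowcomb g v.
  have [c ->] := gS z zK; exists (\row_i c (enum_val i)); rewrite rowcombE.
  rewrite (reindex (fun i : 'I_#|T| => enum_val i : T)) /=.
    by apply: eq_bigr => i _; rewrite mxE.
  by exists enum_rank => i _; rewrite ?enum_valK ?enum_rankK.
rewrite xE; apply: idealD => //; rewrite zE; apply/preimageP/(k2P m _ k2m)/preimageP.
by rewrite -zE.
Qed.

(** The topological closure of K^q, which is a left ideal. *)
Definition pow_closure q : set R :=
  [set x | forall L : lideal, open_ideal L -> (forall y, pow q y -> y \in L) -> x \in L].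
Local Notation "''a_' q" := (pow_closure q) (at level 8, q at level 2).

Lemma pow_closure_sub q : pow q `<=` 'a_q.
Proof. by move=> x xK L oL; exact. Qed.

Lemma closureMr q x b : 'a_q x -> 'a_q (x * b).
Proof.
move=> xa L oL KL; apply/ideal_shiftP; apply: xa; first exact: open_ideal_shift.
by move=> y yK; apply/ideal_shiftP/KL/powMr.
Qed.

Lemma closureD q x y : 'a_q x -> 'a_q y -> 'a_q (x + y).
Proof. by move=> xa ya L oL KL; apply: idealD; [exact: xa|exact: ya]. Qed.

Lemma closureMl q a x : 'a_q x -> 'a_q (a * x).
Proof. by move=> xa L oL KL; exact/idealMl/xa. Qed.

Lemma closure0 q : 'a_q 0. Proof. by move=> L _ _; exact: ideal0. Qed.

Lemma closure_le p q x : (p <= q)%N -> 'a_q x -> 'a_p x.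
Proof. by move=> pq xa L oL KL; apply: xa => // y /(pow_le pq); exact: KL. Qed.

Lemma closure_open (L : lideal) : open_ideal L -> exists q, forall x, 'a_q x -> x \in L.
Proof. by move=> oL; have [q qP] := radical_exp_open pcR oL; exists q => x xa; exact: xa. Qed.

Lemma closure1 x : 'a_1 x -> K x.
Proof. by move=> xa L [oL mL]; apply: xa => // y /pow1; apply. Qed.

Section Automorphism.
Variables s s' : R -> R.
Hypotheses (sK : cancel s s') (s'K : cancel s' s) (sD : {morph s : x y / x + y})
  (sM : {morph s : x y / x * y}) (s_cont : continuous s).

Let s0 : s 0 = 0.
Proof. by apply: (addrI (s 0)); rewrite -sD !addr0. Qed.
Let s'D : {morph s' : x y / x + y}.
Proof. by move=> x y; apply: (can_inj sK); rewrite s'K sD !s'K. Qed.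
Let s'M : {morph s' : x y / x * y}.
Proof. by move=> x y; apply: (can_inj sK); rewrite s'K sM !s'K. Qed.

Definition ideal_pullback (L : lideal) : lideal.
Proof.
apply: (@submod_of R R^o [set x : R | s x \in L]) => /=.
- by rewrite s0 ideal0.
- by move=> x y xL yL; rewrite sD idealD.
- by move=> a x xL; rewrite -[a *: x]/((a : R) * x) sM; exact: idealMl.
Defined.

Lemma ideal_pullbackP L (x : R) : x \in ideal_pullback L <-> s x \in L.
Proof. exact: (@submod_ofP R R^o _ _ _ _ x). Qed.

Lemma open_pullback L : open_ideal L -> open_ideal (ideal_pullback L).
Proof.
move=> oL; rewrite /open_ideal (_ : [set _ | _] = s @^-1` [set x : R | x \in L]).
  by have /continuousP/(_ _ oL) := s_cont.
by apply/seteqP; split=> x /= /ideal_pullbackP.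
Qed.

Definition ideal_push (L : lideal) : lideal.
Proof.
apply: (@submod_of R R^o [set x : R | s' x \in L]) => /=.
- by rewrite (_ : s' 0 = 0) ?ideal0 // -[in LHS]s0 sK.
- by move=> x y xL yL; rewrite s'D idealD.
- by move=> a x xL; rewrite -[a *: x]/((a : R) * x) s'M; exact: idealMl.
Defined.

Lemma ideal_pushP L (x : R) : x \in ideal_push L <-> s' x \in L.
Proof. exact: (@submod_ofP R R^o _ _ _ _ x). Qed.

Lemma s1 : s 1 = 1.
Proof. by rewrite -[s 1]mulr1 -{2}(s'K 1) -sM mul1r s'K. Qed.

(** The preimage under s of an open maximal left ideal is open and maximal. Stated for any
    automorphism so as to serve both sigma and its inverse. *)
Lemma radical_auto x : K x -> K (s x).
Proof.
move=> xK L [oL [L1 mL]]; apply/ideal_pullbackP; apply: xK; split; first exact: open_pullback.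
split; first by move=> /ideal_pullbackP; rewrite s1.
move=> G LG; have [|G1|GL] := mL (ideal_push G).
- by move=> y yL; apply/ideal_pushP/LG/ideal_pullbackP; rewrite s'K.
- by left; have /ideal_pushP := G1; rewrite -{1}s1 sK.
- right=> y; apply/idP/idP => [yG|/LG //]; apply/ideal_pullbackP.
  by rewrite -GL; apply/ideal_pushP; rewrite sK.
Qed.

Lemma pow_auto n x : pow n x -> pow n (s x).
Proof.
elim: n x => // n IHn; apply: ideal_exp_ind => [|x y xs ys|a b an bK].
- by rewrite s0; exact: ideal_exp0.
- by rewrite sD; exact: powD.
- by rewrite sM; apply: ideal_exp_mul; [exact: IHn|exact: radical_auto].
Qed.

Lemma closure_auto q x : 'a_q x -> 'a_q (s x).
Proof.
move=> xa L oL KL; apply/ideal_pullbackP; apply: xa; first exact: open_pullback.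
by move=> y yK; apply/ideal_pullbackP/KL/pow_auto.
Qed.
End Automorphism.

Let dD : {morph delta : x y / x + y} := deltaP.1.
Let dM := deltaP.2.
Let sK : cancel sigma sigmaV. Proof. by case: sigmaP. Qed.
Let sVK : cancel sigmaV sigma. Proof. by case: sigmaP. Qed.
Let sigmaVD : {morph sigmaV : x y / x + y}.
Proof. by move=> x y; apply: (can_inj sK); rewrite sVK rmorphD !sVK. Qed.
Let sigmaVM : {morph sigmaV : x y / x * y}.
Proof. by move=> x y; apply: (can_inj sK); rewrite sVK rmorphM !sVK. Qed.

Lemma delta0 : delta 0 = 0.
Proof. by apply: (addrI (delta 0)); rewrite -dD !addr0. Qed.

Lemma pow_sigma n x : pow n x -> pow n (sigma x).
Proof.
have [_ _ sc _] := sigmaP; apply: (pow_auto sK sVK) => //; first exact: rmorphD.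
exact: rmorphM.
Qed.

Lemma closure_sigma q x : 'a_q x -> 'a_q (sigma x).
Proof.
have [_ _ sc _] := sigmaP; apply: (closure_auto sK sVK) => //; first exact: rmorphD.
exact: rmorphM.
Qed.

Lemma closure_sigmaV q x : 'a_q x -> 'a_q (sigmaV x).
Proof. by have [_ _ _ sc] := sigmaP; apply: (closure_auto sVK sK). Qed.

(** No power need be stable: delta may send K outside K. By the Leibniz rule each factor of a
    product is differentiated in turn, so one factor at most is lost. *)
Lemma pow_delta n x : pow n.+1 x -> pow n (delta x).
Proof.
elim: n x => // n IHn; apply: ideal_exp_ind => [|x y xs ys|a b an bK].
- by rewrite delta0; exact: ideal_exp0.
- by rewrite dD; exact: powD.
- rewrite dM; apply: powD; first by apply: ideal_exp_mul; [exact: IHn|].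
  exact/powMr/pow_sigma.
Qed.

(* {x | delta x \in L} is not a left ideal, but its intersection with L is. *)
Definition delta_pullback (L : lideal) : lideal.
Proof.
apply: (@submod_of R R^o [set x : R | x \in L /\ delta x \in L]) => /=.
- by rewrite delta0 ideal0.
- by move=> x y [xL dxL] [yL dyL]; rewrite dD !idealD.
- move=> a x [xL dxL]; rewrite -[a *: x]/((a : R) * x) dM; split; first exact: idealMl.
  by apply: idealD; exact: idealMl.
Defined.

Lemma delta_pullbackP L (x : R) : x \in delta_pullback L <-> x \in L /\ delta x \in L.
Proof. exact: (@submod_ofP R R^o _ _ _ _ x). Qed.

Lemma closure_delta q x : 'a_q.+1 x -> 'a_q (delta x).
Proof.
move=> xa L oL KL.
suff : x \in delta_pullback L by case/delta_pullbackP.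
apply: xa.
  rewrite /open_ideal (_ : [set _ | _] = [set x : R | x \in L] `&` delta @^-1` [set x : R | x \in L]).
    by apply: openI => //; have /continuousP/(_ _ oL) := delta_cont.
  by apply/seteqP; split=> y /= /delta_pullbackP.
move=> y yK; apply/delta_pullbackP; split; apply: KL; last exact: pow_delta.
exact: pow_le (leqnSn q) yK.
Qed.

Local Notation ev := (monomial_eval delta sigma sigmaV).

Lemma monomial_eval_cat w w' x : ev (w ++ w') x = ev w (ev w' x).
Proof. by rewrite /monomial_eval foldr_cat. Qed.

Lemma closure_word q w x : 'a_(q + count is_Y w) x -> 'a_q (ev w x).
Proof.
elim: w q => [|c w IHw] q; first by rewrite addn0.
case: c => /=.
- by rewrite addnCA add1n -addSn => /IHw/closure_delta.
- by rewrite add0n => /IHw/closure_sigma.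
- by rewrite add0n => /IHw/closure_sigmaV.
Qed.

(** The largest part of the closure that sigma, its inverse and delta preserve. *)
Definition stable_core q : set R := [set x | forall w, 'a_q (ev w x)].
Local Notation I := stable_core.

Lemma words_closure q : exists m, forall w x, (m <= count is_Y w)%N -> 'a_q (ev w x).
Proof.
(* Nilpotency is stated for exponents at least 1; q + 1 covers q = 0 too. *)
have [m _ mP] := nilp (ltn0Sn q); exists m => w x wm.
apply: (closure_le (leqnSn q)); apply: pow_closure_sub.
apply: (ideal_exp_sub (@jacobson_open_radical R)); apply: (mP w wm).
by exists x.
Qed.

(** Words with at most m deltas cost at most m exponents, and longer ones are covered by
    [words_closure]. *)
Lemma closure_core q : exists m, forall x, 'a_m x -> I q x.
Proof.
have [m mP] := words_closure q; exists (q + m)%N => x xa w.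
have [wm|/ltnW wm] := leqP m (count is_Y w); first exact: mP.
by apply: closure_word; apply: closure_le xa; rewrite leq_add2l.
Qed.

Lemma word_additive w : {morph ev w : x y / x + y}.
Proof.
elim: w => // c w IHw x y; case: c; rewrite /= IHw; first exact: dD.
  exact: rmorphD.
exact: sigmaVD.
Qed.

Lemma word0 w : ev w 0 = 0.
Proof. by apply: (addrI (ev w 0)); rewrite -word_additive !addr0. Qed.

Lemma word_rcons w c x : ev (rcons w c) x = ev w (ev [:: c] x).
Proof. by rewrite -cats1 monomial_eval_cat. Qed.

Lemma core_letter q c x : I q x -> I q (ev [:: c] x).
Proof. by move=> xI w; rewrite -word_rcons. Qed.

(** Induction from the innermost letter, for x and y at once: the Leibniz rule leaves a word applied
    to products in which one factor still belongs to the core. *)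
Lemma coreM q x y : I q x \/ I q y -> I q (x * y).
Proof.
move=> xy w; elim/last_ind: w x y xy => [|w c IHw] x y.
  by case=> /(_ [::]) /= h; [exact: closureMr|exact: closureMl].
rewrite word_rcons => xy; case: c => /=.
- rewrite dM word_additive; apply: closureD; apply: IHw.
    by case: xy => [/(core_letter Y)|]; [left|right].
  by case: xy => [/(core_letter Z)|/(core_letter Y)]; [left|right].
- rewrite rmorphM; apply: IHw.
  by case: xy => /(core_letter Z); [left|right].
- rewrite sigmaVM; apply: IHw.
  by case: xy => /(core_letter Z'); [left|right].
Qed.

Lemma core_closure q x : I q x -> 'a_q x. Proof. by move/(_ [::]). Qed.

Lemma coreD q x y : I q x -> I q y -> I q (x + y).
Proof. by move=> xI yI w; rewrite word_additive; exact: closureD. Qed.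

Lemma core_complete (u : nat -> R) :
  (forall q, exists N, forall n, (N <= n)%N -> I q (u n.+1 - u n)) ->
  exists l, forall q, exists N, forall n, (N <= n)%N -> I q (l - u n).
Proof.
move=> uC; have [hR cR _] := pcR.
have uC' q : exists N, forall n m, (N <= n)%N -> (n <= m)%N -> 'a_q (u m - u n).
  have [N NP] := uC q; exists N => n m Nn; elim: m => [|m IHm].
    by rewrite leqn0 => /eqP ->; rewrite subrr; exact: closure0.
  rewrite leq_eqVlt => /orP[/eqP ->|nm]; first by rewrite subrr; exact: closure0.
  rewrite -(subrKA (u m)); apply: closureD; last exact: IHm.
  by apply: core_closure; apply: NP; exact: leq_trans Nn nm.
have [l ul] : exists l : R, u @ \oo --> l.
  apply: cR => U /(open_ideal_base pcR)[L [oL LU _]].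
  have [q qL] := closure_open oL; have [N NP] := uC' q.
  exists [set y | y - u N \in L].
    by exists N => // n /= Nn; apply: qL; exact: NP.
  move=> y z /= yL zL; apply: LU; rewrite /= -(subrKA (u N)); apply: idealD => //.
  by rewrite -opprB; exact: idealN.
(* The topological limit is controlled only in closures, so the estimate is made in the closure of
   K^m, which lies inside I q. *)
exists l => q; have [m mq] := closure_core q; have [N NP] := uC' m.
exists N => n Nn; apply: mq => L oL KL.
have [M _ MP] := ul _ (coset_nbhs l oL).
rewrite -(subrKA (u (maxn n M))); apply: idealD.
  by rewrite -opprB; apply: idealN; apply: (MP (maxn n M)); exact: leq_maxr.
by apply: (NP n) => //; exact: leq_maxl.
Qed.

Theorem skew_filtration_exists : skew_filtration sigma sigmaV delta I.
Proof.
split.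
- by move=> q w; rewrite word0; exact: closure0.
- exact: coreD.
- by move=> q a x xI; apply: coreM; right.
- by move=> q x a xI; apply: coreM; left.
- by move=> q x; exact: (@core_letter q Z).
- by move=> q x; exact: (@core_letter q Z').
- by move=> q x; exact: (@core_letter q Y).
- move=> q; have [m mP] := words_closure q; exists m => w x wm w'.
  by rewrite -monomial_eval_cat; apply: mP; rewrite count_cat (leq_trans wm) // leq_addl.
- move=> x xI; apply: (open_ideal_separated pcR) => L /closure_open[q qL].
  exact/qL/core_closure/xI.
- exact: core_complete.
- by move=> q x xI w; exact: closure_le (leqnSn q) (xI w).
(* I 1 lies in K, so its m-th power lies in K^m and hence in I q. *)
- move=> q; have [m mP] := closure_core q; exists m => x xI; apply: mP.
  apply: pow_closure_sub; apply: ideal_exp_sub xI => y yI.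
  exact/closure1/core_closure.
- have [m mP] := closure_core 1.
  by apply: (@artinian_sub R R^o (pow m) _ _ (@pow_artinian m)) => x xp; exact/mP/pow_closure_sub.
Qed.
End Filtration.

(** Keeps only products with constants and with t. These are finite formulas, so convergence in R
    disappears from here on. *)
Record series_model (R S : pzRingType) (sigma delta : R -> R) := {
  scst :> {rmorphism R -> S};
  scoef : S -> nat -> R;
  svar : S;
  scoef_inj : forall f g, (forall m, scoef f m = scoef g m) -> f = g;
  scoef_surj : forall a : nat -> R, exists f, forall m, scoef f m = a m;
  scoefD : forall f g m, scoef (f + g) m = scoef f m + scoef g m;
  scoef_cst : forall a m, scoef (scst a) m = if m is 0%N then a else 0;
  scoef_cstM : forall a f m, scoef (scst a * f) m = a * scoef f m;
  scoef_varM : forall f m,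
    scoef (svar * f) m = (if m is k.+1 then sigma (scoef f k) else 0) + delta (scoef f m);
  scoef_Mvar : forall f m, scoef (f * svar) m = if m is k.+1 then scoef f k else 0 }.

(** * Products with constants and with t *)

Section Model.
Variables (R : topologicalPzRingType) (sigma : {rmorphism R -> R}) (delta : R -> R).
Variables (S : pzRingType) (HS : skew_power_series_ring sigma delta S).
Hypothesis hR : hausdorff_space R.
Hypothesis deltaP : left_sigma_derivation sigma delta.

Lemma limit_eventually (u : nat -> R) c d N0 :
  u @ \oo --> c -> (forall N, (N0 <= N)%N -> u N = d) -> c = d.
Proof.
move=> uc ud; apply: (cvg_unique hR uc).
by apply: cvg_near_cst; exists N0 => // N /= /ud ->.
Qed.

Let delta_0 : delta 0 = 0.
Proof. by apply: (addrI (delta 0)); rewrite -deltaP.1 !addr0. Qed.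

Let delta_1 : delta 1 = 0.
Proof.
by apply: (addrI (delta 1)); have := deltaP.2 1 1; rewrite !mulr1 rmorph1 mul1r addr0.
Qed.

Let sub_word (w : seq bool) (x : R) :=
  foldr (fun b : bool => if b then delta else (sigma : R -> R)) x w.

Lemma skew_monomial0 l x : skew_monomial_sum delta sigma 0 l x = iter l sigma x.
Proof.
rewrite /skew_monomial_sum (big_pred1 (nseq_tuple l false)) /=.
  by elim: l => //= l ->.
move=> w /=; apply/eqP/eqP => [w0|->]; last by rewrite /= count_nseq.
have E (s : seq bool) : count id s = 0%N -> s = nseq (size s) false.
  by elim: s => //= -[] //= s IHs /IHs {1}->.
by apply: val_inj => /=; rewrite [LHS](E _ w0) size_tuple.
Qed.

Lemma skew_monomial1 x : skew_monomial_sum delta sigma 1 0 x = delta x.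
Proof.
rewrite /skew_monomial_sum (big_pred1 [tuple true]) //=.
move=> w; case/tupleP: w => b w; rewrite (tuple0 w) /=.
by case: b.
Qed.

Lemma skew_monomial_at0 k l : skew_monomial_sum delta sigma k l 0 = 0.
Proof.
apply: big1 => w _; elim: (tval w) => //= b s ->.
by case: b; rewrite ?delta_0 ?rmorph0.
Qed.

Lemma skew_monomial_at1 k l : skew_monomial_sum delta sigma k l 1 = (k == 0%N)%:R.
Proof.
case: k => [|k].
  by rewrite skew_monomial0; elim: l => //= l ->; rewrite rmorph1.
apply: big1 => w /eqP wk.
suff E (s : seq bool) : sub_word s 1 = (count id s == 0%N)%:R by rewrite [LHS]E wk.
elim: s => //= b s ->; case: b => /=.
  by case: eqP; rewrite ?delta_1 ?delta_0.
by case: eqP; rewrite ?rmorph1 ?rmorph0.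
Qed.

Lemma sps_var_exists : exists t : S, forall m, sps_coef HS t m = (m == 1%N)%:R.
Proof.
have [g _ gK] := sps_coef_bij HS; exists (g (fun m => (m == 1%N)%:R)) => m.
by rewrite gK.
Qed.

(** When the partial sums are eventually constant, uniqueness of limits in a Hausdorff ring gives
    the coefficient. *)
Lemma sps_coefM_eventually f g m (d : nat -> R) :
  (forall n, (n <= m)%N -> exists N0, forall N, (N0 <= N)%N ->
    \sum_(n <= j < N) sps_coef HS f j *
      skew_monomial_sum delta sigma (j - n) n (sps_coef HS g (m - n)%N) = d n) ->
  sps_coef HS (f * g) m = \sum_(n < m.+1) d n.
Proof.
move=> dP; have [c cP ->] := sps_coefM HS f g m; apply: eq_bigr => n _.
have nm : (n <= m)%N by rewrite -ltnS.
by have [N0 N0P] := dP n nm; exact: limit_eventually (cP n nm) N0P.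
Qed.

Lemma sps_series_model : exists mdl : series_model S sigma delta, scst mdl = sps_const HS.
Proof.
have [t tP] := sps_var_exists; pose cf := sps_coef HS.
have inj f g : (forall m, cf f m = cf g m) -> f = g.
  by move=> fg; apply: (bij_inj (sps_coef_bij HS)); apply: funext.
have surj a : exists f, forall m, cf f m = a m.
  by have [g _ gK] := sps_coef_bij HS; exists (g a) => m; rewrite /cf gK.
have cM a f m : cf (sps_const HS a * f) m = a * cf f m.
  rewrite /cf (@sps_coefM_eventually _ _ _ (fun n => if n is 0%N then a * cf f m else 0)).
    by rewrite big_ord_recl big1 ?addr0.
  move=> n _; exists 1%N => -[//|N] _; case: n => [|n].
    rewrite big_nat_recl // subnn subn0 skew_monomial0 /= sps_coefC big1 ?addr0 // => j _.
    by rewrite sps_coefC mul0r.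
  rewrite big_nat_cond big1 // => -[|j]; first by rewrite ltn0.
  by rewrite sps_coefC mul0r.
have tM f m : cf (t * f) m = (if m is k.+1 then sigma (cf f k) else 0) + delta (cf f m).
  (* Only j = 1 contributes, hence n is 0 or 1, with M_(1,0) = delta and M_(0,1) = sigma. *)
  rewrite /cf (@sps_coefM_eventually _ _ _ (fun n => match n with
      0%N => delta (cf f m) | 1%N => if m is k.+1 then sigma (cf f k) else 0 | _ => 0 end)).
    case: m => [|m]; first by rewrite big_ord_recl big_ord0 addr0 add0r.
    by rewrite 2!big_ord_recl big1 ?addr0 // addrC.
  move=> n nm; exists 2%N => -[//|[//|N]] _; case: n nm => [|[|n]] nm.
  - rewrite 2?big_nat_recl // big1 ?addr0 => [|j _]; last by rewrite tP mul0r.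
    by rewrite !tP /= mulr0n mulr1n mul0r mul1r add0r !subn0 skew_monomial1.
  - rewrite big_nat_recl // big_nat_cond big1 ?addr0 => [|[|j] // _]; last by rewrite tP mul0r.
    rewrite tP /= mulr1n mul1r subnn skew_monomial0 /=; by case: m nm => // m _; rewrite subn1.
  - by rewrite big_nat_cond big1 // => -[|[|j]] //; rewrite tP mul0r.
have Mt f m : cf (f * t) m = if m is k.+1 then cf f k else 0.
  (* The right factor contributes only for m - n = 1, and M_(k,l)(1) = 0 for k > 0 leaves j = n. *)
  rewrite /cf (@sps_coefM_eventually _ _ _ (fun n => if n.+1 == m then cf f n else 0)).
    case: m => [|m]; first by rewrite big_ord_recl big_ord0 addr0.
    by rewrite big_ord_recr big_ord_recr /= eqxx (gtn_eqF (ltnSn _)) addr0 big1 ?add0r // => i _;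
      rewrite eqSS (ltn_eqF (ltn_ord i)).
  move=> n nm; exists n.+1 => N nN; rewrite big_ltn // big1_seq ?addr0 => [|j].
    rewrite tP -(eqn_add2r n) subnK // add1n eq_sym.
    case: eqP => _ /=; rewrite ?mulr1n ?mulr0n; last by rewrite skew_monomial_at0 mulr0.
    by rewrite skew_monomial_at1 subnn /= mulr1n mulr1.
  rewrite mem_index_iota => /andP[_ /andP[nj _]].
  rewrite tP; case: eqP => _; last by rewrite skew_monomial_at0 mulr0.
  by rewrite skew_monomial_at1 subn_eq0 leqNgt nj mulr0.
by exists (@Build_series_model R S sigma delta (sps_const HS) cf t inj surj
  (sps_coefD HS) (sps_coefC HS) cM tM Mt).
Qed.
End Model.

(** * Division by t - B *)

Section Division.
Variables (R S : pzRingType) (sigma : {rmorphism R -> R}) (sigmaV delta : R -> R).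
Hypotheses (sK : cancel sigma sigmaV) (sVK : cancel sigmaV sigma).
Hypothesis deltaP : left_sigma_derivation sigma delta.
Variable mdl : series_model S sigma delta.
Variable I : nat -> set R.
Hypothesis fil : skew_filtration sigma sigmaV delta I.
Local Notation C := (scst mdl).
Local Notation t := (svar mdl).
Local Notation cf := (scoef mdl).
Local Notation ev := (monomial_eval delta sigma sigmaV).

Lemma dD : {morph delta : x y / x + y}. Proof. exact: deltaP.1. Qed.
Lemma d0 : delta 0 = 0.
Proof. by apply: (addrI (delta 0)); rewrite -dD !addr0. Qed.
Lemma sVD : {morph sigmaV : x y / x + y}.
Proof. by move=> x y; apply: (can_inj sK); rewrite sVK rmorphD !sVK. Qed.
Lemma sV0 : sigmaV 0 = 0. Proof. by rewrite -[0](rmorph0 sigma) sK rmorph0. Qed.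
Lemma sVN x : sigmaV (- x) = - sigmaV x.
Proof. by apply: (can_inj sK); rewrite sVK rmorphN sVK. Qed.
Lemma sVB x y : sigmaV (x - y) = sigmaV x - sigmaV y. Proof. by rewrite sVD sVN. Qed.
Lemma evD w : {morph ev w : x y / x + y}.
Proof.
elim: w => // c w IHw x y; case: c; rewrite /= IHw; first exact: dD.
  exact: rmorphD.
exact: sVD.
Qed.

Lemma ev_cat w w' x : ev (w ++ w') x = ev w (ev w' x).
Proof. by rewrite /monomial_eval foldr_cat. Qed.

Lemma ev0 w : ev w 0 = 0.
Proof. by apply: (addrI (ev w 0)); rewrite -evD !addr0. Qed.

Lemma evN w x : ev w (- x) = - ev w x.
Proof. by apply: (addrI (ev w x)); rewrite -evD !subrr ev0. Qed.

Lemma filN q x : I q x -> I q (- x).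
Proof. by rewrite -mulN1r; exact: (filMl fil). Qed.

Lemma filB q x y : I q x -> I q y -> I q (x - y).
Proof. by move=> xI yI; apply: (filD fil) => //; exact: filN. Qed.

Lemma fil_word q w x : I q x -> I q (ev w x).
Proof.
move=> xI; elim: w => // c w IHw; case: c => /=.
- exact: (fil_delta fil).
- exact: (fil_sigma fil).
- exact: (fil_sigmaV fil).
Qed.

Lemma fil_sum q (T : Type) (r : seq T) (P : pred T) (F : T -> R) :
  (forall i, P i -> I q (F i)) -> I q (\sum_(i <- r | P i) F i).
Proof. by apply: (big_ind (I q)); [exact: (fil0 fil)|exact: (filD fil)]. Qed.

Section Matrices.
Variables a b : nat.

Definition mx_fil q (v : 'M[R]_(a, b)) : Prop := forall i j, I q (v i j).

Lemma mx_fil_separated v : (forall q, mx_fil q v) -> v = 0.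
Proof.
move=> vI; apply/matrixP => i j; rewrite mxE; apply: (fil_separated fil) => q.
exact: vI.
Qed.

Lemma mx_filD q u v : mx_fil q u -> mx_fil q v -> mx_fil q (u + v).
Proof. by move=> uI vI i j; rewrite mxE; apply: (filD fil). Qed.

Lemma mx_filB q u v : mx_fil q u -> mx_fil q v -> mx_fil q (u - v).
Proof. by move=> uI vI i j; rewrite !mxE; apply: filB. Qed.

Lemma mx_fil_complete (u : nat -> 'M[R]_(a, b)) :
  (forall q, exists N, forall n, (N <= n)%N -> mx_fil q (u n.+1 - u n)) ->
  exists l, forall q, exists N, forall n, (N <= n)%N -> mx_fil q (l - u n).
Proof.
move=> uC.
have /choice[l lP] (ij : 'I_a * 'I_b) : exists l, forall q, exists N, forall n,
    (N <= n)%N -> I q (l - u n ij.1 ij.2).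
  apply: (fil_complete fil) => q; have [N NP] := uC q; exists N => n Nn.
  by have := NP n Nn ij.1 ij.2; rewrite !mxE.
exists (\matrix_(i, j) l (i, j)) => q.
have /choice[N NP] ij := lP ij q.
exists (\max_ij N ij) => n Nn i j; rewrite !mxE; apply: (NP (i, j)).
exact: leq_trans (leq_bigmax (i, j)) Nn.
Qed.

Variable theta : 'M[R]_(a, b) -> 'M[R]_(a, b).
Hypothesis thetaD : {morph theta : u v / u + v}.
Hypothesis theta_fil : forall q v, mx_fil q v -> mx_fil q (theta v).
Hypothesis theta_nilp : forall q, exists N, forall k v, (N <= k)%N -> mx_fil q (iter k theta v).

Lemma theta0 : theta 0 = 0.
Proof. by apply: (addrI (theta 0)); rewrite -thetaD !addr0. Qed.

Lemma thetaB u v : theta (u - v) = theta u - theta v.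
Proof. by apply: (addIr (theta v)); rewrite -thetaD !subrK. Qed.

(** w_l = theta^N(w_(l+N)) for every N, and high powers of theta are small uniformly in the
    argument. *)
Lemma recursion_unique (w : nat -> 'M[R]_(a, b)) :
  (forall l, w l = theta (w l.+1)) -> forall l, w l = 0.
Proof.
move=> wE l; apply: mx_fil_separated => q; have [N NP] := theta_nilp q.
suff -> : w l = iter N theta (w (l + N)%N) by exact: NP.
elim: N l {NP} => [|N IHN] l; first by rewrite addn0.
by rewrite wE IHN addnS.
Qed.

(** The solution is the sum of the theta^k(c_(l+k)); it converges for arbitrary c because theta is
    nilpotent uniformly. *)
Lemma recursion_exists (c : nat -> 'M[R]_(a, b)) :
  exists w, forall l, w l = c l + theta (w l.+1).
Proof.
pose s l N := \sum_(k < N) iter k theta (c (l + k)%N).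
have sE l N : s l N.+1 = c l + theta (s l.+1 N).
  rewrite /s big_ord_recl addn0; congr (_ + _).
  rewrite (big_morph theta thetaD theta0); apply: eq_bigr => k _ /=.
  by rewrite addSnnS.
have /choice[w wP] l : exists w, forall q, exists N, forall n, (N <= n)%N ->
    mx_fil q (w - s l n).
  apply: mx_fil_complete => q; have [N NP] := theta_nilp q; exists N => n Nn.
  by rewrite /s big_ord_recr /= addrAC subrr add0r; exact: NP.
exists w => l; apply/eqP; rewrite -subr_eq0; apply/eqP/mx_fil_separated => q.
have [N NP] := wP l q; have [N' NP'] := wP l.+1 q.
pose n := maxn N N'.
have -> : w l - (c l + theta (w l.+1)) = (w l - s l n.+1) - theta (w l.+1 - s l.+1 n).
  by rewrite thetaB sE opprB !opprD !addrA subrK.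
apply: mx_filB; first by apply: NP; rewrite leqW // leq_maxl.
by apply/theta_fil/NP'; exact: leq_maxr.
Qed.
End Matrices.

Lemma scoef0 m : cf 0 m = 0.
Proof. by apply: (addrI (cf 0 m)); rewrite -scoefD !addr0. Qed.

Lemma scoefN f m : cf (- f) m = - cf f m.
Proof. by apply: (addrI (cf f m)); rewrite -scoefD !subrr scoef0. Qed.

Lemma scoef_sum (T : Type) (r : seq T) (P : pred T) (F : T -> S) m :
  cf (\sum_(i <- r | P i) F i) m = \sum_(i <- r | P i) cf (F i) m.
Proof. exact: (big_morph (cf^~ m) (fun f g => scoefD _ f g m) (scoef0 m)). Qed.

Lemma var_cst x : t * C x = C (sigma x) * t + C (delta x).
Proof.
apply: (scoef_inj (s := mdl)) => m.
rewrite scoef_varM scoefD scoef_Mvar !scoef_cst; case: m => [|[|m]]; rewrite ?scoef_cst //.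
  by rewrite d0.
by rewrite rmorph0 d0.
Qed.

Definition mx_coef a b (s : 'M[S]_(a, b)) m : 'M[R]_(a, b) := map_mx (cf^~ m) s.
Local Notation mcf := mx_coef.
Definition mx_cst a b (s : 'M[R]_(a, b)) : 'M[S]_(a, b) := map_mx C s.
Local Notation Cm := mx_cst.

Lemma mx_coef_inj a b (s s' : 'M[S]_(a, b)) : (forall m, mcf s m = mcf s' m) -> s = s'.
Proof.
move=> ss; apply/matrixP => i j; apply: (scoef_inj (s := mdl)) => m.
by have /matrixP/(_ i j) := ss m; rewrite !mxE.
Qed.

Lemma mx_coef_surj a b (c : nat -> 'M[R]_(a, b)) : exists s, forall m, mcf s m = c m.
Proof.
have /choice[s sP] (ij : 'I_a * 'I_b) := scoef_surj mdl (fun m => c m ij.1 ij.2).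
exists (\matrix_(i, j) s (i, j)) => m; apply/matrixP => i j; rewrite !mxE.
exact: (sP (i, j)).
Qed.

Lemma mx_coefD a b (s s' : 'M[S]_(a, b)) m : mcf (s + s') m = mcf s m + mcf s' m.
Proof. by apply/matrixP => i j; rewrite !mxE scoefD. Qed.

Lemma mx_coefN a b (s : 'M[S]_(a, b)) m : mcf (- s) m = - mcf s m.
Proof. by apply/matrixP => i j; rewrite !mxE scoefN. Qed.

Lemma mx_coef_cst a b (s : 'M[R]_(a, b)) m : mcf (Cm s) m = if m is 0%N then s else 0.
Proof. by apply/matrixP => i j; rewrite !mxE scoef_cst; case: m; rewrite ?mxE. Qed.

Lemma mx_coef_cstM a b c (B : 'M[R]_(a, b)) (s : 'M[S]_(b, c)) m :
  mcf (Cm B *m s) m = B *m mcf s m.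
Proof.
apply/matrixP => i j; rewrite !mxE scoef_sum; apply: eq_bigr => k _.
by rewrite !mxE scoef_cstM.
Qed.

Lemma mx_coef_var a b (s : 'M[S]_(a, b)) m :
  mcf (t *: s) m = (if m is k.+1 then map_mx sigma (mcf s k) else 0) + map_mx delta (mcf s m).
Proof.
apply/matrixP => i j; rewrite [RHS]mxE [LHS]mxE mxE scoef_varM; case: m => [|m].
  by rewrite !mxE.
by rewrite !mxE.
Qed.

Section Operator.
Variables (n : nat) (B : 'M[R]_n).

(* The action of t on the free module R^n of rows, e_i being sent to the i-th
   row of B. *)
Definition twist (v : 'rV[R]_n) : 'rV[R]_n := map_mx sigma v *m B + map_mx delta v.

Definition topologically_nilpotent : Prop :=
  forall q, exists N, forall k v, (N <= k)%N -> mx_fil q (iter k twist v).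

(** Comparing coefficients of t^(l+1) in (t - B) u = c gives u_l = sigma^-1(c_(l+1)) +
    cotwist(u_(l+1)). *)
Definition cotwist (v : 'cV[R]_n) : 'cV[R]_n := map_mx sigmaV (B *m v - map_mx delta v).

Lemma twistD : {morph twist : u v / u + v}.
Proof.
move=> u v; rewrite /twist map_mxD mulmxDl [RHS]addrACA; congr (_ + _).
by apply/matrixP => i j; rewrite !mxE dD.
Qed.

Lemma mx_fil_mulr a b c q (u : 'M[R]_(a, b)) (v : 'M[R]_(b, c)) :
  mx_fil q u -> mx_fil q (u *m v).
Proof. by move=> uI i j; rewrite mxE; apply: fil_sum => k _; exact: (filMr fil). Qed.

Lemma mx_fil_mull a b c q (u : 'M[R]_(a, b)) (v : 'M[R]_(b, c)) :
  mx_fil q v -> mx_fil q (u *m v).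
Proof. by move=> vI i j; rewrite mxE; apply: fil_sum => k _; exact: (filMl fil). Qed.

Lemma twist_fil q v : mx_fil q v -> mx_fil q (twist v).
Proof.
move=> vI; apply: mx_filD; first by apply: mx_fil_mulr => i j; rewrite mxE; exact: (fil_sigma fil).
by move=> i j; rewrite mxE; exact: (fil_delta fil).
Qed.

Lemma cotwistD : {morph cotwist : u v / u + v}.
Proof.
move=> u v; apply/matrixP => i j; rewrite !mxE -sVD; congr sigmaV.
rewrite dD opprD addrACA -big_split /=; congr (_ + _); apply: eq_bigr => k _.
by rewrite mxE mulrDr.
Qed.

Lemma cotwist_fil q v : mx_fil q v -> mx_fil q (cotwist v).
Proof.
move=> vI i j; rewrite mxE; apply: (fil_sigmaV fil).
apply: mx_filB; first exact: mx_fil_mull.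
by move=> k l; rewrite mxE; exact: (fil_delta fil).
Qed.

(* <x, cotwist v> = sigma^-1 (<twist x, v> - delta <x, v>) *)
Lemma cotwist_pairing (x : 'rV[R]_n) (v : 'cV[R]_n) :
  (x *m cotwist v) 0 0 = sigmaV ((twist x *m v) 0 0) - sigmaV (delta ((x *m v) 0 0)).
Proof.
apply: (can_inj sK); rewrite -sVB sVK.
have dxv : delta ((x *m v) 0 0) =
    (map_mx delta x *m v) 0 0 + (map_mx sigma x *m map_mx delta v) 0 0.
  rewrite !mxE (big_morph delta dD d0) -big_split; apply: eq_bigr => k _.
  by rewrite deltaP.2 !mxE.
have -> : sigma ((x *m cotwist v) 0 0) =
    (map_mx sigma x *m (B *m v - map_mx delta v)) 0 0.
  by rewrite !mxE rmorph_sum; apply: eq_bigr => k _; rewrite rmorphM !mxE sVK.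
have mxB (a b : 'M[R]_1) : (a - b) 0 0 = a 0 0 - b 0 0 by rewrite !mxE.
have mxD (a b : 'M[R]_1) : (a + b) 0 0 = a 0 0 + b 0 0 by rewrite !mxE.
by rewrite dxv mulmxBr mxB mulmxDl mxD mulmxA opprD addrA addrK.
Qed.

Hypothesis nB : topologically_nilpotent.

(** Pairing with a row x trades each cotwist for a twist of x or for a delta in the word outside.
    The total of cotwists, twists and deltas never drops, so in the end there are many twists or
    many deltas. *)
Lemma cotwist_nilp q : exists N, forall k v, (N <= k)%N -> mx_fil q (iter k cotwist v).
Proof.
have [m mP] := fil_words fil q; have [N0 N0P] := nB q.
have key k : forall w (x : 'rV[R]_n) j v, (m + N0 <= k + count is_Y w + j)%N ->
    I q (ev w ((iter j twist x *m iter k cotwist v) 0 0)).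
  elim: k => [|k IHk] w x j v kwj.
    have [wm|mw] := leqP m (count is_Y w); first exact: mP.
    apply/fil_word/mx_fil_mulr/N0P; rewrite -(leq_add2l m).
    by apply: (leq_trans kwj); rewrite add0n leq_add2r ltnW.
  rewrite iterS cotwist_pairing evD; apply: (filD fil).
    have := IHk (w ++ [:: Z']) x j.+1 v; rewrite ev_cat; apply.
    by rewrite count_cat addn0 addnS -!addSn.
  have := IHk (w ++ [:: Z'; Y]) x j v; rewrite ev_cat => h.
  rewrite evN; apply/filN/h.
  by rewrite count_cat /= addn1 addnS -addSn.
exists (m + N0)%N => k v mk i j; rewrite ord1.
have := key k [::] (delta_mx 0 i) 0%N v; rewrite /= -rowE mxE; apply.
by rewrite !addn0.
Qed.

End Operator.

Definition col_shift n (B : 'M[R]_n) (u : 'cV[S]_n) : 'cV[S]_n := t *: u - Cm B *m u.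

Lemma col_shift_coef n (B : 'M[R]_n) u l :
  mcf (col_shift B u) l = (if l is k.+1 then map_mx sigma (mcf u k) else 0) +
    map_mx delta (mcf u l) - B *m mcf u l.
Proof. by rewrite /col_shift mx_coefD mx_coefN mx_coef_cstM mx_coef_var. Qed.

Lemma map_sigmaV_K a b (v : 'M[R]_(a, b)) : map_mx sigma (map_mx sigmaV v) = v.
Proof. by apply/matrixP => i j; rewrite !mxE sVK. Qed.

Lemma map_sigma_K a b (v : 'M[R]_(a, b)) : map_mx sigmaV (map_mx sigma v) = v.
Proof. by apply/matrixP => i j; rewrite !mxE sK. Qed.

Lemma map_sigmaVD a b (u v : 'M[R]_(a, b)) :
  map_mx sigmaV (u + v) = map_mx sigmaV u + map_mx sigmaV v.
Proof. by apply/matrixP => i j; rewrite !mxE sVD. Qed.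

Lemma col_division n (B : 'M[R]_n) (c : 'cV[S]_n) : topologically_nilpotent B ->
  exists u r, c = col_shift B u + Cm r.
Proof.
move=> nB.
have [w wE] := recursion_exists (@cotwistD n B) (@cotwist_fil n B) (cotwist_nilp nB)
  (fun l => map_mx sigmaV (mcf c l.+1)).
have [u uE] := mx_coef_surj w.
exists u, (mcf c 0 - (map_mx delta (mcf u 0) - B *m mcf u 0)); apply: mx_coef_inj => -[|l].
  by rewrite mx_coefD col_shift_coef mx_coef_cst add0r addrC subrK.
rewrite mx_coefD col_shift_coef mx_coef_cst addr0 !uE (wE l) map_mxD !map_sigmaV_K.
by rewrite -addrA -[mcf c _ + _ + _]addrA [B *m _ - _ + _]addrA subrK subrr addr0.
Qed.

Lemma col_division_unique n (B : 'M[R]_n) u r : topologically_nilpotent B ->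
  col_shift B u = Cm r -> u = 0 /\ r = 0.
Proof.
move=> nB ur.
have u0 l : mcf u l = 0.
  apply: (recursion_unique (cotwist_nilp nB)) => {}l.
  have /(congr1 (map_mx sigmaV)) := congr1 (fun s => mcf s l.+1) ur.
  rewrite col_shift_coef mx_coef_cst -addrA map_sigmaVD map_sigma_K => E.
  apply/eqP; rewrite -subr_eq0; apply/eqP; rewrite -[RHS](_ : map_mx sigmaV (0 : 'cV_n) = 0).
    rewrite -E; congr (_ + _); apply/matrixP => i j; rewrite !mxE -sVN; congr sigmaV.
    by rewrite opprB.
  by apply/matrixP => i j; rewrite !mxE sV0.
have {}u0 : u = 0 by apply: mx_coef_inj => l; rewrite u0; apply/matrixP => i j; rewrite !mxE scoef0.
split=> //; have := congr1 (fun s => mcf s 0%N) ur.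
rewrite u0 /col_shift scaler0 mulmx0 subr0 mx_coef_cst => <-.
by apply/matrixP => i j; rewrite !mxE scoef0.
Qed.

(** For B = 0 the twist is delta. Dividing by t itself then gives the expansion with coefficients on
    the right. *)
Lemma nilpotent0 n : topologically_nilpotent (0 : 'M[R]_n).
Proof.
move=> q; have [m mP] := fil_words fil q; exists m => k v mk i j.
suff -> : iter k (twist 0) v = map_mx (ev (nseq k Y)) v.
  by rewrite mxE; apply: mP; rewrite count_nseq mul1n.
elim: k {mk} => [|k IHk]; first by apply/matrixP => ? ?; rewrite mxE.
rewrite iterS IHk /twist mulmx0 add0r.
by apply/matrixP => ? ?; rewrite !mxE.
Qed.

Lemma var_division (f : S) : exists g a, f = t * g + C a.
Proof.
have [u [r E]] := col_division (const_mx f) (@nilpotent0 1).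
exists (u 0 0), (r 0 0); have := congr1 (fun s : 'M[S]_1 => s 0 0) E.
by rewrite !mxE big1 ?subr0 // => k _; rewrite !mxE rmorph0 mul0r.
Qed.

Lemma var_division_unique g a : t * g + C a = 0 -> g = 0 /\ a = 0.
Proof.
move=> E; have [||u0 r0] := @col_division_unique 1 0 (const_mx g) (const_mx (- a)).
- exact: nilpotent0.
- apply/matrixP => i j; rewrite !mxE big1 ?subr0 => [|k _]; last by rewrite !mxE rmorph0 mul0r.
  by rewrite rmorphN; apply/eqP; rewrite -addr_eq0 E.
have /(congr1 (fun s : 'M[S]_1 => s 0 0)) := u0; rewrite !mxE => ->; split=> //.
have /(congr1 (fun s : 'M[R]_1 => s 0 0)) := r0; rewrite !mxE => /eqP.
by rewrite oppr_eq0 => /eqP.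
Qed.

(** * Coefficients on the right and row division *)

Definition quo (f : S) : S := sval (cid (var_division f)).
Definition rem (f : S) : R := sval (cid (svalP (cid (var_division f)))).

Lemma quo_rem f : f = t * quo f + C (rem f).
Proof. exact: (svalP (cid (svalP (cid (var_division f))))). Qed.

Lemma quo_remE f g a : f = t * g + C a -> quo f = g /\ rem f = a.
Proof.
move=> E; have [|q0 r0] := @var_division_unique (quo f - g) (rem f - a).
  have := quo_rem f; rewrite {1}E => E'.
  rewrite mulrBr rmorphB addrACA -E' -opprD; exact: subrr.
by split; apply/eqP; rewrite -subr_eq0; apply/eqP.
Qed.

(* Coefficients a_m of f written as the series of the t^m a_m. *)
Definition rcoef (f : S) (m : nat) : R := rem (iter m quo f).

Lemma rcoefS f m : rcoef f m.+1 = rcoef (quo f) m.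
Proof. by rewrite /rcoef iterSr. Qed.

Lemma rcoefD f g m : rcoef (f + g) m = rcoef f m + rcoef g m.
Proof.
elim: m f g => [|m IHm] f g; last rewrite !rcoefS.
all: have [] := @quo_remE (f + g) (quo f + quo g) (rem f + rem g).
1,3: by rewrite mulrDr rmorphD addrACA -!quo_rem.
  by [].
by move=> -> _; exact: IHm.
Qed.

Lemma rcoef_cst a m : rcoef (C a) m = if m is 0%N then a else 0.
Proof.
have r0 k : rcoef 0 k = 0.
  by apply: (addrI (rcoef 0 k)); rewrite -rcoefD !addr0.
have [|q0 r] := @quo_remE (C a) 0 a; first by rewrite mulr0 add0r.
by case: m => [|m] //; rewrite rcoefS q0 r0.
Qed.

Lemma rcoef0 m : rcoef 0 m = 0.
Proof. by have := rcoef_cst 0 m; rewrite rmorph0 => ->; case: m. Qed.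

Lemma rcoefN f m : rcoef (- f) m = - rcoef f m.
Proof. by apply: (addrI (rcoef f m)); rewrite -rcoefD !subrr rcoef0. Qed.

Lemma rcoef_sum (T : Type) (r : seq T) (P : pred T) (F : T -> S) m :
  rcoef (\sum_(i <- r | P i) F i) m = \sum_(i <- r | P i) rcoef (F i) m.
Proof. exact: (big_morph (rcoef^~ m) (fun f g => rcoefD f g m) (rcoef0 m)). Qed.

Lemma rcoef_Mcst f b m : rcoef (f * C b) m = rcoef f m * b.
Proof.
elim: m f => [|m IHm] f; last rewrite !rcoefS.
all: have [] := @quo_remE (f * C b) (quo f * C b) (rem f * b).
1,3: by rewrite rmorphM mulrA -mulrDl -quo_rem.
  by [].
by move=> -> _; exact: IHm.
Qed.

Lemma cst_Mvar a : C a * t = t * C (sigmaV a) - C (delta (sigmaV a)).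
Proof. by rewrite var_cst sVK addrK. Qed.

Lemma rcoef_Mvar f m : rcoef (f * t) m =
  (if m is k.+1 then sigmaV (rcoef f k) else 0) - delta (sigmaV (rcoef f m)).
Proof.
have E f' : f' * t = t * (quo f' * t + C (sigmaV (rem f'))) + C (- delta (sigmaV (rem f'))).
  by rewrite {1}[f']quo_rem mulrDl cst_Mvar rmorphN mulrDr -!mulrA addrA.
elim: m f => [|m IHm] f; have [q r] := quo_remE (E f); first by rewrite sub0r -r.
rewrite rcoefS q rcoefD IHm rcoef_cst -rcoefS addrAC; congr (_ - _).
by case: m {IHm} => [|m]; rewrite ?add0r ?addr0 // -rcoefS.
Qed.

(** Each factor t acts by sigma and lowers the index, or by delta. At most l factors can do the
    former, so at least k - l deltas appear. *)
Lemma var_power_word w m q k g : 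
  (forall w x, (q <= count is_Y w)%N -> I m (ev w x)) ->
  forall l, (q + l <= k + count is_Y w)%N -> I m (ev w (cf (t ^+ k * g) l)).
Proof.
move=> qP; elim: k w => [|k IHk] w l kl; first by apply: qP; apply: leq_trans kl; exact: leq_addr.
rewrite exprS -mulrA scoef_varM evD; apply: (filD fil).
  case: l kl => [|l] kl; first by rewrite ev0; exact: (fil0 fil).
  have := IHk (w ++ [:: Z]) l; rewrite ev_cat; apply.
  by rewrite count_cat addn0 -ltnS -addnS (leq_trans kl) // addSn.
have := IHk (w ++ [:: Y]) l; rewrite ev_cat; apply.
by rewrite count_cat /= addn1 addnS -addSn.
Qed.

Lemma var_power_small q : exists N, forall k l g, (N + l <= k)%N -> I q (cf (t ^+ k * g) l).
Proof.
have [m mP] := fil_words fil q; exists m => k l g kl.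
by apply: (@var_power_word [::] q m) => //; rewrite addn0.
Qed.

Lemma rcoef_inj f : (forall m, rcoef f m = 0) -> f = 0.
Proof.
move=> f0; apply: (scoef_inj (s := mdl)) => l; rewrite scoef0; apply: (fil_separated fil) => q.
have [N NP] := var_power_small q.
suff -> : f = t ^+ (N + l) * iter (N + l) quo f by exact: NP.
elim: (N + l)%N => [|k IHk]; first by rewrite mul1r.
rewrite {1}IHk exprSr -mulrA; congr (_ * _).
by rewrite {1}[iter k quo f]quo_rem -/(rcoef f k) f0 rmorph0 addr0.
Qed.

Lemma rcoef_surj (a : nat -> R) : exists f, forall m, rcoef f m = a m.
Proof.
(* All tails are built together: dividing the i-th series by t gives the next one with remainder
   a_i, so the coefficients can be read off from [fE]. *)
pose s i N := \sum_(j < N) t ^+ j * C (a (i + j)%N).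
have sE i N : s i N.+1 = t * s i.+1 N + C (a i).
  rewrite /s big_ord_recl mul1r addn0 addrC; congr (_ + _).
  by rewrite mulr_sumr; apply: eq_bigr => j _; rewrite mulrA exprS addSnnS.
have /choice[c cP] (im : nat * nat) : exists c, forall q, exists N, forall n, (N <= n)%N ->
    I q (c - cf (s im.1 n) im.2).
  apply: (fil_complete fil) => q; have [N NP] := var_power_small q.
  exists (N + im.2)%N => n Nn; rewrite -scoefN -scoefD /s big_ord_recr /= addrAC subrr add0r.
  exact: NP.
have /choice[f fP] i := scoef_surj mdl (fun m => c (i, m)).
have fE i : f i = t * f i.+1 + C (a i).
  apply: (scoef_inj (s := mdl)) => m; apply/eqP; rewrite -subr_eq0; apply/eqP.
  apply: (fil_separated fil) => q.
  have fs j l : exists N, forall n, (N <= n)%N -> I q (cf (f j - s j n) l).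
    have [N NP] := cP (j, l) q; exists N => n /NP.
    by rewrite scoefD scoefN fP.
  (* Coefficient m of t f involves the coefficients m and m - 1 of f; at m = 0 the default m.-1 = 0
     is harmless, the sigma term being absent. *)
  have [N1 N1P] := fs i m; have [N2 N2P] := fs i.+1 m; have [N3 N3P] := fs i.+1 m.-1.
  pose n := (N1 + N2 + N3)%N.
  have -> : cf (f i) m - cf (t * f i.+1 + C (a i)) m =
     cf (f i - s i n.+1) m - cf (t * (f i.+1 - s i.+1 n)) m.
    rewrite -!scoefN -!scoefD; congr (cf _ m).
    by rewrite sE mulrBr opprB [t * f i.+1 + _]addrC [t * s _ _ + _]addrC !opprD !addrA subrK.
  apply: filB; first by apply: N1P; apply: leqW; rewrite /n -addnA leq_addr.
  rewrite scoef_varM; apply: (filD fil); last first.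
    by apply/(fil_delta fil)/N2P; rewrite /n addnAC leq_addl.
  have nN3 : (N3 <= n)%N by exact: leq_addl.
  case: m N3P {N1P N2P} => [|m] N3P; first exact: (fil0 fil).
  exact/(fil_sigma fil)/N3P.
exists (f 0%N) => m; have {fE} qr i := quo_remE (fE i).
suff E k i : rcoef (f i) k = a (i + k)%N by rewrite E.
elim: k i => [|k IHk] i; first by rewrite addn0; exact: (qr i).2.
by rewrite rcoefS (qr i).1 IHk addSnnS.
Qed.

Definition mx_rcoef a b (s : 'M[S]_(a, b)) m : 'M[R]_(a, b) := map_mx (rcoef^~ m) s.
Local Notation mrc := mx_rcoef.

Lemma mx_rcoef_inj a b (s s' : 'M[S]_(a, b)) : (forall m, mrc s m = mrc s' m) -> s = s'.
Proof.
move=> ss; apply/matrixP => i j; apply/eqP; rewrite -subr_eq0; apply/eqP/rcoef_inj => m.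
have /matrixP/(_ i j) := ss m; rewrite !mxE => E.
by rewrite rcoefD rcoefN E subrr.
Qed.

Lemma mx_rcoef_surj a b (c : nat -> 'M[R]_(a, b)) : exists s, forall m, mrc s m = c m.
Proof.
have /choice[s sP] (ij : 'I_a * 'I_b) := rcoef_surj (fun m => c m ij.1 ij.2).
exists (\matrix_(i, j) s (i, j)) => m; apply/matrixP => i j; rewrite !mxE.
exact: (sP (i, j)).
Qed.

Lemma mx_rcoef_cst a b (s : 'M[R]_(a, b)) m : mrc (Cm s) m = if m is 0%N then s else 0.
Proof. by apply/matrixP => i j; rewrite !mxE rcoef_cst; case: m; rewrite ?mxE. Qed.

Lemma mx_rcoefD a b (s s' : 'M[S]_(a, b)) m : mrc (s + s') m = mrc s m + mrc s' m.
Proof. by apply/matrixP => i j; rewrite !mxE rcoefD. Qed.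

Lemma mx_rcoef0 a b m : mrc (0 : 'M[S]_(a, b)) m = 0.
Proof. by apply/matrixP => i j; rewrite !mxE rcoef0. Qed.

Definition row_shift n (B : 'M[R]_n) (q : 'rV[S]_n) : 'rV[S]_n :=
  map_mx ( *%R^~ t) q - q *m Cm B.

Lemma row_shift_coef n (B : 'M[R]_n) q l :
  mrc (row_shift B q) l = (if l is k.+1 then map_mx sigmaV (mrc q k) else 0) -
    (map_mx delta (map_mx sigmaV (mrc q l)) + mrc q l *m B).
Proof.
apply/matrixP => i j; rewrite !mxE rcoefD rcoefN rcoef_sum rcoef_Mvar.
rewrite opprD addrA; congr (_ - _ - _); first by case: l => [|l]; rewrite !mxE.
by apply: eq_bigr => k _; rewrite !mxE rcoef_Mcst.
Qed.

(** Coefficients on the right turn s = q (t - B) into q_l = sigma(s_(l+1)) + retwist(q_(l+1)).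
    Conjugation by sigma identifies this operator with [twist], which carries nilpotency over. *)
Definition retwist n (B : 'M[R]_n) (v : 'rV[R]_n) : 'rV[R]_n :=
  map_mx sigma (map_mx delta (map_mx sigmaV v) + v *m B).

Lemma retwistE n (B : 'M[R]_n) v :
  retwist B v = map_mx sigma (twist B (map_mx sigmaV v)).
Proof. by rewrite /retwist /twist map_sigmaV_K addrC. Qed.

Lemma retwistD n (B : 'M[R]_n) : {morph retwist B : u v / u + v}.
Proof.
move=> u v; rewrite !retwistE -map_mxD -twistD; congr (map_mx _ (twist _ _)).
exact: map_sigmaVD.
Qed.

Lemma retwist_fil n (B : 'M[R]_n) q v : mx_fil q v -> mx_fil q (retwist B v).
Proof.
move=> vI; rewrite retwistE => i j; rewrite mxE; apply/(fil_sigma fil)/twist_fil => k l.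
by rewrite mxE; exact: (fil_sigmaV fil).
Qed.

Lemma retwist_nilp n (B : 'M[R]_n) : topologically_nilpotent B ->
  forall q, exists N, forall k v, (N <= k)%N -> mx_fil q (iter k (retwist B) v).
Proof.
move=> nB q; have [N NP] := nB q; exists N => k v Nk.
suff -> : iter k (retwist B) v = map_mx sigma (iter k (twist B) (map_mx sigmaV v)).
  by move=> i j; rewrite mxE; apply: (fil_sigma fil); exact: NP.
elim: k {Nk} => [|k IHk]; first by rewrite map_sigmaV_K.
by rewrite !iterS IHk retwistE map_sigma_K.
Qed.

Lemma row_division n (B : 'M[R]_n) (s : 'rV[S]_n) : topologically_nilpotent B ->
  exists q r, s = row_shift B q + Cm r.
Proof.
move=> nB.
have [w wE] := recursion_exists (@retwistD n B) (@retwist_fil n B) (retwist_nilp nB)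
  (fun l => map_mx sigma (mrc s l.+1)).
have [q qE] := mx_rcoef_surj w.
exists q, (mrc s 0 + (map_mx delta (map_mx sigmaV (mrc q 0)) + mrc q 0 *m B)).
apply: mx_rcoef_inj => -[|l].
  by rewrite mx_rcoefD row_shift_coef mx_rcoef_cst sub0r addrC addrK.
rewrite mx_rcoefD row_shift_coef mx_rcoef_cst addr0 !qE (wE l) map_sigmaVD !map_sigma_K.
by rewrite addrK.
Qed.

Lemma row_division_unique n (B : 'M[R]_n) q r : topologically_nilpotent B ->
  row_shift B q = Cm r -> q = 0 /\ r = 0.
Proof.
move=> nB qr.
have q0 l : mrc q l = 0.
  apply: (recursion_unique (retwist_nilp nB)) => {}l.
  have := congr1 (fun s => mrc s l.+1) qr.
  rewrite row_shift_coef mx_rcoef_cst => /eqP; rewrite subr_eq0 => /eqP E.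
  by rewrite -[LHS]map_sigmaV_K E.
have {}q0 : q = 0 by apply: mx_rcoef_inj => l; rewrite q0 mx_rcoef0.
split=> //; have := congr1 (fun s => mrc s 0%N) qr.
rewrite mx_rcoef_cst => <-; rewrite q0 (_ : row_shift B 0 = 0) ?mx_rcoef0 //.
by rewrite /row_shift mul0mx subr0; apply/matrixP => i j; rewrite !mxE mul0r.
Qed.

Lemma row_shiftZ n (B : 'M[R]_n) (a : S) q : row_shift B (a *: q) = a *: row_shift B q.
Proof.
rewrite /row_shift scalerBr -scalemxAl; congr (_ - _).
by apply/matrixP => i j; rewrite !mxE mulrA.
Qed.

Lemma row_shiftD n (B : 'M[R]_n) q q' : row_shift B (q + q') = row_shift B q + row_shift B q'.
Proof.
rewrite /row_shift mulmxDl opprD [RHS]addrACA; congr (_ + _).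
by apply/matrixP => i j; rewrite !mxE mulrDl.
Qed.

Lemma mx_var_cst a b (D : 'M[R]_(a, b)) :
  t *: Cm D = map_mx ( *%R^~ t) (Cm (map_mx sigma D)) + Cm (map_mx delta D).
Proof. by apply/matrixP => i j; rewrite !mxE var_cst. Qed.

Lemma delta1 : delta 1 = 0.
Proof.
by apply: (addrI (delta 1)); have := deltaP.2 1 1; rewrite !mulr1 rmorph1 mul1r addr0.
Qed.

(* Right noetherianity makes the series with coefficients in I 1 the right ideal
   generated by I 1. *)
Hypothesis noethRc : left_noetherian R^c.

Lemma fil_right_generators : exists (T : finType) (a : T -> R), (forall i, I 1 (a i)) /\
  forall x, I 1 x -> exists c : T -> R, x = \sum_i a i * c i.
Proof.
pose W : submodClosed R^c^o := @submod_of R^c R^c^o (I 1 : set R) (fil0 fil 1)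
  (fun x y xI yI => filD fil xI yI) (fun a x xI => filMr fil (a : R) xI).
have WP (x : R) : x \in W <-> I 1 x by exact: (@submod_ofP R^c R^c^o _ _ _ _ x).
have [T [a [aW aS]]] := noeth_regular noethRc W.
exists T, a; split=> [i|x /WP/aS[c xE]]; first exact/WP/aW.
by exists c; rewrite xE.
Qed.

(** * Series with coefficients in I 1 *)

Definition small (f : S) : Prop := forall m, I 1 (cf f m).

Lemma smallD f g : small f -> small g -> small (f + g).
Proof. by move=> fI gI m; rewrite scoefD; apply: (filD fil). Qed.

Lemma small0 : small 0. Proof. by move=> m; rewrite scoef0; exact: (fil0 fil). Qed.

Lemma small_sum (T : Type) (r : seq T) (P : pred T) (F : T -> S) :
  (forall i, P i -> small (F i)) -> small (\sum_(i <- r | P i) F i).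
Proof. by apply: (big_ind small); [exact: small0|exact: smallD]. Qed.

Lemma small_cstM a f : I 1 a -> small (C a * f).
Proof. by move=> aI m; rewrite scoef_cstM; exact: (filMr fil). Qed.

Lemma small_decompose f : small f -> exists (T : finType) (a : T -> R) (g : T -> S),
  (forall i, I 1 (a i)) /\ f = \sum_i C (a i) * g i.
Proof.
move=> fI; have [T [a [aI aS]]] := fil_right_generators.
have /choice[c cP] m := aS _ (fI m).
have /choice[g gP] i := scoef_surj mdl (fun m => c m i).
exists T, a, g; split=> //; apply: (scoef_inj (s := mdl)) => m.
by rewrite scoef_sum cP; apply: eq_bigr => i _; rewrite scoef_cstM gP.
Qed.

Lemma smallMr f g : small f -> small (f * g).
Proof.
move=> /small_decompose[T [a [h [aI ->]]]]; rewrite mulr_suml; apply: small_sum => i _.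
by rewrite -mulrA; exact: small_cstM.
Qed.

Lemma rcoef_expand f k :
  f = \sum_(i < k) t ^+ i * C (rcoef f i) + t ^+ k * iter k quo f.
Proof.
elim: k => [|k IHk]; first by rewrite big_ord0 add0r mul1r.
rewrite big_ord_recr /= {1}IHk -addrA; congr (_ + _).
by rewrite exprSr -mulrA addrC -mulrDr -quo_rem.
Qed.

Lemma fil_varM q f : (forall m, I q (cf f m)) -> forall m, I q (cf (t * f) m).
Proof.
move=> fI m; rewrite scoef_varM; apply: (filD fil); last exact: (fil_delta fil).
by case: m => [|m]; [exact: (fil0 fil)|exact: (fil_sigma fil)].
Qed.

Lemma fil_power_cst q i a m : I q a -> I q (cf (t ^+ i * C a) m).
Proof.
move=> aI; elim: i m => [|i IHi] m; last by rewrite exprS -mulrA; exact: fil_varM.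
by rewrite mul1r scoef_cst; case: m => [//|m]; exact: (fil0 fil).
Qed.

(** The product is expanded with coefficients on the right, which are multiples of a, up to a tail
    t^(N+m) g whose coefficient of index m is already in I 1. *)
Lemma small_Mcst s a : I 1 a -> small (s * C a).
Proof.
move=> aI m; have [N NP] := var_power_small 1; set f := s * C a.
rewrite (rcoef_expand f (N + m)) scoefD; apply: (filD fil); last exact: NP.
rewrite scoef_sum; apply: fil_sum => i _; apply: fil_power_cst.
by rewrite rcoef_Mcst; exact: (filMl fil).
Qed.

Lemma smallMl f g : small g -> small (f * g).
Proof.
move=> /small_decompose[T [a [h [aI ->]]]]; rewrite mulr_sumr; apply: small_sum => i _.
by rewrite mulrA; apply/smallMr/small_Mcst.
Qed.

Lemma smallN f : small f -> small (- f).
Proof. by rewrite -mulN1r; exact: smallMl. Qed.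

(* [order k f]: f has order at least k modulo the small series. *)
Definition order k f : Prop := forall l, (l < k)%N -> I 1 (cf f l).

Lemma scoef_Mpower h k l : cf (h * t ^+ k) l = if (k <= l)%N then cf h (l - k) else 0.
Proof.
elim: k h l => [|k IHk] h l; first by rewrite mulr1 subn0.
by rewrite exprSr mulrA scoef_Mvar; case: l => [|l] //; rewrite IHk ltnS subSS.
Qed.

Lemma order_decompose k f : order k f -> exists e h, small e /\ f = e + h * t ^+ k.
Proof.
move=> fI; have [e eP] := scoef_surj mdl (fun l => if (l < k)%N then cf f l else 0).
have [h hP] := scoef_surj mdl (fun l => cf f (k + l)).
exists e, h; split.
  by move=> l; rewrite eP; case: ifP => [/fI //|_]; exact: (fil0 fil).
apply: (scoef_inj (s := mdl)) => l; rewrite scoefD eP scoef_Mpower hP.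
by case: leqP => kl; rewrite ?addr0 // add0r subnKC.
Qed.

Lemma order_small k f : small f -> order k f. Proof. by move=> fI l _. Qed.

Lemma order_power k h : order k (h * t ^+ k).
Proof. by move=> l lk; rewrite scoef_Mpower leqNgt lk /=; exact: (fil0 fil). Qed.

Lemma orderD k f g : order k f -> order k g -> order k (f + g).
Proof. by move=> fI gI l lk; rewrite scoefD; apply: (filD fil); [exact: fI|exact: gI]. Qed.

Lemma orderN k f : order k f -> order k (- f).
Proof. by move=> fI l lk; rewrite scoefN; exact/filN/fI. Qed.

Lemma order_le k k' f : (k <= k')%N -> order k' f -> order k f.
Proof. by move=> kk fI l lk; apply: fI; exact: leq_trans kk. Qed.

Lemma orderMl k s f : order k f -> order k (s * f).
Proof.
move=> /order_decompose[e [h [eI ->]]]; rewrite mulrDr mulrA; apply: orderD.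
  exact/order_small/smallMl.
exact: order_power.
Qed.

(** Modulo small series f is h t^k, and t^k s has order at least k + 1 - m; the factor t^(m+1) more
    than makes up for the loss. *)
Lemma order_mulS (m : nat) s k f :
  (forall k l g, (m + l <= k)%N -> I 1 (cf (t ^+ k * g) l)) ->
  order k f -> order k.+1 (f * (s * t ^+ m.+1)).
Proof.
move=> mP /order_decompose[e [h [eI ->]]]; rewrite mulrDl; apply: orderD.
  exact/order_small/smallMr.
rewrite -mulrA; apply: orderMl; rewrite mulrA.
have : order (k.+1 - m) (t ^+ k * s).
  by move=> l lk; apply: mP; move: lk; rewrite ltn_subRL.
move=> /order_decompose[e' [h' [eI' ->]]]; rewrite mulrDl; apply: orderD.
  exact/order_small/smallMr.
rewrite -mulrA -exprD; apply: (@order_le _ (k.+1 - m + m.+1)); last exact: order_power.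
by rewrite addnS ltnS (leq_trans (leqnSn k)) // addnC -leq_subLR.
Qed.

(** A left inverse of 1 - s t^(m+1) modulo small series, from the geometric series. *)
Lemma order_inverse (m : nat) s :
  (forall k l g, (m + l <= k)%N -> I 1 (cf (t ^+ k * g) l)) ->
  exists u, small (u * (1 - s * t ^+ m.+1) - 1).
Proof.
move=> mP; set p := s * t ^+ m.+1.
have pS k f : order k f -> order k.+1 (f * p) by exact: order_mulS.
have pj j : order j (p ^+ j) by elim: j => // j IHj; rewrite exprSr; exact: pS.
(* Since p^j has order j, its coefficient of index l is in I 1 for j > l; truncating at j = l makes
   all sums finite. *)
have [u uP] := scoef_surj mdl (fun l => \sum_(j < l.+1) cf (p ^+ j) l).
exists u => l; pose g := \sum_(j < l.+1) p ^+ j.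
have geo : g * (1 - p) = 1 - p ^+ l.+1.
  rewrite /g; elim: l.+1 => [|n IHn]; first by rewrite big_ord0 mul0r subrr.
  by rewrite big_ord_recr /= mulrDl IHn mulrBr mulr1 -exprSr addrA subrK.
have ug : order l.+1 (u - g).
  move=> i il; rewrite scoefD scoefN uP /g scoef_sum -(subnKC il) big_split_ord /=.
  rewrite opprD addrA subrr sub0r; apply/filN/fil_sum => j _.
  by apply: pj; exact: leq_addr.
have -> : u * (1 - p) - 1 = (u - g) * (1 - p) - p ^+ l.+1.
  by rewrite [in RHS]mulrBl geo opprB addrA [in RHS]addrAC addrK.
suff : order l.+1 ((u - g) * (1 - p) - p ^+ l.+1) by apply.
apply: orderD; last exact/orderN/pj.
rewrite mulrBr mulr1; apply: orderD => //; apply: orderN.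
exact: order_le (leqnSn _) (pS _ _ ug).
Qed.

(** * Modules finitely generated over R *)

Section FiniteOverBase.
Variables (M : lmodType S) (r : nat) (g : 'I_r -> M).
Hypothesis gS : forall x, exists c : 'I_r -> R, x = \sum_i C (c i) *: g i.

Definition small_elt (x : M) : Prop :=
  exists c : 'I_r -> R, (forall i, I 1 (c i)) /\ x = \sum_i C (c i) *: g i.

Lemma small_eltD x y : small_elt x -> small_elt y -> small_elt (x + y).
Proof.
move=> [c [cI ->]] [d [dI ->]]; exists (fun i => c i + d i); split.
  by move=> i; exact: (filD fil).
by rewrite -big_split; apply: eq_bigr => i _; rewrite rmorphD scalerDl.
Qed.

Lemma small_elt0 : small_elt 0.
Proof.
exists (fun=> 0); split=> [i|]; first exact: (fil0 fil).
by rewrite big1 // => i _; rewrite rmorph0 scale0r.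
Qed.

Lemma small_elt_sum (T : Type) (s : seq T) (F : T -> M) :
  (forall i, small_elt (F i)) -> small_elt (\sum_(i <- s) F i).
Proof. by move=> FI; apply: (big_ind small_elt); [exact: small_elt0|exact: small_eltD|]. Qed.

Lemma small_elt_cst a x : I 1 a -> small_elt (C a *: x).
Proof.
move=> aI; have [c ->] := gS x; exists (fun i => a * c i); split=> [i|].
  exact: (filMr fil).
by rewrite scaler_sumr; apply: eq_bigr => i _; rewrite scalerA rmorphM.
Qed.

Lemma small_scale f x : small f -> small_elt (f *: x).
Proof.
move=> /small_decompose[T [a [h [aI ->]]]]; rewrite scaler_suml.
by apply: small_elt_sum => i; rewrite -scalerA; exact: small_elt_cst.
Qed.

Lemma small_eltZ s x : small_elt x -> small_elt (s *: x).
Proof.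
move=> [c [cI ->]]; rewrite scaler_sumr; apply: small_elt_sum => i.
by rewrite scalerA; apply/small_scale/small_Mcst.
Qed.

(** The preimages in R^r of S t^k x + I_1 M form a descending chain, stationary because R/I_1 is
    artinian. Thus t^k x is in S t^(k+m+1) x + I_1 M, and (1 - s t^(m+1)) t^k x in I_1 M; the factor
    is invertible modulo small series. *)
Lemma power_small_elt (x : M) : exists k, small_elt (t ^+ k *: x).
Proof.
have [m mP] := var_power_small 1.
pose lc (v : 'rV[R]_r) := \sum_i C (v 0 i) *: g i.
have lcD u v : lc (u + v) = lc u + lc v.
  by rewrite -big_split; apply: eq_bigr => i _; rewrite !mxE rmorphD scalerDl.
have lcZ a v : lc (a *: v) = C a *: lc v.
  by rewrite scaler_sumr; apply: eq_bigr => i _; rewrite !mxE rmorphM scalerA.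
pose P k (v : 'rV[R]_r) := exists s y, small_elt y /\ lc v = (s * t ^+ k) *: x + y.
have P0 k : P k 0.
  exists 0, 0; split; first exact: small_elt0.
  by rewrite mul0r scale0r addr0 /lc big1 // => i _; rewrite mxE rmorph0 scale0r.
have PD k u v : P k u -> P k v -> P k (u + v).
  move=> [s [y [yI uE]]] [s' [y' [yI' vE]]]; exists (s + s'), (y + y').
  by split; [exact: small_eltD|rewrite lcD uE vE mulrDl scalerDl addrACA].
have PZ k a v : P k v -> P k (a *: v).
  move=> [s [y [yI vE]]]; exists (C a * s), (C a *: y); split; first exact: small_eltZ.
  by rewrite lcZ vE scalerDr scalerA mulrA.
pose F k := submod_of (P0 k) (PD k) (PZ k).
have FP k v : v \in F k <-> P k v by exact: submod_ofP.
have [k0 k0P] : exists k, forall n v, (k <= n)%N -> v \in F k -> v \in F n.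
  apply: (artinian_rows (fil0 fil 1) (fil_artinian fil)) => n v.
    move=> /FP[s [y [yI vE]]]; apply/FP; exists (s * t), y; split=> //.
    by rewrite -mulrA -exprS.
  move=> vI; apply/FP; exists 0, (lc v); rewrite mul0r scale0r add0r; split=> //.
  by exists (fun i => v 0 i).
have [c xE] := gS (t ^+ k0 *: x).
have lcE : lc (\row_i c i) = t ^+ k0 *: x.
  by rewrite xE; apply: eq_bigr => i _; rewrite mxE.
(* The exponent jumps by m + 1 at once, as [order_inverse] requires. *)
have /(k0P (m.+1 + k0)%N _ (leq_addl _ _))/FP[s [y [yI]]] : \row_i c i \in F k0.
  apply/FP; exists 1, 0; split; first exact: small_elt0.
  by rewrite mul1r addr0.
rewrite lcE exprD mulrA -scalerA => E.
have [u uI] := order_inverse s mP; exists k0; set z := t ^+ k0 *: x in E *.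
have yE : y = (1 - s * t ^+ m.+1) *: z by rewrite scalerBl scale1r {1}E addrAC subrr add0r.
have -> : z = u *: y + (- ((u * (1 - s * t ^+ m.+1) - 1) *: z)).
  by rewrite yE scalerA scalerBl scale1r opprB addrCA subrr addr0.
apply: small_eltD; first exact: small_eltZ.
by rewrite -scaleNr; apply/small_scale/smallN.
Qed.

Lemma power_small_uniform : exists k, forall i, small_elt (t ^+ k.+1 *: g i).
Proof.
have /choice[k kP] i := power_small_elt (g i).
exists (\max_i k i) => i; have ki := leq_bigmax (F := k) i.
have -> : (\max_i k i).+1 = ((\max_i k i).+1 - k i + k i)%N by rewrite subnK // leqW.
by rewrite exprD -scalerA; apply: small_eltZ.
Qed.
End FiniteOverBase.

(** * Topologically nilpotent companion matrices *)

Section Companion.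
Variables (n : nat) (B : 'M[R]_n).

Lemma iter_twistD k : {morph iter k (twist B) : u v / u + v}.
Proof. by move=> u v; elim: k => //= k ->; exact: twistD. Qed.

Lemma twistZ a v : twist B (a *: v) = sigma a *: twist B v + delta a *: v.
Proof.
apply/matrixP => i j; rewrite /twist map_mxZ -scalemxAl !mxE deltaP.2 mulrDr.
by rewrite addrAC -addrA.
Qed.

Lemma iter_twist0 k : iter k (twist B) 0 = 0.
Proof. by apply: (addrI (iter k (twist B) 0)); rewrite -iter_twistD !addr0. Qed.

Lemma iter_twist_sum (T : Type) (s : seq T) (F : T -> 'rV[R]_n) k :
  iter k (twist B) (\sum_(i <- s) F i) = \sum_(i <- s) iter k (twist B) (F i).
Proof. exact: (big_morph _ (iter_twistD k) (iter_twist0 k)). Qed.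

Lemma iter_twist_fil k q v : mx_fil q v -> mx_fil q (iter k (twist B) v).
Proof. by move=> vI; elim: k => //= k; exact: twist_fil. Qed.

Definition near_power c q (x : R) : Prop :=
  exists y z, [/\ ideal_exp (I 1) c y, I q z & x = y + z].

Lemma power_sigma c x : ideal_exp (I 1) c x -> ideal_exp (I 1) c (sigma x).
Proof.
elim: c x => // c IHc; apply: ideal_exp_ind => [|x y xI yI|a b aI bI].
- by rewrite rmorph0; exact: ideal_exp0.
- by rewrite rmorphD; exact: ideal_expD.
- by rewrite rmorphM; apply: ideal_exp_mul; [exact: IHc|exact: (fil_sigma fil)].
Qed.

Lemma power_delta c x : ideal_exp (I 1) c x -> ideal_exp (I 1) c (delta x).
Proof.
elim: c x => // c IHc; apply: ideal_exp_ind => [|x y xI yI|a b aI bI].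
- by rewrite d0; exact: ideal_exp0.
- by rewrite dD; exact: ideal_expD.
- rewrite deltaP.2; apply: ideal_expD; first by apply: ideal_exp_mul; [exact: IHc|].
  by apply: ideal_exp_mul; [exact: power_sigma|exact: (fil_delta fil)].
Qed.

Definition is_positive (l : letter) : bool := if l is Z' then false else true.

Lemma power_word c w x : all is_positive w -> ideal_exp (I 1) c x -> ideal_exp (I 1) c (ev w x).
Proof.
move=> + xI; elim: w => // l w IHw /= /andP[lp /IHw].
by case: l lp => // _; [exact: power_delta|exact: power_sigma].
Qed.

Lemma near_powerD c q x y : near_power c q x -> near_power c q y -> near_power c q (x + y).
Proof.
move=> [y1 [z1 [yI zI ->]]] [y2 [z2 [yI' zI' ->]]]; exists (y1 + y2), (z1 + z2).
by split; [exact: ideal_expD|exact: (filD fil)|exact: addrACA].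
Qed.

Lemma near_power0 c q : near_power c q 0.
Proof. by exists 0, 0; rewrite addr0; split=> //; [exact: ideal_exp0|exact: (fil0 fil)]. Qed.

Lemma near_power_fil c q x : I q x -> near_power c q x.
Proof. by move=> xI; exists 0, x; rewrite add0r; split=> //; exact: ideal_exp0. Qed.

(* Expanding twist^k (a x) by the Leibniz rule, each term either carries many
   deltas on a or a high power of twist on x. *)
Lemma iter_twist_scale c q m N0 (x : 'rV[R]_n) :
  (forall w y, (m <= count is_Y w)%N -> I q (ev w y)) ->
  (forall j, (N0 <= j)%N -> mx_fil 1 (iter j (twist B) x)) ->
  forall k a, (m + N0 <= k)%N -> ideal_exp (I 1) c a ->
  forall i, near_power c.+1 q (iter k (twist B) (a *: x) 0 i).
Proof.
move=> mP xP.
suff key k : forall w j a, all is_positive w -> (m + N0 <= k + count is_Y w + j)%N ->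
    ideal_exp (I 1) c a ->
    forall i, near_power c.+1 q (iter k (twist B) (ev w a *: iter j (twist B) x) 0 i).
  by move=> k a mk aI; apply: (key k [::] 0%N) => //; rewrite !addn0.
elim: k => [|k IHk] w j a wp kwj aI i.
  rewrite mxE; have [wm|mw] := leqP m (count is_Y w).
    by apply/near_power_fil/(filMr fil)/mP.
  exists (ev w a * iter j (twist B) x 0 i), 0; rewrite addr0; split=> //; last exact: (fil0 fil).
  apply: ideal_exp_mul; first exact: power_word.
  apply: xP; rewrite -(leq_add2l m); apply: (leq_trans kwj).
  by rewrite add0n leq_add2r ltnW.
rewrite iterSr twistZ iter_twistD mxE; apply: near_powerD.
  by apply: (IHk (Z :: w) j.+1 a) => //; rewrite /= add0n addnS -!addSn.
by apply: (IHk (Y :: w) j a) => //; rewrite /= add1n addnS -!addSn.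
Qed.

(** Each further block of m + N0 twists gains one factor of I 1 modulo I q, and some power of I 1
    lies in I q. *)
Lemma companion_nilpotent : 
  (exists N, forall p j, (N <= j)%N -> mx_fil 1 (iter j (twist B) (delta_mx 0 p))) ->
  topologically_nilpotent B.
Proof.
move=> [N0 N0P] q; have [m mP] := fil_words fil q; have [c cP] := fil_power fil q.
have step c' : exists N, forall k v, (N <= k)%N -> forall i,
    near_power c' q (iter k (twist B) v 0 i).
  elim: c' => [|c' [N NP]].
    by exists 0%N => k v _ i; exists (iter k (twist B) v 0 i), 0; rewrite addr0; split=> //; exact: (fil0 fil).
  exists (m + N0 + N)%N => k v Nk i.
  rewrite -(subnK (leq_trans (leq_addl _ _) Nk)) iterD.
  move: (iter N (twist B) v) (NP N v (leqnn N)) => {}v vP.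
  have mk : (m + N0 <= k - N)%N by rewrite leq_subRL ?(leq_trans (leq_addl _ _) Nk) // addnC.
  rewrite [v]row_sum_delta iter_twist_sum summxE; apply: (big_ind (near_power c'.+1 q)).
  - exact: near_power0.
  - exact: near_powerD.
  move=> p _; have [y [z [yI zI ->]]] := vP p.
  rewrite scalerDl iter_twistD mxE; apply: near_powerD.
    by apply: (@iter_twist_scale c' q m N0) => // j; exact: N0P.
  apply/near_power_fil/iter_twist_fil => a b; rewrite mxE; exact: (filMr fil).
have [N NP] := step c; exists N => k v Nk i j; rewrite (ord1 i).
by have [y [z [/cP yI zI ->]]] := NP k v Nk j; apply: (filD fil).
Qed.

End Companion.

Lemma twist_delta n (B : 'M[R]_n) p : twist B (delta_mx 0 p) = row p B.
Proof.
rewrite /twist map_delta_mx -rowE [X in _ + X](_ : _ = 0) ?addr0 //.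
by apply/matrixP => i j; rewrite !mxE; case: (_ && _); rewrite /= ?delta1 ?d0.
Qed.

Lemma nilpotent_presentation (M : lmodType S) (r : nat) (g : 'I_r -> M) :
  (forall x, exists c : 'I_r -> R, x = \sum_i C (c i) *: g i) ->
  exists (n : nat) (B : 'M[R]_n) (h : 'I_n -> M),
    [/\ topologically_nilpotent B,
        forall p, t *: h p = \sum_q C (B p q) *: h q
      & forall x, exists c : 'I_n -> R, x = \sum_p C (c p) *: h p].
Proof.
move=> gS; have [k /choice[b bP]] := power_small_uniform gS.
pose T := ('I_k.+1 * 'I_r)%type; pose e (p : 'I_#|{: T}|) : T := enum_val p.
pose H (z : T) := t ^+ z.1 *: g z.2.
(* The companion matrix on the t^l g_i with l <= k: t raises l, and t^(k+1) g_i is expressed by the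
   g_j with the coefficients [b] from I 1. *)
pose Bf (z z' : T) : R := if (z.1 < k)%N then ((z'.1 == z.1.+1 :> nat) && (z'.2 == z.2))%:R
  else if z'.1 == ord0 then b z.2 z'.2 else 0.
have sumE (F : T -> R) : \sum_p C (F (e p)) *: H (e p) = \sum_z C (F z) *: H z.
  rewrite [RHS](reindex (fun p => e p)) //=.
  by exists enum_rank => z _; rewrite /e ?enum_valK ?enum_rankK.
have sum0 (a : 'I_r -> R) :
    \sum_z C (if z.1 == ord0 then a z.2 else 0) *: H z = \sum_i C (a i) *: g i.
  rewrite -(pair_bigA _ (fun l i => C (if l == ord0 then a i else 0) *: H (l, i))) /=.
  rewrite big_ord_recl /= [X in _ + X]big1 ?addr0 => [|l _].
    by apply: eq_bigr => i _; rewrite /H /= scale1r.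
  by apply: big1 => i _; rewrite rmorph0 scale0r.
pose B := \matrix_(p, q) Bf (e p) (e q).
exists #|{: T}|, B, (fun p => H (e p)); split.
- apply: companion_nilpotent; exists k.+1 => p j kj.
  (* d is the distance to the last block, from which one more twist enters I 1. *)
  have key d : forall p, ((e p).1 + d = k)%N -> mx_fil 1 (iter d.+1 (twist B) (delta_mx 0 p)).
    elim: d => [|d IHd] {}p.
      rewrite addn0 => pk i q; rewrite /= twist_delta !mxE /Bf pk ltnn.
      by case: ifP => _; [exact: (bP (e p).2).1|exact: (fil0 fil)].
    move=> pd; have lt : ((e p).1.+1 < k.+1)%N.
      have : ((e p).1 < (e p).1 + d.+1)%N by rewrite addnS ltnS leq_addr.
      by rewrite pd.
    pose p' : 'I_#|{: T}| := enum_rank (Ordinal lt, (e p).2).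
    have ep' : e p' = (Ordinal lt, (e p).2) by exact: enum_rankK.
    rewrite iterSr twist_delta; suff -> : row p B = delta_mx 0 p'.
      by apply: IHd; rewrite ep' /= addSnnS.
    apply/rowP => q; rewrite !mxE /Bf -ltnS lt eqxx /=; congr (_%:R); congr nat_of_bool.
    rewrite -[q == p'](inj_eq enum_val_inj) -/(e q) -/(e p') ep'.
    by case: (e q) => l i; rewrite xpair_eqE -val_eqE.
  have pk : ((e p).1 + (k - (e p).1) = k)%N by rewrite subnKC // -ltnS.
  have dj : ((k - (e p).1).+1 <= j)%N by rewrite (leq_trans _ kj) // ltnS leq_subr.
  by rewrite -(subnK dj) iterD; apply: iter_twist_fil; exact: key.
- move=> p; transitivity (\sum_q C (Bf (e p) (e q)) *: H (e q)); last first.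
    by apply: eq_bigr => q _; rewrite mxE.
  rewrite (sumE (Bf (e p))) /H scalerA -exprS /Bf; case pk: ((e p).1 < k)%N.
    have lt : ((e p).1.+1 < k.+1)%N by rewrite ltnS.
    rewrite (bigD1 (Ordinal lt, (e p).2)) //= !eqxx /= rmorph1 scale1r.
    rewrite big1 ?addr0 // => -[l i]; rewrite xpair_eqE -val_eqE /= => /negPf ->.
    by rewrite /= rmorph0 scale0r.
  have -> : ((e p).1.+1 = k.+1)%N.
    by apply/eqP; rewrite eqn_leq ltn_ord /= ltnS leqNgt pk.
  by rewrite (sum0 (b (e p).2)) (bP (e p).2).2.
- move=> x; have [c ->] := gS x; exists (fun p => if (e p).1 == ord0 then c (e p).2 else 0).
  by rewrite (sumE (fun z => if z.1 == ord0 then c z.2 else 0)) sum0.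
Qed.

Hypothesis noethR : left_noetherian R.

Lemma mx_cstD a b (u v : 'M[R]_(a, b)) : Cm (u + v) = Cm u + Cm v.
Proof. exact: map_mxD. Qed.
Lemma mx_cstN a b (u : 'M[R]_(a, b)) : Cm (- u) = - Cm u.
Proof. exact: map_mxN. Qed.
Lemma mx_cst0 a b : Cm (0 : 'M[R]_(a, b)) = 0.
Proof. exact: map_mx0. Qed.
Lemma mx_cstM a b c (u : 'M[R]_(a, b)) (v : 'M[R]_(b, c)) : Cm (u *m v) = Cm u *m Cm v.
Proof. exact: map_mxM. Qed.
Lemma row_shift0 n (B : 'M[R]_n) : row_shift B 0 = 0.
Proof.
by rewrite /row_shift mul0mx subr0; apply/matrixP => i j; rewrite !mxE mul0r.
Qed.

Lemma row_shiftN n (B : 'M[R]_n) q : row_shift B (- q) = - row_shift B q.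
Proof. by apply: (addrI (row_shift B q)); rewrite -row_shiftD !subrr row_shift0. Qed.

Lemma var_mx_cst a b c (q : 'M[S]_(a, b)) (D : 'M[R]_(b, c)) :
  map_mx ( *%R^~ t) q *m Cm D =
  map_mx ( *%R^~ t) (q *m Cm (map_mx sigma D)) + q *m Cm (map_mx delta D).
Proof.
apply/matrixP => i j; rewrite !mxE mulr_suml -big_split; apply: eq_bigr => k _.
by rewrite !mxE /= -mulrA var_cst mulrDr mulrA.
Qed.

Lemma row_shift_comm n n' (B : 'M[R]_n) (B' : 'M[R]_n') (D : 'M[R]_(n', n)) q :
  B' *m D = map_mx sigma D *m B + map_mx delta D ->
  row_shift B' q *m Cm D = row_shift B (q *m Cm (map_mx sigma D)).
Proof.
move=> E; rewrite /row_shift mulmxBl var_mx_cst -[q *m Cm B' *m _]mulmxA -mx_cstM E.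
by rewrite mx_cstD mulmxDr mx_cstM mulmxA opprD addrACA subrr addr0.
Qed.

Lemma row_shift_mul n (B : 'M[R]_n) (q : 'rV[S]_n) (u : 'cV[S]_n) :
  row_shift B q *m u = q *m col_shift B u.
Proof.
rewrite /row_shift /col_shift mulmxBl mulmxBr mulmxA; congr (_ - _).
by apply/matrixP => i j; rewrite !mxE; apply: eq_bigr => k _; rewrite !mxE mulrA.
Qed.

Lemma col_shiftD n (B : 'M[R]_n) u u' : col_shift B (u + u') = col_shift B u + col_shift B u'.
Proof. by rewrite /col_shift scalerDr mulmxDr opprD addrACA. Qed.

Lemma col_shift0 n (B : 'M[R]_n) : col_shift B 0 = 0.
Proof. by rewrite /col_shift scaler0 mulmx0 subrr. Qed.

Lemma col_shiftN n (B : 'M[R]_n) u : col_shift B (- u) = - col_shift B u.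
Proof. by apply: (addrI (col_shift B u)); rewrite -col_shiftD !subrr col_shift0. Qed.

Lemma col_eq n (u v : 'cV[S]_n) :
  (forall q : 'rV[S]_n, (q *m u) 0 0 = (q *m v) 0 0) -> u = v.
Proof.
by move=> uv; apply/colP => i; have := uv (delta_mx 0 i); rewrite -!rowE !mxE.
Qed.

Lemma col_shift_comm n n' (B : 'M[R]_n) (B' : 'M[R]_n') (D : 'M[R]_(n', n)) u :
  B' *m D = map_mx sigma D *m B + map_mx delta D ->
  col_shift B' (Cm D *m u) = Cm (map_mx sigma D) *m col_shift B u.
Proof.
move=> E; apply: col_eq => q; congr (fun_of_matrix _ 0 0).
by rewrite -row_shift_mul mulmxA (row_shift_comm _ E) row_shift_mul mulmxA.
Qed.

(* An S-module with generators finite over R on which t acts through a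
   topologically nilpotent matrix: a quotient of S^n / S^n (t - B). *)
Record presentation := {
  pmod : lmodType S;
  prank : nat;
  pmat : 'M[R]_prank;
  pgen : 'I_prank -> pmod;
  pnilp : topologically_nilpotent pmat;
  pvar : forall p, t *: pgen p = \sum_q C (pmat p q) *: pgen q;
  pspan : forall x, exists c : 'I_prank -> R, x = \sum_p C (c p) *: pgen p }.

Definition peval (P : presentation) : {linear 'rV[S]_(prank P) -> pmod P} :=
  rowcomb (@pgen P).

Lemma peval_cst (P : presentation) (r : 'rV[R]_(prank P)) :
  peval P (Cm r) = \sum_p C (r 0 p) *: pgen p.
Proof. by apply: eq_bigr => p _; rewrite mxE. Qed.

Lemma peval_shift (P : presentation) q : peval P (row_shift (pmat P) q) = 0.
Proof.
rewrite /row_shift linearB; apply/eqP; rewrite subr_eq0; apply/eqP.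
have -> : peval P (map_mx ( *%R^~ t) q) = \sum_p \sum_k (q 0 p * C (pmat P p k)) *: pgen k.
  apply: eq_bigr => p _; rewrite mxE -scalerA pvar scaler_sumr.
  by apply: eq_bigr => k _; rewrite scalerA.
rewrite exchange_big; apply: eq_bigr => k _; rewrite mxE scaler_suml.
by apply: eq_bigr => p _; rewrite mxE.
Qed.

Lemma peval_surj (P : presentation) x : exists r : 'rV[R]_(prank P), peval P (Cm r) = x.
Proof.
have [c ->] := pspan x; exists (\row_p c p); rewrite peval_cst.
by apply: eq_bigr => p _; rewrite mxE.
Qed.

(** The first two fields make [D] identify [pmod P'] with the relations of P over R, so that
    successive matrices splice into a resolution; the third says that D is compatible with t. *)
Record next_presentation (P P' : presentation) (D : 'M[R]_(prank P', prank P)) : Prop := {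
  next_exact : forall r, peval P (Cm r) = 0 <-> exists y, y *m D = r;
  next_ker : forall y, y *m D = 0 <-> peval P' (Cm y) = 0;
  next_comm : pmat P' *m D = map_mx sigma D *m pmat P + map_mx delta D }.

Lemma row_shift_linear n (B : 'M[R]_n) : linear (row_shift B).
Proof. by move=> a p q; rewrite row_shiftD row_shiftZ. Qed.

Definition row_shift_lin n (B : 'M[R]_n) : {linear 'rV[S]_n -> 'rV[S]_n} :=
  lin_of (row_shift_linear B).

Lemma mx_cst_delta n p : Cm (delta_mx 0 p : 'rV[R]_n) = delta_mx 0 p.
Proof. exact: map_delta_mx. Qed.

(* The next module is the kernel of S^n / S^n (t - B) -> P; by row division its
   elements are the classes of the rows of constants in the kernel. *)
Lemma next_presentation_exists (P : presentation) :
  exists (P' : presentation) (D : 'M[R]_(prank P', prank P)), next_presentation D.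
Proof.
pose Z := ker (peval P); pose W := im (row_shift_lin (pmat P)).
have WP x : x \in W <-> exists q, row_shift (pmat P) q = x by exact: imP.
have WC r : Cm r \in W -> r = 0.
  by move=> /WP[q /(row_division_unique (@pnilp P))[_ ->]].
have Z0 : (0 : 'rV[S]_(prank P)) \in Z by apply/kerP; exact: linear0.
have W0 : (0 : 'rV[S]_(prank P)) \in W by apply/WP; exists 0; exact: row_shift0.
have c0 : class_of (0 : 'rV[S]_(prank P)) (0 : subquotient Z W).
  by exists Z0; apply/esym/quotient_eq0/preimageP.
pose cls (r : 'rV[R]_(prank P)) (z : subquotient Z W) := class_of (Cm r) z.
have clsZ a r z : cls r z -> cls (a *: r) (C a *: z).
  move=> rz; have := class_lin (C a) rz c0; rewrite !addr0.
  by rewrite /cls (_ : Cm (a *: r) = C a *: Cm r); last exact: map_mxZ.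
have cls0 : cls 0 0 by rewrite /cls mx_cst0.
have clsD r r' z z' : cls r z -> cls r' z' -> cls (r + r') (z + z').
  move=> rz rz'; have := class_lin 1 rz rz'; rewrite !scale1r /cls mx_cstD; exact.
have cls_mul k (D : 'M[R]_(k, prank P)) (h : 'I_k -> subquotient Z W) :
    (forall p, cls (row p D) (h p)) ->
    forall y : 'rV[R]_k, cls (y *m D) (\sum_p C (y 0 p) *: h p).
  move=> Dh y; rewrite mulmx_sum_row.
  apply: (big_ind2 (fun r z => cls r z)) => // [r z r' z'|p _]; first exact: clsD.
  exact: clsZ.
have cls_exists r : peval P (Cm r) = 0 -> exists z, cls r z.
  by move=> r0; apply: class_exists; apply/kerP.
have cls_repr z : exists2 r, peval P (Cm r) = 0 & cls r z.
  (* Row division replaces a representative by its constant remainder. *)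
  have [x xZ xz] := class_repr z; have [q [r xE]] := row_division x (@pnilp P).
  have r0 : peval P (Cm r) = 0.
    by have /kerP := xZ; rewrite xE linearD peval_shift add0r.
  exists r => //; have [z' rz'] := cls_exists r r0.
  suff -> : z = z' by [].
  apply/eqP; rewrite -subr_eq0; apply/eqP.
  have := class_lin (-1) rz' xz; rewrite !scaleN1r addrC [X in _ X]addrC => cl.
  by apply/(class_eq0 cl); apply/WP; exists q; rewrite xE addrK.
have cls_eq0 r z : cls r z -> z = 0 <-> r = 0.
  move=> rz; rewrite (class_eq0 rz); split; first exact: WC.
  by move=> ->; rewrite mx_cst0.
have evl : linear (fun r : 'rV[R]_(prank P) => peval P (Cm r) : restrict_scalars C (pmod P)).
  move=> a r r'; rewrite mx_cstD linearD; congr (_ + _).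
  by rewrite (_ : Cm (a *: r) = C a *: Cm r) ?linearZ //; exact: map_mxZ.
have [k [D0 D0P]] := noeth_kernel_mx (lin_of evl) noethR.
have /choice[g0 g0P] i : exists z, cls (row i D0) z.
  by apply: cls_exists; apply/D0P; exists (delta_mx 0 i); rewrite -rowE.
have g0S z : exists c : 'I_k -> R, z = \sum_i C (c i) *: g0 i.
  have [r /D0P[y yr] rz] := cls_repr z; exists (fun i => y 0 i).
  have := cls_mul _ _ _ g0P y; rewrite yr => rz'.
  have := clsD _ _ _ _ rz (clsZ (-1) _ _ rz'); rewrite scaleN1r subrr rmorphN1 scaleN1r.
  by move=> /cls_eq0[_ /(_ erefl)] /eqP; rewrite subr_eq0 => /eqP.
(* New generators replace [g0], because the matrix of t on arbitrary generators need not be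
   topologically nilpotent. *)
have [n' [B' [h [B'n hvar hS]]]] := nilpotent_presentation g0S.
have /choice[d dP] p : exists r, peval P (Cm r) = 0 /\ cls r (h p).
  by have [r r0 rh] := cls_repr (h p); exists r.
pose P' := Build_presentation B'n hvar hS.
pose D : 'M[R]_(n', prank P) := \matrix_p d p.
have Dh : forall p, cls (row p D) (h p) by move=> p; rewrite rowK; exact: (dP p).2.
have Dcls (y : 'rV[R]_n') : cls (y *m D) (peval P' (Cm y)).
  by rewrite peval_cst; exact: cls_mul.
exists P', D; split.
- move=> r; split=> [r0|[y <-]]; last first.
    by have /class_mem/kerP := Dcls y.
  have [z rz] := cls_exists r r0; have [c zE] := hS z.
  exists (\row_p c p); have := Dcls (\row_p c p); rewrite peval_cst.
  rewrite (eq_bigr (fun p => C (c p) *: h p)) => [|p _]; last by rewrite mxE.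
  rewrite -zE => rz'; apply/eqP; rewrite -subr_eq0; apply/eqP.
  have := clsD _ _ _ _ rz' (clsZ (-1) _ _ rz); rewrite rmorphN1 !scaleN1r subrr.
  by move=> /cls_eq0[/(_ erefl)].
- by move=> y; rewrite (cls_eq0 _ _ (Dcls y)).
(* Modulo W, row p of either side represents t h_p; their difference is a constant row in W, so it
   is zero by [WC]. *)
apply/row_matrixP => p; rewrite row_mul linearD /= row_mul -!map_row rowK.
apply/esym/eqP; rewrite -subr_eq0; apply/eqP/WC.
have dh : class_of (Cm (d p)) (h p) by exact: (dP p).2.
have tdh := class_lin t dh c0; rewrite !addr0 in tdh.
have := Dcls (row p B'); rewrite peval_cst (eq_bigr (fun q => C (B' p q) *: h q)) => [|q _].
  rewrite -hvar => bh; have := class_lin (-1) bh tdh.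
  rewrite !scaleN1r addNr addrC => cl.
  have /(class_eq0 cl)/WP[q qE] : 0 = 0 :> subquotient Z W by [].
  apply/WP; exists (q - Cm (map_mx sigma (d p))).
  rewrite row_shiftD row_shiftN qE mx_var_cst mx_cstD mx_cstN mx_cstD.
  rewrite /row_shift !mx_cstM opprB addrAC; congr (_ - _).
  by rewrite addrC addrA subrK.
by rewrite mxE.
Qed.

Lemma row_shift_eq0 n (B : 'M[R]_n) q r : topologically_nilpotent B ->
  row_shift B q + Cm r = 0 -> q = 0 /\ r = 0.
Proof.
move=> nB /eqP; rewrite addr_eq0 -mx_cstN => /eqP/(row_division_unique nB)[-> /eqP].
by rewrite oppr_eq0 => /eqP.
Qed.

Lemma col_shift_eq0 n (B : 'M[R]_n) u r : topologically_nilpotent B ->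
  col_shift B u + Cm r = 0 -> u = 0 /\ r = 0.
Proof.
move=> nB /eqP; rewrite addr_eq0 -mx_cstN => /eqP/(col_division_unique nB)[-> /eqP].
by rewrite oppr_eq0 => /eqP.
Qed.

Lemma presentation_tower (P : presentation) :
  exists (st : nat -> presentation) (D : forall i, 'M[R]_(prank (st i.+1), prank (st i))),
    st 0%N = P /\ forall i, next_presentation (D i).
Proof.
pose nx Q := cid (next_presentation_exists Q).
pose st i := iter i (fun Q => sval (nx Q)) P.
by exists st, (fun i => sval (cid (svalP (nx (st i))))); split=> // i;
  exact: (svalP (cid (svalP (nx (st i))))).
Qed.

(** * The cone of t - B *)

Section Tower.
Variables (st : nat -> presentation).
Variable D : forall i, 'M[R]_(prank (st i.+1), prank (st i)).
Hypothesis DP : forall i, next_presentation (D i).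
Local Notation n i := (prank (st i)).
Local Notation B i := (pmat (st i)).
Local Notation sD i := (map_mx sigma (D i)).
Local Notation M := (pmod (st 0%N)).

Lemma tower_exact i (x : 'rV[R]_(n i.+1)) : x *m D i = 0 <-> exists y, y *m D i.+1 = x.
Proof. by rewrite (next_ker (DP i)) (next_exact (DP i.+1)). Qed.

Lemma tower_diffK i : D i.+1 *m D i = 0.
Proof.
by apply/row_matrixP => k; rewrite row_mul row0 rowE; apply/tower_exact; exists (delta_mx 0 k).
Qed.

Lemma tower_comm i : B i.+1 *m D i = sD i *m B i + map_mx delta (D i).
Proof. exact: next_comm (DP i). Qed.

Definition tower_resolution : mx_resolution (restrict_scalars C M).
Proof.
refine (@Build_mx_resolution R (restrict_scalars C M) (fun i => n i) D (@pgen (st 0%N)) _ _ tower_exact).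
- move=> y; have [x <-] := peval_surj (P := st 0%N) y; exists x; rewrite peval_cst; by [].
- by move=> x; rewrite -(next_exact (DP 0%N)) peval_cst.
Defined.

(** The cone of t - B as a map from the complex with differentials sigma(D i) to the one with
    differentials D i; [row_shift_comm] says that it is a chain map. *)
Definition shift_cone_obj i : lmodType S :=
  if i is j.+1 then ('rV[S]_(n j.+1) * 'rV[S]_(n j))%type else 'rV[S]_(n 0%N).

Definition shift_cone_top i : {linear ('rV[S]_(n i.+1) * 'rV[S]_(n i))%type -> 'rV[S]_(n i)} :=
  pair_sum (rowmul (Cm (D i))) (row_shift_lin (B i)).

Definition shift_cone_map i : {linear shift_cone_obj i.+1 -> shift_cone_obj i} :=
  match i return {linear shift_cone_obj i.+1 -> shift_cone_obj i} with
  | 0%N => shift_cone_top 0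
  | j.+1 => pair_lin (shift_cone_top j.+1) (pair_sum (zero_lin _ _) (rowmul (Cm (- sD j))))
  end.

Lemma shift_cone_topE i x y : shift_cone_top i (x, y) = x *m Cm (D i) + row_shift (B i) y.
Proof. by []. Qed.

Lemma shift_cone_mapE i x y : shift_cone_map i.+1 (x, y) =
  (x *m Cm (D i.+1) + row_shift (B i.+1) y, - (y *m Cm (sD i))).
Proof. by rewrite /= mx_cstN mulmxN add0r. Qed.

Lemma shift_cone_top_ker i x y : shift_cone_top i (x, y) = 0 <->
  exists q r, (x, y) = (r *m Cm (D i.+1) + row_shift (B i.+1) q, - (q *m Cm (sD i))).
Proof.
rewrite shift_cone_topE; split=> [xy0|[q [r [-> ->]]]]; last first.
  rewrite mulmxDl -mulmxA -mx_cstM tower_diffK mx_cst0 mulmx0 add0r.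
  by rewrite (row_shift_comm _ (tower_comm i)) row_shiftN subrr.
(* After dividing x by t - B, the equation is a multiple of t - B plus a constant; uniqueness
   determines y and leaves r D = 0, which is solved over R. *)
have [q [r xE]] := row_division x (@pnilp (st i.+1)).
move: xy0; rewrite xE mulmxDl (row_shift_comm _ (tower_comm i)) -mx_cstM addrAC -row_shiftD.
case/(row_shift_eq0 (@pnilp (st i))) => /eqP; rewrite addrC addr_eq0 => /eqP -> /tower_exact[r' rE].
by exists q, (Cm r'); rewrite -rE mx_cstM addrC.
Qed.

Lemma shift_cone_exact i x : shift_cone_map i x = 0 <-> exists y, shift_cone_map i.+1 y = x.
Proof.
have [e1 e2] : (forall y, shift_cone_map i (shift_cone_map i.+1 y) = 0) /\
    (forall x, shift_cone_map i x = 0 -> exists y, shift_cone_map i.+1 y = x).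
  case: i x => [|i] _; split.
  - by move=> [x y]; rewrite shift_cone_mapE; apply/shift_cone_top_ker; exists y, x.
  - by move=> [x y] /shift_cone_top_ker[q [r ->]]; exists (r, q); rewrite shift_cone_mapE.
  - move=> [x y]; rewrite [shift_cone_map i.+2 _]shift_cone_mapE [LHS]shift_cone_mapE; apply: pair_eqI; last first.
      by rewrite /= mulNmx opprK -mulmxA -mx_cstM -map_mxM tower_diffK map_mx0 mx_cst0 mulmx0.
    by apply/(shift_cone_top_ker (i := i.+1)); exists y, x.
  - move=> [x y]; rewrite shift_cone_mapE => /(congr1 fst)/= /(shift_cone_top_ker (i := i.+1))[q [r ->]].
    by exists (r, q); exact: (@shift_cone_mapE i.+1).
by split=> [/e2|[y <-]].
Qed.

Lemma shift_cone_exact0 x : peval (st 0%N) x = 0 <-> exists y, shift_cone_map 0 y = x.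
Proof.
split=> [x0|[[y q] <-]]; last first.
  rewrite [shift_cone_map 0 _]shift_cone_topE linearD peval_shift addr0.
  rewrite -[LHS]/((peval (st 0%N) \o rowmul (Cm (D 0))) y) row_linE rowcombE.
  apply: big1 => k _; rewrite -[RHS](scaler0 _ (y 0 k)); congr (_ *: _).
  rewrite /= -mx_cst_delta -mx_cstM.
  by apply/(next_exact (DP 0%N)); exists (delta_mx 0 k).
have [q [r xE]] := row_division x (@pnilp (st 0%N)).
move: x0; rewrite xE linearD peval_shift add0r => /(next_exact (DP 0%N))[y yr].
by exists (Cm y, q); rewrite [LHS]shift_cone_topE -mx_cstM yr addrC.
Qed.

Lemma shift_cone_projective i : projective (shift_cone_obj i).
Proof. by case: i => [|i]; [|apply: projective_prod]; exact: row_projective. Qed.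

Lemma shift_cone_surj x : exists y, peval (st 0%N) y = x.
Proof. by have [r <-] := peval_surj (P := st 0%N) x; exists (Cm r). Qed.

Definition shift_cone_resolution : projective_resolution M :=
  @Build_projective_resolution S M shift_cone_obj shift_cone_map (peval (st 0%N))
    shift_cone_projective shift_cone_surj shift_cone_exact0 shift_cone_exact.

(** A column killed by t - B is zero, by uniqueness in column division. *)
Lemma shift_cone_Ext0 : Ext_vanish 0 M.
Proof.
apply/(Ext_vanishP shift_cone_resolution) => v /cocycleP vZ; apply/coboundary0P.
pose f : {linear 'rV[S]_(n 0%N) -> S^o} := of_dual v.
suff c0 : coords f = 0 by move=> x; rewrite -[LHS](coordsK f) c0 colfunE mulmx0 mxE.
have [] // := @col_shift_eq0 _ (B 0) (coords f) 0 (@pnilp (st 0%N)).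
rewrite mx_cst0 addr0; apply: col_eq => q.
rewrite -row_shift_mul -[LHS]/(colfun (coords f) _) coordsK mulmx0 mxE.
rewrite -[RHS](vZ (0, q)) /f; congr (of_dual v _).
by rewrite [RHS]shift_cone_topE mul0mx add0r.
Qed.

Definition shift_cone_boundary i : 'cV[S]_(n i) -> Prop :=
  match i with
  | 0%N => fun w => w = 0
  | j.+1 => fun w => exists u, w = Cm (sD j) *m u
  end.

Lemma pair_coords a b (f : {linear ('rV[S]_a * 'rV[S]_b)%type -> S^o}) :
  exists (c : 'cV[S]_a) (c' : 'cV[S]_b), forall x y, f (x, y) = (x *m c + y *m c') 0 0.
Proof.
exists (coords (f \o pair_lin (@idfun _) (zero_lin _ _))).
exists (coords (f \o pair_lin (zero_lin _ _) (@idfun _))) => x y.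
rewrite mxE -[X in _ = X + _]colfunE -[X in _ = _ + X]colfunE !coordsK /= -linearD.
by congr (f _); apply: pair_eqI; rewrite /= ?addr0 ?add0r.
Qed.

Lemma shift_cone_coboundary i (c : 'cV[S]_(n i.+1)) (c' : 'cV[S]_(n i))
    (v : dual (shift_cone_obj i.+1)) :
  (forall x y, of_dual v (x, y) = (x *m c + y *m c') 0 0) ->
  v \in coboundaries shift_cone_resolution i.+1 <->
  exists u w, [/\ c = Cm (D i) *m u, c' = col_shift (B i) u + w & shift_cone_boundary w].
Proof.
move=> vE; rewrite coboundarySP; split.
  case=> g gE.
  have {gE} : forall x y, (x *m c + y *m c') 0 0 = g (shift_cone_map i (x, y)).
    by move=> x y; rewrite -vE; exact: gE.
  have split (u : 'cV[S]_(n i)) (w : 'cV[S]_(n i)) :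
      (forall x y, (x *m c + y *m c') 0 0 =
         ((x *m Cm (D i) + row_shift (B i) y) *m u + y *m w) 0 0) ->
      c = Cm (D i) *m u /\ c' = col_shift (B i) u + w.
    move=> E; split; apply: col_eq => q.
      by have := E q 0; rewrite !mul0mx row_shift0 !addr0 -mulmxA.
    by have := E 0 q; rewrite !mul0mx !add0r row_shift_mul -mulmxDr.
  case: i c c' v vE g split => [|i] c c' v vE g split gE.
    pose f : {linear 'rV[S]_(n 0%N) -> S^o} := g.
    have [x y|-> ->] := split (coords f) 0; last by exists (coords f), 0.
    by rewrite gE mulmx0 addr0 -[RHS]/(colfun (coords f) _) coordsK.
  have [u [u' uE]] := pair_coords (g : {linear ('rV[S]_(n i.+1) * 'rV[S]_(n i))%type -> S^o}).
  have [x y|-> ->] := split u (- (Cm (sD i) *m u')).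
    by rewrite gE [shift_cone_map _ _]shift_cone_mapE uE mulmxN mulNmx mulmxA.
  by exists u, (- (Cm (sD i) *m u')); split=> //; exists (- u'); rewrite mulmxN.
case=> u [w [cE c'E]] wB.
suff [g gE] : exists g : {linear shift_cone_obj i -> S^o}, forall x y,
    g (shift_cone_map i (x, y)) = ((x *m Cm (D i) + row_shift (B i) y) *m u + y *m w) 0 0.
  exists g => -[x y]; rewrite [LHS]vE [RHS]gE cE c'E mulmxDl row_shift_mul !mulmxDr mulmxA.
  by rewrite addrA.
case: i c c' v vE u w cE c'E wB => [|i] c c' v vE u w cE c'E wB.
  have -> : w = 0 by exact: wB.
  by exists (colfun u) => x y; rewrite mulmx0 addr0.
have [u' wE] : exists u', w = Cm (sD i) *m u' := wB; exists (pair_sum (colfun u) (colfun (- u'))) => x y.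
rewrite [shift_cone_map _ _]shift_cone_mapE [LHS]pair_sumE !colfunE wE [RHS]mxE.
by rewrite mulmxN mulNmx opprK mulmxA.
Qed.

Lemma shift_cone_ExtS i : Ext_vanish i.+1 M <->
  forall (c : 'cV[S]_(n i.+1)) (c' : 'cV[S]_(n i)),
    Cm (D i.+1) *m c = 0 -> col_shift (B i.+1) c = Cm (sD i) *m c' ->
    exists u w, [/\ c = Cm (D i) *m u, c' = col_shift (B i) u + w & shift_cone_boundary w].
Proof.
rewrite (Ext_vanishP shift_cone_resolution); split=> [ex c c' Dc Bc|ex v /cocycleP vZ].
  pose f : {linear shift_cone_obj i.+1 -> S^o} := pair_sum (colfun c) (colfun c').
  have fE x y : of_dual (to_dual f) (x, y) = (x *m c + y *m c') 0 0.
    by rewrite of_to_dual [LHS]pair_sumE !colfunE [RHS]mxE.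
  apply: (shift_cone_coboundary fE).1; apply: ex; apply/cocycleP => -[x y].
  rewrite [res_diff _ _ _]shift_cone_mapE [LHS]fE mulmxDl -mulmxA Dc mulmx0 add0r.
  by rewrite row_shift_mul Bc mulNmx mulmxA subrr mxE.
have [c [c' vE]] := pair_coords (of_dual v : {linear ('rV[S]_(n i.+1) * 'rV[S]_(n i))%type -> S^o}).
have E x y : ((x *m Cm (D i.+1) + row_shift (B i.+1) y) *m c - y *m Cm (sD i) *m c') 0 0 = 0.
  by rewrite -mulNmx -vE -[RHS](vZ (x, y)) [res_diff _ _ _]shift_cone_mapE.
apply: (shift_cone_coboundary vE).2; apply: ex.
  apply: col_eq => q; have := E q 0.
  by rewrite row_shift0 addr0 !mul0mx subr0 -mulmxA => ->; rewrite mulmx0 mxE.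
apply/eqP; rewrite -subr_eq0; apply/eqP/col_eq => q.
by rewrite mulmxBr mulmx0 [RHS]mxE -row_shift_mul mulmxA -[RHS](E 0 q) mul0mx add0r.
Qed.

Lemma map_sigma_eq0 a b (v : 'M[R]_(a, b)) : map_mx sigma v = 0 -> v = 0.
Proof.
move=> v0; rewrite -[v]map_sigma_K v0; apply/matrixP => i j; rewrite !mxE.
exact: sV0.
Qed.

(** Column division brings each cocycle of the dual cone to the form (0, r) with r constant, modulo
    coboundaries. The differential acting on r is sigma(D), so sigma^-1(r) is a cocycle over R. *)
Lemma tower_Ext i : Ext_vanish i.+1 M <-> Ext_vanish i (restrict_scalars C M : lmodType R).
Proof.
rewrite shift_cone_ExtS (mx_Ext_vanish tower_resolution); split=> ex.
  move=> v Dv.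
  have [||u [w [_ vE wB]]] := ex 0 (Cm (map_mx sigma v)).
  - by rewrite mulmx0.
  - by rewrite col_shift0 -mx_cstM -map_mxM [D i *m v]Dv map_mx0 mx_cst0.
  case: i v Dv u w vE wB ex => [|i] v Dv u w vE /= wB _.
    move: vE; rewrite wB addr0 => /esym/(col_division_unique (@pnilp (st 0%N)))[_].
    exact: map_sigma_eq0.
  case: wB => u' wE; have [q [r u'E]] := col_division u' (@pnilp (st i)).
  (* Dividing [u'] splits the equation into a multiple of t - B and a constant column; uniqueness
     makes the constant column v = D sigma^-1(r), up to sigma, vanish as a difference. *)
  exists (map_mx sigmaV r); apply/eqP; rewrite -subr_eq0; apply/eqP/map_sigma_eq0.
  rewrite map_mxB map_mxM map_sigmaV_K.
  have [] // := @col_shift_eq0 _ (B i.+1) (- u - Cm (D i) *m q)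
    (map_mx sigma v - sD i *m r) (@pnilp (st i.+1)).
  rewrite mx_cstD vE wE u'E mulmxDr -(col_shift_comm _ (tower_comm i)) mx_cstN mx_cstM.
  rewrite col_shiftD !col_shiftN [in X in _ + X]addrA addrK.
  by rewrite -opprD addNr.
move=> c c' Dc Bc; have [u [r c'E]] := col_division c' (@pnilp (st i)).
exists u, (Cm r).
have [|e0 r0] := @col_division_unique _ (B i.+1) (c - Cm (D i) *m u) (sD i *m r) (@pnilp (st i.+1)).
  rewrite col_shiftD col_shiftN Bc c'E (col_shift_comm _ (tower_comm i)) mulmxDr mx_cstM.
  by rewrite addrAC subrr add0r.
split=> //; first by apply/eqP; rewrite -subr_eq0; apply/eqP.
have Dr : D i *m map_mx sigmaV r = 0.
  by apply: map_sigma_eq0; rewrite map_mxM map_sigmaV_K.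
have := ex _ Dr; case: i {c c' Dc Bc c'E u e0 r0 ex Dr} r => [|i] r /=.
  by move=> r0; rewrite -[r]map_sigmaV_K [map_mx sigmaV r]r0 map_mx0 mx_cst0.
case=> w wE; exists (Cm (map_mx sigma w)).
by rewrite -mx_cstM -map_mxM -[r]map_sigmaV_K [map_mx sigmaV r]wE.
Qed.
End Tower.

(* A module with a resolution F over R has the cone of t - B on S tensor F as a
   resolution over S, whence a shift of Ext by one degree. *)
Lemma Ext_shift (M : lmodType S) :
  finitely_generated (restrict_scalars C M : lmodType R) ->
  Ext_vanish 0 M /\
  forall i, Ext_vanish i.+1 M <-> Ext_vanish i (restrict_scalars C M : lmodType R).
Proof.
case=> r [g gS]; have [n [B [h [nB hvar hS]]]] := @nilpotent_presentation M r g gS.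
have [st [D [E DP]]] := presentation_tower (Build_presentation nB hvar hS).
rewrite -[M]/(pmod (Build_presentation nB hvar hS)) -E; split; first exact: (shift_cone_Ext0 DP).
by move=> i; exact: (tower_Ext DP).
Qed.

End Division.

(** * Submodules over S and over R *)

Section Restriction.
Variables (R S : pzRingType) (f : {rmorphism R -> S}) (M : lmodType S).

Lemma fg_restrict : finitely_generated (restrict_scalars f M : lmodType R) -> finitely_generated M.
Proof.
case=> n [g gS]; exists n, g => x; have [c xE] := gS x.
by exists (fun i => f (c i)); exact: xE.
Qed.

(** Restricting a submodule and taking a submodule of the restriction give different types,
    identified by a bijective linear map. *)
Lemma restrict_submodule (W : submodClosed M) :
  exists (V : submodClosed (restrict_scalars f M : lmodType R))
    (h : {linear (restrict_scalars f (submodule W) : lmodType R) -> submodule V}),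
    (forall x, h x = 0 -> x = 0) /\ (forall y, exists x, h x = y).
Proof.
pose V : submodClosed (restrict_scalars f M : lmodType R) :=
  @submod_of R (restrict_scalars f M) (fun x => (x : M) \in W) (rpred0 W)
    (fun x y => @rpredD _ W x y) (fun a x => @rpredZ _ _ W (f a) x).
have hV (x : restrict_scalars f (submodule W) : lmodType R) :
  restrict_lin f (submodule_val W) x \in V by apply/submod_ofP; exact: valP.
exists V, (corestrict hV); split=> [x x0|[y yV]].
  by apply: val_inj; exact: (congr1 val x0).
have yW : (y : M) \in W by move/submod_ofP: (yV).
by exists (exist (fun x => x \in W) (y : M) yW); exact: val_inj.
Qed.
End Restriction.

(** [codim_category] speaks of submodules only, so M has to be reached as one of them. *)
Lemma full_submod (A : pzRingType) (M : lmodType A) :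
  exists W : submodClosed M, forall x, x \in W.
Proof.
by exists (@submod_of A M setT I (fun _ _ _ _ => I) (fun _ _ _ => I)) => x; apply/submod_ofP.
Qed.

Theorem proposition3p2
    (R : topologicalPzRingType) (sigma : {rmorphism R -> R}) (sigmaV delta : R -> R)
    (S : pzRingType) (HS : skew_power_series_ring sigma delta S) :
  noetherian R -> left_pseudocompact R ->
  topological_automorphism sigma sigmaV ->
  left_sigma_derivation sigma delta -> continuous delta ->
  sigma_nilpotent delta sigma sigmaV ->
  noetherian S -> auslander_regular R -> auslander_regular S ->
  forall (j : nat) (M : lmodType S),
    let M_R : lmodType R := restrict_scalars (sps_const HS) M in
    (codim_category j M_R /\ finitely_generated M_R) <->
    (codim_category j.+1 M /\ finitely_generated M_R).
Proof.
move=> [nR nRc] pcR sigmaP deltaP delta_cont nilp _ [regR regRc] _ j M M_R.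
have fil := skew_filtration_exists pcR nR sigmaP deltaP delta_cont nilp.
have [sK sVK _ _] := sigmaP; have [hR _ _] := pcR.
have shift (N : lmodType S) :
    finitely_generated (restrict_scalars (sps_const HS) N : lmodType R) ->
    Ext_vanish 0 N /\ forall i, Ext_vanish i.+1 N <->
      Ext_vanish i (restrict_scalars (sps_const HS) N : lmodType R).
  have [mdl <-] := sps_series_model HS hR deltaP.
  exact: (Ext_shift sK sVK deltaP fil nRc nR).
split=> -[[_ vM] fgM]; split=> //; split=> //; first exact: (fg_restrict fgM).
- move=> W i ij; have [V [h [hI hS]]] := restrict_submodule (sps_const HS) W.
  have [k kK hK] := linear_inverse hI hS.
  have fgW : finitely_generated (restrict_scalars (sps_const HS) (submodule W) : lmodType R).
    by apply: (fg_image (f := k) _ (fg_submodule V nR fgM)) => x; exists (h x).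
  have [v0 vS] := shift _ fgW; case: i ij => [//|i] ij.
  by apply/vS/(Ext_vanish_iso _ hI hS); exact: vM.
- move=> V i ij.
  (* V need not be stable under t, so the shift of degrees is applied to M alone and
     [vanish_submodule] passes to V. *)
  have [W WT] := full_submod M; have [_ vS] := shift _ fgM.
  apply: (vanish_submodule nR regR regRc fgM _ ij) => k kj; apply/vS.
  apply: (Ext_vanish_iso (f := submodule_val W) _ _ _).1 (vM W k.+1 kj).
    by move=> x x0; exact: val_inj.
  by move=> x; exists (exist (fun x => x \in W) x (WT x)).
Qed.
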